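(* Let $H$ be a CQG algebra, $V$ a finite-dimensional right $H$-comodule, $d\in[0,\dim V]$ an integer and $\ell\in\mathbb{Z}_{\ge 0}$. Both of the following subsets of $\mathbb{G}(d,V)$ are open in the Zariski topology on $\mathrm{Res}_{\mathbb{C}/\mathbb{R}}\mathbb{G}(d,V)$, and hence dense in the standard (Hausdorff) topology if non-empty: $$\{W\in\mathbb{G}(d,V) : H_{W\le V}\text{ is }\ell\text{-constrained on }W\},$$ $$\{W\in\mathbb{G}(d,V) : H_{W\le V}\text{ is }\ell\text{-constrained on }V\}.$$
   Context: A CQG algebra is a complex Hopf $*$-algebra $H$ all of whose finite-dimensional right comodules $V\to V\otimes H$, $v\mapsto v_0\otimes v_1$, are unitarizable, i.e. admit an inner product with $\langle v_0\mid w\rangle v_1^*=\langle v\mid w_0\rangle S(w_1)$ for all $v,w\in V$ ($S$ the antipode). Morphisms of CQG algebras are Hopf $*$-algebra morphisms. $\mathbb{G}(d,V)$ is the Grassmannian of $d$-dimensional complex linear subspaces of $V$. For a linear subspace $W\le V$, $H\to H_{W\le V}$ denotes the morphism of CQG algebras that is initial among CQG algebra morphisms $H\to H'$ for which $W$ is an $H'$-subcomodule of $V$ (with $V$ regarded as an $H'$-comodule along $H\to H'$); it is a quotient of $H$. For $\ell\in\mathbb{Z}_{\ge0}$, such a Hopf algebra $K$ is $\ell$-constrained on a finite-dimensional right $K$-comodule $X$ if all non-trivial irreducible $K$-comodules appearing as subquotients of $X$ have dimension $\le\ell$. For $\ell=0$ this means that all irreducible subquotients of $X$ are trivial. $\mathrm{Res}_{\mathbb{C}/\mathbb{R}}$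 is Weil restriction: $\mathrm{Res}_{\mathbb{C}/\mathbb{R}}\mathbb{G}(d,V)$ is the real algebraic variety whose real points are the complex points of $\mathbb{G}(d,V)$; its Zariski-closed sets are those locally cut out by real polynomials in the real and imaginary parts of the coordinates. *)

(* Defs.v *)
From HB Require Import structures.
From mathcomp Require Import all_boot all_order all_algebra.
From mathcomp Require Import generic_quotient.
From mathcomp Require Import mathcomp_extra boolp classical_sets reals topology
  normedtype.
From mathcomp.real_closed Require Import complex.
From mathcomp.multinomials Require Import -(notations) mpoly.

Set Implicit Arguments.
Unset Strict Implicit.
Unset Printing Implicit Defensive.

Import Order.TTheory GRing.Theory Num.Theory.
Import numFieldNormedType.Exports.

Local Open Scope ring_scope.
Local Open Scope complex_scope.
Local Open Scope quotient_scope.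

(* Tensor products of (possibly infinite-dimensional) vector spaces: formal
   sums of pairs, two of them being identified when every balanced biadditive
   map takes the same value on both.  Quantifying over all balanced maps into
   abelian groups makes both bilinear and biantilinear maps factor through the
   tensor product. *)
Section Tensor.
Variables (F : comNzRingType) (V W : lmodType F).

Definition balanced (U : zmodType) (f : V -> W -> U) : Prop :=
  [/\ forall x y w, f (x + y) w = f x w + f y w,
      forall v x y, f v (x + y) = f v x + f v y
    & forall c v w, f (c *: v) w = f v (c *: w)].

Definition formal_lift (U : zmodType) (f : V -> W -> U) (s : seq (V * W)) : U :=
  \sum_(p <- s) f p.1 p.2.

Definition tensor_eqv : rel (seq (V * W)) := fun s t =>
  `[< forall (U : zmodType) (f : V -> W -> U), balanced f ->
      formal_lift f s = formal_lift f t >].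

Lemma tensor_eqvP : equiv_class_of tensor_eqv.
Proof.
split=> [s|s t|t s u]; first exact/asboolP.
- by apply/asboolP/asboolP => h U f hf; rewrite h.
- move=> /asboolP h1 /asboolP h2; apply/asboolP => U f hf.
  by rewrite h1 // h2.
Qed.

Canonical tensor_equiv := EquivRelPack tensor_eqvP.

Definition tensor := {eq_quot tensor_eqv}.

HB.instance Definition _ := Choice.on tensor.
HB.instance Definition _ := EqQuotient.on tensor.

Definition tens (v : V) (w : W) : tensor := \pi_tensor [:: (v, w)].

Definition tlift (U : zmodType) (f : V -> W -> U) (t : tensor) : U :=
  formal_lift f (repr t).

Lemma tensor_piP (s t : seq (V * W)) :
  (forall (U : zmodType) (f : V -> W -> U), balanced f ->
     formal_lift f s = formal_lift f t) <-> \pi_tensor s = \pi_tensor t.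
Proof.
split=> [h|/eqquotP/asboolP //]; by apply/eqquotP/asboolP.
Qed.

Lemma tlift_pi (U : zmodType) (f : V -> W -> U) s :
  balanced f -> tlift f (\pi_tensor s) = formal_lift f s.
Proof.
move=> hf; have /tensor_piP h : \pi_tensor (repr (\pi_tensor s)) = \pi_tensor s.
  by rewrite reprK.
exact: h.
Qed.

Lemma tensor_eqP (s t : tensor) :
  (forall (U : zmodType) (f : V -> W -> U), balanced f ->
     tlift f s = tlift f t) -> s = t.
Proof. by move=> h; rewrite -[s]reprK -[t]reprK; apply/tensor_piP. Qed.

Definition tensor_zero : tensor := \pi_tensor [::].
Definition tensor_add (s t : tensor) : tensor := \pi_tensor (repr s ++ repr t).
Definition tensor_scale (c : F) (t : tensor) : tensor :=
  \pi_tensor [seq (c *: p.1, p.2) | p <- repr t].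
Definition tensor_opp (t : tensor) : tensor := tensor_scale (-1) t.

Lemma balanced_scale (U : zmodType) (f : V -> W -> U) c :
  balanced f -> balanced (fun v w => f (c *: v) w).
Proof.
move=> [h1 h2 h3]; split=> [x y w|v x y|d v w].
- by rewrite scalerDr h1.
- by rewrite h2.
- by rewrite scalerA mulrC -scalerA h3.
Qed.

Section Lifts.
Variables (U : zmodType) (f : V -> W -> U).
Hypothesis hf : balanced f.

Lemma tlift0 : tlift f tensor_zero = 0.
Proof. by rewrite tlift_pi // /formal_lift big_nil. Qed.

Lemma tlift_add s t : tlift f (tensor_add s t) = tlift f s + tlift f t.
Proof. by rewrite tlift_pi // /formal_lift big_cat. Qed.

Lemma tlift_scale c t :
  tlift f (tensor_scale c t) = tlift (fun v w => f (c *: v) w) t.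
Proof. by rewrite tlift_pi // /formal_lift big_map. Qed.

Lemma balancedNl v w : f (- v) w = - f v w.
Proof.
case: hf => h1 _ _; have f0 : f 0 w = 0.
  by apply: (addrI (f 0 w)); rewrite -h1 !addr0.
by apply/eqP; rewrite -addr_eq0 -h1 addNr f0.
Qed.

Lemma tlift_opp t : tlift f (tensor_opp t) = - tlift f t.
Proof.
rewrite tlift_scale /tlift /formal_lift -sumrN.
by apply: eq_bigr => p _; rewrite scaleN1r balancedNl.
Qed.
End Lifts.

Lemma tensor_addA : associative tensor_add.
Proof. by move=> s t u; apply: tensor_eqP => U f hf; rewrite !tlift_add // addrA. Qed.
Lemma tensor_addC : commutative tensor_add.
Proof. by move=> s t; apply: tensor_eqP => U f hf; rewrite !tlift_add // addrC. Qed.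
Lemma tensor_add0 : left_id tensor_zero tensor_add.
Proof. by move=> s; apply: tensor_eqP => U f hf; rewrite tlift_add // tlift0 // add0r. Qed.
Lemma tensor_addN : left_inverse tensor_zero tensor_opp tensor_add.
Proof.
by move=> s; apply: tensor_eqP => U f hf; rewrite tlift_add // tlift_opp // tlift0 // addNr.
Qed.

HB.instance Definition _ :=
  GRing.isZmodule.Build tensor tensor_addA tensor_addC tensor_add0 tensor_addN.

Lemma tensor_scaleA c d t :
  tensor_scale c (tensor_scale d t) = tensor_scale (c * d) t.
Proof.
apply: tensor_eqP => U f hf; rewrite !tlift_scale //; last exact: balanced_scale.
by rewrite /tlift /formal_lift; apply: eq_bigr => p _; rewrite scalerA.
Qed.
Lemma tensor_scale1 : left_id 1 tensor_scale.
Proof.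
move=> t; apply: tensor_eqP => U f hf; rewrite tlift_scale //.
by rewrite /tlift /formal_lift; apply: eq_bigr => p _; rewrite scale1r.
Qed.
Lemma tensor_scaleDr : right_distributive tensor_scale +%R.
Proof.
move=> c s t; apply: tensor_eqP => U f hf.
have hcf := balanced_scale c hf.
by rewrite tlift_scale // [LHS]tlift_add // [RHS]tlift_add // !tlift_scale.
Qed.
Lemma tensor_scaleDl t : {morph (tensor_scale^~ t) : a b / a + b}.
Proof.
move=> a b; apply: tensor_eqP => U f hf.
rewrite [RHS]tlift_add // !tlift_scale // /tlift /formal_lift -big_split /=.
by case: hf => h1 _ _; apply: eq_bigr => p _; rewrite scalerDl h1.
Qed.

HB.instance Definition _ := GRing.Zmodule_isLmodule.Build F tensor
  tensor_scaleA tensor_scale1 tensor_scaleDr tensor_scaleDl.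

Lemma tlift_tens (U : zmodType) (f : V -> W -> U) v w :
  balanced f -> tlift f (tens v w) = f v w.
Proof. by move=> hf; rewrite tlift_pi // /formal_lift big_seq1. Qed.

Lemma tliftD (U : zmodType) (f : V -> W -> U) s t :
  balanced f -> tlift f (s + t) = tlift f s + tlift f t.
Proof. by move=> hf; rewrite tlift_add. Qed.

Lemma tlift_is0 (U : zmodType) (f : V -> W -> U) :
  balanced f -> tlift f 0 = 0.
Proof. by move=> hf; rewrite tlift0. Qed.

Lemma tlift_sum (U : zmodType) (f : V -> W -> U) (I : Type) (r : seq I) F' :
  balanced f -> tlift f (\sum_(i <- r) F' i) = \sum_(i <- r) tlift f (F' i).
Proof.
move=> hf; apply: (big_morph (tlift f)); last exact: tlift_is0.
by move=> s t; exact: tliftD.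
Qed.

Lemma tliftZ (U : lmodType F) (f : V -> W -> U) c t :
  balanced f -> (forall a v w, f (a *: v) w = a *: f v w) ->
  tlift f (c *: t) = c *: tlift f t.
Proof.
move=> hf hs; rewrite tlift_scale // /tlift /formal_lift scaler_sumr.
by apply: eq_bigr => p _; rewrite hs.
Qed.

Lemma tens_balanced : balanced tens.
Proof.
split=> [x y w|v x y|c v w]; apply: tensor_eqP => U f hf;
  rewrite ?tliftD // ?tlift_tens //; by case: hf.
Qed.

Lemma tensDl x y w : tens (x + y) w = tens x w + tens y w.
Proof. by case: tens_balanced. Qed.
Lemma tensDr v x y : tens v (x + y) = tens v x + tens v y.
Proof. by case: tens_balanced. Qed.
Lemma tensZl c v w : tens (c *: v) w = c *: tens v w.
Proof.
apply: tensor_eqP => U f hf; rewrite tlift_scale // !tlift_tens //.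
exact: balanced_scale.
Qed.
Lemma tensZr c v w : tens v (c *: w) = c *: tens v w.
Proof. by rewrite -tensZl; case: tens_balanced. Qed.

Lemma tensor_repr (t : tensor) : t = \sum_(p <- repr t) tens p.1 p.2.
Proof.
apply: tensor_eqP => U f hf; rewrite tlift_sum //.
by apply: eq_bigr => p _; rewrite tlift_tens.
Qed.

End Tensor.

Arguments tens {F V W} v w.
Arguments tlift {F V W U} f t.

Notation "V ⊗ W" := (tensor V W) (at level 40, left associativity) : type_scope.
Notation "v ⊗ w" := (tens v w) (at level 40, left associativity) : ring_scope.

(* Sweedler sums: if t = \sum_i a_i ⊗ b_i, then \sw_(a, b <- t) E a b is
   \sum_i E a_i b_i, for E balanced in (a, b). *)
Notation "\sw_ ( a , b <- t ) E" := (tlift (fun a b => E) t)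
  (at level 41, E at level 41, a name, b name, t at level 60,
   format "'[' \sw_ ( a ,  b  <-  t ) '/  '  E ']'") : ring_scope.

Section Bilinear.
Variable F : comNzRingType.

Definition lin (V U : lmodType F) (f : V -> U) : Prop :=
  forall c x y, f (c *: x + y) = c *: f x + f y.

Definition bilin (V W U : lmodType F) (f : V -> W -> U) : Prop :=
  (forall w, lin (f^~ w)) /\ (forall v, lin (f v)).

Lemma linD (V U : lmodType F) (f : V -> U) x y :
  lin f -> f (x + y) = f x + f y.
Proof. by move=> hf; have := hf 1 x y; rewrite !scale1r. Qed.

Lemma lin0 (V U : lmodType F) (f : V -> U) : lin f -> f 0 = 0.
Proof. by move=> hf; apply: (addrI (f 0)); rewrite -linD // !addr0. Qed.

Lemma linZ (V U : lmodType F) (f : V -> U) c x : lin f -> f (c *: x) = c *: f x.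
Proof. by move=> hf; have := hf c x 0; rewrite (lin0 hf) !addr0. Qed.

Lemma lin_linear (V U : lmodType F) (f : {linear V -> U}) : lin f.
Proof. by move=> c x y; rewrite linearP. Qed.

Lemma bilin_balanced (V W U : lmodType F) (f : V -> W -> U) :
  bilin f -> balanced f.
Proof.
move=> [h1 h2]; split=> [x y w|v x y|c v w].
- exact: (linD x y (h1 w)).
- exact: (linD x y (h2 v)).
- by rewrite (linZ c w (h2 v)); exact: (linZ c v (h1 w)).
Qed.

Lemma tlift_lin (V W U : lmodType F) (f : V -> W -> U) :
  bilin f -> lin (tlift f).
Proof.
move=> hf c s t; have hb := bilin_balanced hf.
rewrite tliftD // tliftZ // => a v w.
by case: hf => h1 _; exact: (linZ a v (h1 w)).
Qed.

Lemma bilin_tens (V W V' W' : lmodType F) (f : V -> V') (g : W -> W') :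
  lin f -> lin g -> bilin (fun v w => f v ⊗ g w).
Proof.
move=> hf hg; split=> [w c x y|v c x y].
- by rewrite hf tensDl tensZl.
- by rewrite hg tensDr tensZr.
Qed.

Lemma tlift_fuse (V W V' W' : lmodType F) (U : zmodType) (f : V' -> W' -> U)
    (g : V -> W -> V' ⊗ W') t :
  balanced f -> tlift f (tlift g t) = \sw_(v, w <- t) tlift f (g v w).
Proof. by move=> hf; rewrite [in LHS]/tlift -/(tlift f _) /formal_lift tlift_sum. Qed.

Lemma lin_fuse (V W U U' : lmodType F) (f : U -> U') (g : V -> W -> U) t :
  lin f -> f (tlift g t) = \sw_(v, w <- t) f (g v w).
Proof.
move=> hf; rewrite /tlift /formal_lift.
by apply: (big_morph f) => [x y|]; [exact: linD | exact: lin0].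
Qed.

Lemma tlift_ext (V W : lmodType F) (U : zmodType) (f g : V -> W -> U) t :
  (forall v w, f v w = g v w) -> tlift f t = tlift g t.
Proof. by move=> h; apply: eq_bigr => p _; exact: h. Qed.

Lemma tlift_combine (V W U : lmodType F) (f g : V -> W -> U) c t :
  \sw_(v, w <- t) (c *: f v w + g v w) = c *: tlift f t + tlift g t.
Proof. by rewrite /tlift /formal_lift big_split /= scaler_sumr. Qed.

Lemma bilin_nestl (X Y V W U : lmodType F) (rho : X -> V ⊗ W)
    (g : Y -> V -> W -> U) :
  lin rho -> (forall y, bilin (g y)) -> (forall v w, lin (fun y => g y v w)) ->
  bilin (fun x y => tlift (g y) (rho x)).
Proof.
move=> hr hg hl; split=> [y c a b|x c a b].
- by rewrite hr; exact: tlift_lin.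
- by rewrite -tlift_combine; apply: tlift_ext => v w; exact: hl.
Qed.

Lemma bilin_nestr (X Y V W U : lmodType F) (rho : X -> V ⊗ W)
    (g : Y -> V -> W -> U) :
  lin rho -> (forall y, bilin (g y)) -> (forall v w, lin (fun y => g y v w)) ->
  bilin (fun y x => tlift (g y) (rho x)).
Proof. by move=> hr hg hl; case: (bilin_nestl hr hg hl). Qed.

Lemma lin_tensl (V W : lmodType F) (w : W) : lin (fun v : V => v ⊗ w).
Proof. by move=> c x y; rewrite tensDl tensZl. Qed.

Lemma lin_tensr (V W : lmodType F) (v : V) : lin (fun w : W => v ⊗ w).
Proof. by move=> c x y; rewrite tensDr tensZr. Qed.

Lemma lin_comp (V W U : lmodType F) (f : W -> U) (g : V -> W) :
  lin f -> lin g -> lin (fun x => f (g x)).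
Proof. by move=> hf hg c x y; rewrite hg hf. Qed.

Lemma lin_id (V : lmodType F) : lin (fun x : V => x).
Proof. by []. Qed.

Lemma bilin_compl (V W V' W' U : lmodType F) (b : V' -> W' -> U) (f : V -> V')
    (g : W -> W') :
  bilin b -> lin f -> lin g -> bilin (fun v w => b (f v) (g w)).
Proof.
move=> [h1 h2] hf hg; split=> [w|v].
- exact: (lin_comp (h1 (g w)) hf).
- exact: (lin_comp (h2 (f v)) hg).
Qed.

End Bilinear.

Section HopfStar.
Variable R : realType.
Local Notation C := R[i].

Record hopf_star_algebra := HopfStarAlgebra {
  hopf_alg :> algType C;
  comul : {linear hopf_alg -> (hopf_alg ⊗ hopf_alg)%type};
  counit : {linear hopf_alg -> C^o};
  antipode : {linear hopf_alg -> hopf_alg};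
  star : hopf_alg -> hopf_alg;
  comul_coassoc : forall a : hopf_alg,
    \sw_(x, y <- comul a) \sw_(x1, x2 <- comul x) (x1 ⊗ (x2 ⊗ y)) =
    \sw_(x, y <- comul a) \sw_(y1, y2 <- comul y) (x ⊗ (y1 ⊗ y2));
  counit_left : forall a : hopf_alg, \sw_(x, y <- comul a) ((counit x : C) *: y) = a;
  counit_right : forall a : hopf_alg, \sw_(x, y <- comul a) ((counit y : C) *: x) = a;
  comul1 : comul 1 = 1 ⊗ 1;
  comulM : forall a b : hopf_alg, comul (a * b) =
    \sw_(x, y <- comul a) \sw_(x', y' <- comul b) ((x * x') ⊗ (y * y'));
  counit1 : counit 1 = 1;
  counitM : forall a b : hopf_alg, counit (a * b) = counit a * counit b;
  antipode_left : forall a : hopf_alg,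
    \sw_(x, y <- comul a) (antipode x * y) = (counit a : C)%:A;
  antipode_right : forall a : hopf_alg,
    \sw_(x, y <- comul a) (x * antipode y) = (counit a : C)%:A;
  starD : forall a b : hopf_alg, star (a + b) = star a + star b;
  starZ : forall (c : C) (a : hopf_alg), star (c *: a) = (c^*)%C *: star a;
  starM : forall a b : hopf_alg, star (a * b) = star b * star a;
  starK : forall a : hopf_alg, star (star a) = a;
  comul_star : forall a : hopf_alg,
    comul (star a) = \sw_(x, y <- comul a) (star x ⊗ star y)
}.

Arguments comul {h}.
Arguments counit {h}.
Arguments antipode {h}.
Arguments star {h} _.

Record hopf_star_morphism (H K : hopf_star_algebra) := HopfStarMorphism {
  hopf_morph :> {lrmorphism H -> K};
  morph_comul : forall a : H,
    comul (hopf_morph a) =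
    \sw_(x, y <- comul a) (hopf_morph x ⊗ hopf_morph y);
  morph_counit : forall a : H, counit (hopf_morph a) = counit a;
  morph_antipode : forall a : H, antipode (hopf_morph a) = hopf_morph (antipode a);
  morph_star : forall a : H, star (hopf_morph a) = hopf_morph (star a)
}.

Record is_comodule (H : hopf_star_algebra) (V : vectType C) (rho : V -> V ⊗ H)
    : Prop := IsComodule {
  coact_linear : forall (c : C) v w, rho (c *: v + w) = c *: rho v + rho w;
  coact_coassoc : forall v,
    \sw_(x, h <- rho v) \sw_(y, k <- rho x) (y ⊗ (k ⊗ h)) =
    \sw_(x, h <- rho v) \sw_(h1, h2 <- comul h) (x ⊗ (h1 ⊗ h2));
  coact_counit : forall v, \sw_(x, h <- rho v) ((counit h : C) *: x) = v
}.

(* Linear in the second argument, antilinear in the first: this is what makes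
   both Sweedler sums in [unitarizable] well defined. *)
Record is_inner_product (V : vectType C) (ip : V -> V -> C) : Prop :=
  IsInnerProduct {
  ip_linear : forall v (c : C) x y, ip v (c *: x + y) = c * ip v x + ip v y;
  ip_conj : forall v w, ip w v = ((ip v w)^*)%C;
  ip_pos : forall v, v != 0 -> 0 < ip v v
}.

Definition unitarizable (H : hopf_star_algebra) (V : vectType C)
    (rho : V -> V ⊗ H) : Prop :=
  exists ip : V -> V -> C, is_inner_product ip /\
    forall v w,
      \sw_(v0, v1 <- rho v) (ip v0 w *: star v1) =
      \sw_(w0, w1 <- rho w) (ip v w0 *: antipode w1).

Record cqg_algebra := CQGAlgebra {
  cqg_hopf :> hopf_star_algebra;
  cqg_unitarizable : forall (V : vectType C) (rho : V -> V ⊗ cqg_hopf),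
    is_comodule rho -> unitarizable rho
}.

Definition is_subcomodule (H : hopf_star_algebra) (V : vectType C)
    (rho : V -> V ⊗ H) (W : {vspace V}) : Prop :=
  forall w, w \in W -> exists s : seq (V * H),
    (forall p, p \in s -> p.1 \in W) /\ rho w = \sum_(p <- s) (p.1 ⊗ p.2).

(* The coaction on W: when W is a subcomodule, applying the projection
   vsproj W to the first tensor factor amounts to reading rho w in W ⊗ H. *)
Definition sub_coact (H : hopf_star_algebra) (V : vectType C)
    (rho : V -> V ⊗ H) (W : {vspace V}) : subvs_of W -> subvs_of W ⊗ H :=
  fun w => \sw_(x, h <- rho (vsval w)) (vsproj W x ⊗ h).

Definition push_coact (H K : hopf_star_algebra) (pi : hopf_star_morphism H K)
    (V : vectType C) (rho : V -> V ⊗ H) : V -> V ⊗ K :=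
  fun v => \sw_(x, h <- rho v) (x ⊗ pi h).

Definition is_colinear (H : hopf_star_algebra) (V W : vectType C)
    (rhoV : V -> V ⊗ H) (rhoW : W -> W ⊗ H) (f : 'Hom(V, W)) : Prop :=
  forall v, rhoW (f v) = \sw_(x, h <- rhoV v) (f x ⊗ h).

Definition is_irreducible (H : hopf_star_algebra) (V : vectType C)
    (rho : V -> V ⊗ H) : Prop :=
  (0 < \dim {:V})%N /\
  forall W : {vspace V}, is_subcomodule rho W -> W = 0%VS \/ W = fullv.

(* For an irreducible comodule this says that it is isomorphic to the trivial
   comodule C. *)
Definition is_trivial (H : hopf_star_algebra) (V : vectType C)
    (rho : V -> V ⊗ H) : Prop :=
  forall v, rho v = v ⊗ 1.

(* Y is isomorphic to a quotient A / ker f of a subcomodule A of X. *)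
Definition is_subquotient (H : hopf_star_algebra) (X Y : vectType C)
    (rhoX : X -> X ⊗ H) (rhoY : Y -> Y ⊗ H) : Prop :=
  exists2 A : {vspace X}, is_subcomodule rhoX A &
  exists2 f : 'Hom(subvs_of A, Y),
    is_colinear (@sub_coact H X rhoX A) rhoY f & limg f = fullv.

Definition is_constrained (l : nat) (H : hopf_star_algebra) (X : vectType C)
    (rhoX : X -> X ⊗ H) : Prop :=
  forall (Y : vectType C) (rhoY : Y -> Y ⊗ H),
    is_comodule rhoY -> is_irreducible rhoY -> is_subquotient rhoX rhoY ->
    ~ is_trivial rhoY -> (\dim {:Y} <= l)%N.

(* pi : H -> K is H -> H_{W <= V}. *)
Definition is_stabilizer (H : cqg_algebra) (V : vectType C) (rho : V -> V ⊗ H)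
    (W : {vspace V}) (K : cqg_algebra) (pi : hopf_star_morphism H K) : Prop :=
  is_subcomodule (push_coact pi rho) W /\
  forall (K' : cqg_algebra) (pi' : hopf_star_morphism H K'),
    is_subcomodule (push_coact pi' rho) W ->
    exists g : hopf_star_morphism K K',
      (forall a, g (pi a) = pi' a) /\
      forall g' : hopf_star_morphism K K',
        (forall a, g' (pi a) = pi' a) -> g' =1 g.

End HopfStar.

Arguments comul {R h}.
Arguments counit {R h}.
Arguments antipode {R h}.
Arguments star {R h} _.

Section ComoduleLemmas.
Variables (R : realType) (H : hopf_star_algebra R).
Local Notation C := R[i].

Lemma is_comodule_push (K : hopf_star_algebra R)
    (pi : hopf_star_morphism H K) (V : vectType C) (rho : V -> V ⊗ H) :
  is_comodule rho -> is_comodule (push_coact pi rho).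
Proof.
move=> [hlin hco heps].
have lpi : lin (pi : H -> K) by exact: lin_linear.
have b0 : bilin (fun (x : V) (h : H) => x ⊗ pi h) by exact: bilin_tens.
have lpush : lin (push_coact pi rho) by apply: lin_comp hlin; exact: tlift_lin.
have lD : lin (comul : H -> H ⊗ H) by exact: lin_linear.
have lDK : lin (comul : K -> K ⊗ K) by exact: lin_linear.
split=> [||v]; first exact: lpush.
- move=> v.
  have bpi : bilin (fun h k : H => pi h ⊗ pi k) by exact: bilin_tens.
  pose T (t : (V ⊗ (H ⊗ H))%type) : (V ⊗ (K ⊗ K))%type :=
    \sw_(x, u <- t) (x ⊗ \sw_(h, k <- u) (pi h ⊗ pi k)).
  have lT : lin T by apply/tlift_lin/bilin_tens => //; exact: tlift_lin.
  have TE x h k : T (x ⊗ (h ⊗ k)) = x ⊗ (pi h ⊗ pi k).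
    rewrite /T tlift_tens ?tlift_tens //; first exact: bilin_balanced.
    by apply/bilin_balanced/bilin_tens => //; exact: tlift_lin.
  have bL1 (k : K) : bilin (fun (x : V) (h : K) => x ⊗ (h ⊗ k)).
    by split=> [h|x]; [exact: lin_tensl | apply: lin_comp (lin_tensr _) (lin_tensl _)].
  have bR1 (x : V) : bilin (fun h k : K => x ⊗ (h ⊗ k)).
    by split=> h; apply: lin_comp (lin_tensr _) _; [exact: lin_tensl|exact: lin_tensr].
  have bL : bilin (fun (x : V) (k : K) =>
      \sw_(y, h <- push_coact pi rho x) (y ⊗ (h ⊗ k))).
    apply: (bilin_nestl lpush) => // y h.
    by apply: lin_comp (lin_tensr _) (lin_tensr _).
  have bR : bilin (fun (x : V) (k : K) =>
      \sw_(k1, k2 <- comul k) (x ⊗ (k1 ⊗ k2))).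
    by apply: (bilin_nestr lDK) => // a b; exact: lin_tensl.
  have E := congr1 T (hco v); rewrite !(lin_fuse _ _ lT) in E.
  rewrite [X in tlift _ X = tlift _ X]/push_coact.
  rewrite !tlift_fuse; [|exact: bilin_balanced ..].
  transitivity (\sw_(x, h <- rho v) T (\sw_(y, k <- rho x) (y ⊗ (k ⊗ h)))).
    apply: tlift_ext => x h; rewrite tlift_tens; last exact: bilin_balanced.
    rewrite (lin_fuse _ _ lT) /push_coact tlift_fuse; last exact: bilin_balanced.
    apply: tlift_ext => y k; rewrite TE tlift_tens //.
    exact: bilin_balanced.
  rewrite {}E; apply: tlift_ext => x h; rewrite (lin_fuse _ _ lT).
  rewrite tlift_tens; last exact: bilin_balanced.
  rewrite morph_comul tlift_fuse; last exact: bilin_balanced.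
  apply: tlift_ext => h1 h2; rewrite TE tlift_tens //.
  exact: bilin_balanced.
- have bc : balanced (fun (x : V) (k : K) => (counit k : C) *: x).
    apply: bilin_balanced; split=> [k|x] c a b.
    + by rewrite scalerDr !scalerA mulrC.
    + by rewrite linearP scalerDl -scalerA.
  rewrite /push_coact tlift_fuse // -[RHS](heps v).
  by apply: tlift_ext => x h; rewrite tlift_tens // morph_counit.
Qed.

Section Sub.
Variables (V : vectType C) (rho : V -> V ⊗ H) (W : {vspace V}).
Hypothesis hrho : is_comodule rho.
Hypothesis hW : is_subcomodule rho W.

Let bP : bilin (fun (x : V) (h : H) => vsproj W x ⊗ h).
Proof. by apply: bilin_tens => //; exact: lin_linear. Qed.

Lemma sub_coactE (w : subvs_of W) :
  \sw_(x, h <- sub_coact rho w) (vsval x ⊗ h) = rho (vsval w).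
Proof.
have bJ : balanced (fun (x : subvs_of W) (h : H) => vsval x ⊗ h).
  by apply/bilin_balanced/bilin_tens => //; exact: lin_linear.
rewrite /sub_coact tlift_fuse //.
have [s [hs ->]] := hW (subvsP w).
rewrite tlift_sum; last first.
  split=> [x y h|x h k|c x h]; rewrite !tlift_tens //.
  - by rewrite linearD linearD tensDl.
  - by rewrite tensDr.
  - by rewrite linearZ linearZ tensZl tensZr.
apply: eq_big_seq => p /hs pW; rewrite tlift_tens ?tlift_tens ?vsprojK //.
split=> [x y h|x h k|c x h]; rewrite !tlift_tens //.
- by rewrite linearD linearD tensDl.
- by rewrite tensDr.
- by rewrite linearZ linearZ tensZl tensZr.
Qed.

Lemma is_comodule_sub : is_comodule (@sub_coact _ H V rho W).
Proof.
case: hrho => hlin hco heps.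
have lsub : lin (@sub_coact _ H V rho W).
  apply: (lin_comp (tlift_lin bP)); apply: (lin_comp hlin).
  exact: lin_linear.
have lp : lin (vsproj W) by exact: lin_linear.
have lD : lin (comul : H -> H ⊗ H) by exact: lin_linear.
split=> [||w]; first exact: lsub.
- move=> w.
  have bT : bilin (fun (x : V) (u : H ⊗ H) => vsproj W x ⊗ u) by exact: bilin_tens.
  pose T (t : (V ⊗ (H ⊗ H))%type) : (subvs_of W ⊗ (H ⊗ H))%type :=
    \sw_(x, u <- t) (vsproj W x ⊗ u).
  have lT : lin T by exact: tlift_lin.
  have TE x u : T (x ⊗ u) = vsproj W x ⊗ u.
    by rewrite /T tlift_tens //; exact: bilin_balanced.
  have bR : bilin (fun (x : subvs_of W) (h : H) =>
      \sw_(h1, h2 <- comul h) (x ⊗ (h1 ⊗ h2))).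
    apply: (bilin_nestr lD) => [y|a b]; last exact: lin_tensl.
    by split=> k; apply: lin_comp (lin_tensr _) _; [exact: lin_tensl|exact: lin_tensr].
  have bL1 (h : H) : bilin (fun (y : subvs_of W) (k : H) => y ⊗ (k ⊗ h)).
    by split=> [k|z]; [exact: lin_tensl | apply: lin_comp (lin_tensr _) (lin_tensl _)].
  have bL : bilin (fun (x : subvs_of W) (h : H) =>
      \sw_(y, k <- sub_coact rho x) (y ⊗ (k ⊗ h))).
    apply: (bilin_nestl lsub) => // a b.
    by apply: lin_comp (lin_tensr _) (lin_tensr _).
  have bL2 (h : H) : bilin (fun (y : V) (k : H) => vsproj W y ⊗ (k ⊗ h)).
    by split=> [k|z]; [exact: (lin_comp (lin_tensl _) lp) |
      apply: lin_comp (lin_tensr _) (lin_tensl _)].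
  have bL3 : bilin (fun (x : V) (h : H) =>
      \sw_(y, k <- rho x) (vsproj W y ⊗ (k ⊗ h))).
    apply: (bilin_nestl hlin) => // a b.
    by apply: lin_comp (lin_tensr _) (lin_tensr _).
  have E := congr1 T (hco (vsval w)).
  rewrite !(lin_fuse _ _ lT) in E.
  transitivity (\sw_(x, h <- rho (vsval w)) T (\sw_(y, k <- rho x) (y ⊗ (k ⊗ h)))).
    rewrite -(sub_coactE w) [RHS]tlift_fuse; last first.
      have := bilin_balanced bL3; congr balanced.
      apply: funext => x; apply: funext => h; rewrite (lin_fuse _ _ lT).
      by apply: tlift_ext => y k; rewrite TE.
    apply: tlift_ext => x h; rewrite tlift_tens; last first.
      have := bilin_balanced bL3; congr balanced.
      apply: funext => x'; apply: funext => h'; rewrite (lin_fuse _ _ lT).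
      by apply: tlift_ext => y k; rewrite TE.
    rewrite /sub_coact tlift_fuse; last exact: bilin_balanced.
    rewrite (lin_fuse _ _ lT); apply: tlift_ext => y k.
    by rewrite TE tlift_tens //; exact: bilin_balanced.
  rewrite {}E /sub_coact tlift_fuse; last exact: bilin_balanced.
  apply: tlift_ext => x h; rewrite tlift_tens; last exact: bilin_balanced.
  by rewrite (lin_fuse _ _ lT); apply: tlift_ext => h1 h2; rewrite TE.
- have bc : balanced (fun (x : subvs_of W) (k : H) => (counit k : C) *: x).
    apply: bilin_balanced; split=> [k|x] c a b.
    + by rewrite scalerDr !scalerA mulrC.
    + by rewrite linearP scalerDl -scalerA.
  rewrite /sub_coact tlift_fuse // -[RHS]vsvalK -[in RHS](heps (vsval w)).
  rewrite (lin_fuse _ _ lp).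
  by apply: tlift_ext => x h; rewrite tlift_tens // linearZ.
Qed.
End Sub.
End ComoduleLemmas.

Section Grassmannian.
Variables (R : realType) (V : vectType R[i]) (d : nat).
Local Open Scope classical_set_scope.

Definition grassmannian := {W : {vspace V} | \dim W == d}.
HB.instance Definition _ := Choice.on grassmannian.

Local Notation m := (\dim {:V} - d)%N.

(* C^(d x m) = R^(dm + dm): real parts, then imaginary parts. *)
Definition complex_mx (x : 'rV[R]_(d * m + d * m)) : 'M[R[i]]_(d, m) :=
  \matrix_(i, j) (x 0 (lshift _ (mxvec_index i j)) +i*
                  x 0 (rshift _ (mxvec_index i j))).

(* The affine chart attached to a basis b of V maps a complex d x m matrix A
   to the span of the rows of (1 | A) in the basis b. *)
Definition chart_space (b : (\dim {:V}).-tuple V) (A : 'M[R[i]]_(d, m))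
    : {vspace V} :=
  <<[seq (b`_i + \sum_(j < m) A i j *: b`_(d + j)%N)%R | i : 'I_d]>>%VS.

Definition is_chart (phi : 'rV[R]_(d * m + d * m) -> grassmannian) : Prop :=
  exists2 b : (\dim {:V}).-tuple V, basis_of fullv b &
    forall x, \val (phi x) = chart_space b (complex_mx x).

Definition zariski_open (n : nat) (U : set 'rV[R]_n) : Prop :=
  exists P : set (mpoly n R),
    U = [set x : 'rV[R]_n | exists2 p, P p & meval (x 0) p != 0].

(* Each topology below is the gluing of the topologies of the affine charts. *)
Definition grass_open (U : set grassmannian) : Prop :=
  forall phi, is_chart phi -> open (phi @^-1` U).

Definition grass_zariski_open (U : set grassmannian) : Prop :=
  forall phi, is_chart phi -> zariski_open (phi @^-1` U).

Lemma dim_chart_space (b : (\dim {:V}).-tuple V) (A : 'M[R[i]]_(d, m)) :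
  (d <= \dim {:V})%N -> basis_of fullv b -> \dim (chart_space b A) = d.
Proof.
move=> led hb.
pose F (i : 'I_d) := b`_i + \sum_(j < m) A i j *: b`_(d + j).
have -> : chart_space b A = <<mktuple F>>%VS.
  by rewrite /chart_space; congr (<<_>>)%VS; rewrite /= val_ord_tuple.
suff /eqP -> : free (mktuple F) by rewrite size_tuple.
apply/freeP => k hk i0.
have := congr1 (coord b (widen_ord led i0)) hk.
have hf := basis_free hb.
rewrite linear_sum linear0 /= (bigD1 i0) //= big1 ?addr0 => [|i nei].
- rewrite linearZ /= nth_mktuple /F linearD /= (coord_free (widen_ord led i0)) //.
  rewrite eqxx linear_sum big1 ?addr0 ?mulr1 // => j _.
  have hj : (d + j < \dim {:V})%N by rewrite -ltn_subRL.
  rewrite linearZ /= (coord_free (Ordinal hj)) // -val_eqE /=.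
  by rewrite gtn_eqF ?mulr0 // ltn_addr.
rewrite linearZ /= nth_mktuple /F linearD /= (coord_free (widen_ord led i)) //.
rewrite -val_eqE /= val_eqE (negPf nei) linear_sum big1 ?addr0 ?mulr0 // => j _.
have hj : (d + j < \dim {:V})%N by rewrite -ltn_subRL.
rewrite linearZ /= (coord_free (Ordinal hj)) // -val_eqE /=.
by rewrite gtn_eqF ?mulr0 // ltn_addr.
Qed.

Lemma chart_exists (b : (\dim {:V}).-tuple V) :
  (d <= \dim {:V})%N -> basis_of fullv b ->
  exists2 phi, is_chart phi &
    forall x, \val (phi x) = chart_space b (complex_mx x).
Proof.
move=> led hb.
have h x : \dim (chart_space b (complex_mx x)) == d.
  by apply/eqP; exact: dim_chart_space.
exists (fun x => exist _ (chart_space b (complex_mx x)) (h x)) => //.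
by exists b.
Qed.

Lemma chart_cover (W : grassmannian) : exists2 phi, is_chart phi & phi 0 = W.
Proof.
have /eqP dW := valP W.
have led : (d <= \dim {:V})%N by rewrite -dW dimvS // subvf.
have sz : size (vbasis (\val W) ++ vbasis (\val W)^C) == \dim {:V}.
  by rewrite size_cat !size_tuple dimv_compl subnKC // dimvS // subvf.
pose b := Tuple sz.
have hb : basis_of fullv b.
  have := cat_basis (introT directv_addP (capv_compl (\val W)))
    (vbasisP (\val W)) (vbasisP (\val W)^C).
  by rewrite addv_complf.
have [phi hphi phiE] := chart_exists led hb.
exists phi => //; apply: val_inj; rewrite phiE /chart_space -[RHS](span_basis (vbasisP _)).
congr (<<_>>)%VS; apply: (@eq_from_nth _ 0) => [|i].
  by rewrite size_map -cardE card_ord size_tuple.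
rewrite size_map -cardE card_ord => hi.
rewrite /image_mem (nth_map (Ordinal hi)) ?size_enum_ord // nth_enum_ord // big1 => [|j _].
  by rewrite addr0 nth_cat size_tuple; case: ltnP => // hle; move: (leq_trans hi (eq_leq (esym dW))); rewrite ltnNge hle.
by rewrite !mxE (_ : 0 +i* 0 = 0) ?scale0r.
Qed.

Lemma zariski_openT n : zariski_open [set: 'rV[R]_n].
Proof.
exists [set (1 : mpoly n R)]; apply/seteqP; split=> // x _.
by exists 1; rewrite ?meval1 ?oner_neq0.
Qed.

Lemma zariski_openI n : setI_closed (@zariski_open n).
Proof.
move=> A B [P ->] [Q ->].
exists [set r | exists p q, [/\ P p, Q q & r = p * q]].
apply/seteqP; split=> [x [[p Pp px] [q Qq qx]]|x [r [p [q [Pp Qq ->]]]]].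
  exists (p * q); first by exists p, q.
  by rewrite mevalM mulf_neq0.
rewrite mevalM mulf_eq0 negb_or => /andP[px qx].
by split; [exists p | exists q].
Qed.

Lemma zariski_open_bigcup n (I : Type) (f : I -> set 'rV[R]_n) :
  (forall i, zariski_open (f i)) -> zariski_open (\bigcup_i f i).
Proof.
move=> hf.
exists [set p | forall x : 'rV[R]_n,
  meval (x 0) p != 0 -> (\bigcup_i f i) x].
apply/seteqP; split=> [x [i _]|x [p hp /hp //]].
have [P fE] := hf i; rewrite {1}fE => -[p Pp px]; exists p => // y py.
by exists i => //; rewrite fE; exists p.
Qed.

Lemma grass_openT : grass_open setT.
Proof. by move=> phi _; rewrite preimage_setT; exact: openT. Qed.
Lemma grass_openI : setI_closed grass_open.
Proof. by move=> A B hA hB phi hp; rewrite preimage_setI; apply: openI; auto. Qed.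
Lemma grass_open_bigcup (I : Type) (f : I -> set grassmannian) :
  (forall i, grass_open (f i)) -> grass_open (\bigcup_i f i).
Proof.
move=> hf phi hp; rewrite preimage_bigcup; apply: bigcup_open => i _.
exact: hf.
Qed.

HB.instance Definition _ :=
  isOpenTopological.Build grassmannian grass_openT grass_openI grass_open_bigcup.

(* The same set of points, with the Zariski topology of the Weil restriction. *)
Definition weil_grassmannian := grassmannian.
HB.instance Definition _ := Choice.on weil_grassmannian.

Lemma grass_zariski_openT : grass_zariski_open setT.
Proof. by move=> phi _; rewrite preimage_setT; exact: zariski_openT. Qed.
Lemma grass_zariski_openI : setI_closed grass_zariski_open.
Proof. by move=> A B hA hB phi hp; rewrite preimage_setI; apply: zariski_openI; auto. Qed.
Lemma grass_zariski_open_bigcup (I : Type) (f : I -> set weil_grassmannian) :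
  (forall i, grass_zariski_open (f i)) -> grass_zariski_open (\bigcup_i f i).
Proof.
move=> hf phi hp; rewrite preimage_bigcup; apply: zariski_open_bigcup => i.
exact: hf.
Qed.

HB.instance Definition _ := isOpenTopological.Build weil_grassmannian
  grass_zariski_openT grass_zariski_openI grass_zariski_open_bigcup.

Lemma grass_openE : open = grass_open. Proof. by []. Qed.
Lemma weil_openE : (open : set (set weil_grassmannian)) = grass_zariski_open.
Proof. by []. Qed.

End Grassmannian.

Section ConstrainedLoci.
Variables (R : realType) (H : cqg_algebra R) (V : vectType R[i]).
Variables (rho : V -> V ⊗ H) (d l : nat).
Local Open Scope classical_set_scope.

(* H -> H_{W <= V} is determined up to unique isomorphism by its universal
   property, so it does not matter which K and pi realize it. *)
Definition constrained_on_sub : set (grassmannian V d) :=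
  [set W | exists (K : cqg_algebra R) (pi : hopf_star_morphism H K),
     is_stabilizer rho (\val W) pi /\
     is_constrained l (@sub_coact R K V (push_coact pi rho) (\val W))].

Definition constrained_on_ambient : set (grassmannian V d) :=
  [set W | exists (K : cqg_algebra R) (pi : hopf_star_morphism H K),
     is_stabilizer rho (\val W) pi /\ is_constrained l (push_coact pi rho)].

End ConstrainedLoci.

Arguments constrained_on_sub {R H V} rho d l _.
Arguments constrained_on_ambient {R H V} rho d l _.

(* Main.v *)
Require Import Defs.
From HB Require Import structures.
From mathcomp Require Import all_boot all_order all_algebra.
From mathcomp Require Import generic_quotient.
From mathcomp Require Import boolp classical_sets reals topology normedtype.
From mathcomp.multinomials Require Import -(notations) mpoly.
From mathcomp.real_closed Require Import complex mxtens.

(** Fix a unitary matrix U of the comodule V.  If P is the orthogonal projection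
    onto W, then W is a subcomodule along H -> H' exactly when P commutes with U
    over H'.  The two-sided ideal I_W generated by the entries of [P, U] is a
    Hopf *-ideal, and H_{W <= V} = H / I_W is again a CQG algebra, because it is
    spanned by entries of unitary corepresentations.

    In a chart of the Grassmannian the entries of P are regular functions of the
    real and imaginary parts of the coordinates.  Every intertwiner T over
    H_{W_0 <= V} extends to a regular family of intertwiners over the
    H_{W <= V}: the values at W_0 of such families form *-algebras whose
    commutators [T, Z], with Z unitary, span an ideal containing I_{W_0}, and the
    bicommutant theorem shows that they are all the intertwiners.

    Finally, a comodule X is l-constrained if and only if X is spanned by its
    invariants and the orbit of l vectors under a single self-intertwiner.  This
    is the non-vanishing of a determinant, which is regular along regular
    families of intertwiners and invariants.  Density follows since any two
    subspaces of the same dimension lie in a common chart. *)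

Set Implicit Arguments.
Unset Strict Implicit.
Unset Printing Implicit Defensive.

Import Order.TTheory GRing.Theory Num.Theory.
Import numFieldNormedType.Exports.

Local Open Scope ring_scope.
Local Open Scope complex_scope.

(** * Linear functionals and inner products *)

Section Separation.
Variables (F : fieldType) (V : lmodType F).

(** The obstacle is that [H_{W <= V}] moves with [W], so that being constrained speaks of the
    comodules of a varying algebra. It is replaced by a finite certificate: an invertible matrix
    built from one self-intertwiner, one matrix of invariants and constant data. The
    self-intertwiner takes distinct values 1, ..., r on the non-trivial irreducible summands, which
    is what lets l vectors generate all of them at once. Openness then becomes a semicontinuity
    statement: at a special [W], such as one that is already a subcomodule over [H], the ideal is
    small and intertwiners are few, and these few have to be continued to the other [W]. A single
    intertwiner at [W_0] is known only through the vanishing of its commutator modulo [I_{W_0}],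
    which gives no formula for a continuation; hence all extendable ones are treated together, as a
    matrix algebra. Averaging is done by orthogonal projection onto a finite-dimensional algebra of
    slices instead of a Haar functional. This one tool gives both the bicommutant theorem and the
    unitarizability of the comodules of a quotient. *)

Definition submodule_pred (U : V -> Prop) : Prop :=
  U 0 /\ forall c x y, U x -> U y -> U (c *: x + y).

Lemma submoduleZ (U : V -> Prop) c x : submodule_pred U -> U x -> U (c *: x).
Proof. by move=> [U0 h] Ux; have := h c x 0 Ux U0; rewrite addr0. Qed.

Lemma submoduleD (U : V -> Prop) x y : submodule_pred U -> U x -> U y -> U (x + y).
Proof. by move=> [U0 h] Ux Uy; have := h 1 x y Ux Uy; rewrite scale1r. Qed.

Lemma submoduleB (U : V -> Prop) x y : submodule_pred U -> U x -> U y -> U (x - y).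
Proof.
by move=> [U0 h] Ux Uy; have := h (-1) y x Uy Ux; rewrite scaleN1r addrC.
Qed.

Lemma submodule_sum (U : V -> Prop) (I : Type) (r : seq I) (P : pred I) f :
  submodule_pred U -> (forall i, P i -> U (f i)) -> U (\sum_(i <- r | P i) f i).
Proof.
move=> sU h; apply: (big_ind U) => //; first by case: sU.
by move=> x y; exact: submoduleD.
Qed.

(* A subspace maximal among those containing U but not a is a hyperplane. *)
Lemma separating_functional (U : V -> Prop) (a : V) :
  submodule_pred U -> ~ U a ->
  exists f : V -> F^o, [/\ lin f, (forall u, U u -> f u = 0) & f a = 1].
Proof.
move=> sU nUa.
(* The last clause is conditional because the union of the empty chain is the empty set, which must
   satisfy [P]. *)
pose P (X : set V) := [/\ forall c x y, X x -> X y -> X (c *: x + y), ~ X a &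
   (exists x, X x) -> forall u, U u -> X u].
have [|A [[Ac nAa AU] Amax]] := @Zorn_bigcup _ P.
  move=> G GP tG; split=> [c x y [X GX Xx] [Y GY Yy]|[X GX Xa]|[x [X GX Xx]] u Uu].
  + have [XY|YX] := tG _ _ GX GY.
      by exists Y => //; case: (GP _ GY) => h _ _; apply: h => //; exact: XY.
    by exists X => //; case: (GP _ GX) => h _ _; apply: h => //; exact: YX.
  + by case: (GP _ GX).
  + by exists X => //; case: (GP _ GX) => _ _; apply=> //; exists x.
have [U0 Uc] := sU.
have A_ne : exists x, A x.
  apply/not_existsP => h; apply: (Amax U); last by split.
  by split=> [x /h //|/(_ 0 U0) /h].
have {}AU := AU A_ne.
have A0 : A 0 by exact: AU.
have sA : submodule_pred A by split.
have key v : exists l, A (v - l *: a).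
  have [Av|nAv] := pselect (A v); first by exists 0; rewrite scale0r subr0.
  (* [X] is the sum of [A] and the line through [v]. By maximality of [A] it contains [a],
     necessarily with a nonzero coefficient on [v]. *)
  pose X : set V := fun x => exists c, A (x - c *: v).
  have AX x : A x -> X x by exists 0; rewrite scale0r subr0.
  have [c Xc] : X a.
    apply: contrapT => nXa; apply: (Amax X).
      split=> [|/(_ v) h]; first exact: AX.
      by apply/nAv/h; exists 1; rewrite scale1r subrr.
    split=> // [c x y [d1 h1] [d2 h2]|_ u Uu]; last exact/AX/AU.
    exists (c * d1 + d2).
    rewrite scalerDl opprD addrACA -scalerA -scalerBr; exact: Ac.
  have c0 : c != 0.
    by apply: contra_notN nAa => /eqP c0; move: Xc; rewrite c0 scale0r subr0.
  exists c^-1; have := submoduleZ (- c^-1) sA Xc.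
  by rewrite scalerBr scalerA mulNr mulVf // !scaleNr scale1r opprK addrC.
pose f v := projT1 (cid (key v)).
have fP v : A (v - f v *: a) by exact: projT2 (cid (key v)).
have f_uniq v l : A (v - l *: a) -> f v = l.
  move=> h; apply: contrapT => /eqP ne; apply: nAa.
  have := submoduleB sA h (fP v).
  rewrite opprB addrC addrA subrK -scalerBl => /(submoduleZ (f v - l)^-1 sA).
  by rewrite scalerA mulVf ?scale1r // subr_eq0.
exists f; split=> [c x y|u Uu|]; apply: f_uniq.
- rewrite scalerDl opprD addrACA -scalerA -scalerBr; exact: Ac.
- by rewrite scale0r subr0; exact: AU.
- by rewrite scale1r subrr.
Qed.

Lemma functionals_separate (x : V) :
  (forall f : V -> F^o, lin f -> f x = 0) -> x = 0.
Proof.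
move=> h; apply: contrapT => nx.
have s0 : submodule_pred (fun y : V => y = 0).
  by split=> // c a b -> ->; rewrite scaler0 addr0.
have [f [lf _ f1]] := separating_functional s0 nx.
by have := h f lf; rewrite f1 => /eqP; rewrite oner_eq0.
Qed.

End Separation.

(** A subspace of largest dimension inside [P] exhausts it, since any missed vector of [P] could be
    adjoined. This turns predicates closed under linear combinations into objects of type
    [{vspace V}]. *)
Lemma vspace_of_submodule (F : fieldType) (V : vectType F) (P : V -> Prop) :
  submodule_pred P -> exists U : {vspace V}, forall x, x \in U <-> P x.
Proof.
move=> [P0 Pc].
pose Q n := `[< exists U : {vspace V}, \dim U = n /\ forall x, x \in U -> P x >].
have Q0 : exists n, Q n.
  exists 0%N; apply/asboolP; exists 0%VS; split; first exact: dimv0.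
  by move=> x; rewrite memv0 => /eqP ->.
have Qb n : Q n -> (n <= \dim {:V})%N.
  by move=> /asboolP[U [<- _]]; exact/dimvS/subvf.
have [n /asboolP[U [dU hU]] nmax] := ex_maxnP Q0 Qb.
exists U => x; split; first exact: hU.
move=> Px; apply: contrapT => /negP nUx.
have : Q (\dim (U + <[x]>)).
  apply/asboolP; exists (U + <[x]>)%VS; split=> // y.
  move=> /memv_addP[u Uu [v /vlineP[k ->] ->]].
  by rewrite addrC; apply: Pc => //; exact: hU.
move=> /nmax; rewrite -dU; apply/negP; rewrite -ltnNge.
rewrite (ltn_leqif (dimv_leqif_sup (addvSl U <[x]>))).
apply: contraNN nUx => /subvP; apply.
by apply: (subvP (addvSr U <[x]>)); exact: memv_line.
Qed.


Section Conjugation.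
Variable R : realType.
Implicit Types a b : R[i].

Lemma conjc_add a b : ((a + b)^*)%C = (a^*)%C + (b^*)%C.
Proof. exact: rmorphD. Qed.

Lemma conjc_mul a b : ((a * b)^*)%C = (a^*)%C * (b^*)%C.
Proof. exact: rmorphM. Qed.

Lemma conjc_sum (I : Type) (r : seq I) (P : pred I) (f : I -> R[i]) :
  ((\sum_(i <- r | P i) f i)^*)%C = \sum_(i <- r | P i) ((f i)^*)%C.
Proof. exact: rmorph_sum. Qed.

End Conjugation.

Section InnerProduct.
Variables (R : realType) (V : vectType R[i]) (ip : V -> V -> R[i]).
Hypothesis hip : is_inner_product ip.

Lemma ip_lin v : lin (ip v : V -> R[i]^o).
Proof. by move=> c x y; exact: (ip_linear hip). Qed.

Lemma ip0r v : ip v 0 = 0. Proof. exact: (lin0 (ip_lin v)). Qed.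

Lemma ipDr v x y : ip v (x + y) = ip v x + ip v y.
Proof. exact: (linD _ _ (ip_lin v)). Qed.

Lemma ipZr v c x : ip v (c *: x) = c * ip v x.
Proof. exact: (linZ _ _ (ip_lin v)). Qed.

Lemma ipBr v x y : ip v (x - y) = ip v x - ip v y.
Proof. by rewrite ipDr -scaleN1r ipZr mulN1r. Qed.

Lemma ip_sumr v (I : Type) (r : seq I) (P : pred I) f :
  ip v (\sum_(i <- r | P i) f i) = \sum_(i <- r | P i) ip v (f i).
Proof. by apply: (big_morph (ip v)) => [x y|]; [exact: ipDr | exact: ip0r]. Qed.

Lemma ipDl v x y : ip (x + y) v = ip x v + ip y v.
Proof. by rewrite (ip_conj hip) ipDr conjc_add -!(ip_conj hip). Qed.

Lemma ipZl v c x : ip (c *: x) v = (c^*)%C * ip x v.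
Proof. by rewrite (ip_conj hip) ipZr conjc_mul -(ip_conj hip). Qed.

Lemma ip_suml v (I : Type) (r : seq I) (P : pred I) f :
  ip (\sum_(i <- r | P i) f i) v = \sum_(i <- r | P i) ip (f i) v.
Proof.
by rewrite (ip_conj hip) ip_sumr conjc_sum; apply: eq_bigr => i _; rewrite -(ip_conj hip).
Qed.

Lemma ip_eq0 v : ip v v = 0 -> v = 0.
Proof.
move=> h; apply/eqP; apply: contraT => /(ip_pos hip); by rewrite h ltxx.
Qed.

Definition orthonormal_seq (s : seq V) : Prop :=
  forall i j, (i < size s)%N -> (j < size s)%N ->
    ip s`_i s`_j = (i == j)%:R.

Lemma orthonormal_proj (s : seq V) v i : orthonormal_seq s -> (i < size s)%N ->
  ip s`_i (v - \sum_(j < size s) ip s`_j v *: s`_j) = 0.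
Proof.
move=> hs hi; rewrite ipBr ip_sumr (bigD1 (Ordinal hi)) //=.
rewrite big1 ?addr0 => [|j]; last first.
  rewrite -val_eqE /= eq_sym => /negPf ne; by rewrite ipZr hs // ne mulr0.
by rewrite ipZr hs // eqxx mulr1 subrr.
Qed.

Lemma orthonormal_free (s : seq V) : orthonormal_seq s -> free s.
Proof.
move=> hs; rewrite -[s]/(tval (in_tuple s)); apply/freeP => k hk i.
have := congr1 (ip s`_i) hk.
rewrite ip0r ip_sumr (bigD1 i) //= ipZr hs // eqxx mulr1 big1 ?addr0 // => j.
by rewrite -val_eqE /= eq_sym => /negPf ne; rewrite ipZr hs // ne mulr0.
Qed.

Lemma gram_schmidt (X : seq V) :
  exists2 s : seq V, orthonormal_seq s & <<s>>%VS = <<X>>%VS.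
Proof.
elim: X => [|v X [s hs sX]]; first by exists [::].
pose p := \sum_(j < size s) ip s`_j v *: s`_j.
pose v' := v - p.
have ps : p \in <<s>>%VS.
  by apply: memv_suml => j _; apply/memvZ/memv_span/mem_nth.
have sp : <<v :: X>>%VS = (<[v']> + <<s>>)%VS.
  rewrite span_cons -sX; apply/eqP; rewrite eqEsubv; apply/andP; split.
    rewrite subv_add addvSr andbT -memvE -[v](subrK p); apply: memv_add => //.
    exact: memv_line.
  rewrite subv_add addvSr andbT -memvE; apply: memv_add; first exact: memv_line.
  by rewrite memvN.
have [v0|vn0] := eqVneq v' 0.
  by exists s => //; rewrite sp v0; apply/esym/addv_idPr; rewrite -memvE mem0v.
have vpos := ip_pos hip vn0.
pose c := (sqrtC (ip v' v'))^-1.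
have c_gt0 : 0 < c by rewrite invr_gt0 sqrtC_gt0.
have cc : (c^*)%C = c by apply/CrealP/gtr0_real.
have so i : (i < size s)%N -> ip s`_i v' = 0 by exact: orthonormal_proj.
have so' i : (i < size s)%N -> ip v' s`_i = 0.
  by move=> hi; rewrite (ip_conj hip) so // conjc0.
exists ((c *: v') :: s); last first.
  rewrite span_cons sp; congr (_ + _)%VS.
  apply/eqP; rewrite eqEsubv -!memvE; apply/andP; split.
    by apply: memvZ; exact: memv_line.
  by rewrite -{1}[v'](scalerK (lt0r_neq0 c_gt0)); apply: memvZ; exact: memv_line.
move=> [|i] [|j] //= hi hj.
- rewrite ipZl ipZr cc mulrA -expr2 /c exprVn sqrtCK mulVf //.
  exact: lt0r_neq0.
- by rewrite ipZl so' // mulr0.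
- by rewrite ipZr so // mulr0.
- by rewrite hs.
Qed.

End InnerProduct.

(** * Matrix algebras closed under adjoints: expectation and bicommutant *)

Section AdjointMatrix.
Variable R : realType.
Local Notation C := R[i].

Definition adj m n (A : 'M[C]_(m, n)) : 'M[C]_(n, m) := map_mx conjc A^T.

Lemma adjE m n (A : 'M[C]_(m, n)) i j : adj A i j = ((A j i)^*)%C.
Proof. by rewrite !mxE. Qed.

Lemma adjK m n (A : 'M[C]_(m, n)) : adj (adj A) = A.
Proof. by apply/matrixP => i j; rewrite !adjE conjcK. Qed.

Lemma adjM m n p (A : 'M[C]_(m, n)) (B : 'M[C]_(n, p)) :
  adj (A *m B) = adj B *m adj A.
Proof. by rewrite /adj trmx_mul map_mxM. Qed.

Lemma adjD m n (A B : 'M[C]_(m, n)) : adj (A + B) = adj A + adj B.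
Proof. by rewrite /adj linearD /= map_mxD. Qed.

Lemma adjB m n (A B : 'M[C]_(m, n)) : adj (A - B) = adj A - adj B.
Proof. by rewrite /adj linearB /= map_mxB. Qed.

Lemma adj1 n : adj (1%:M : 'M[C]_n) = 1%:M.
Proof. by rewrite /adj trmx1 map_mx1. Qed.

Lemma adj0 m n : adj (0 : 'M[C]_(m, n)) = 0.
Proof. by rewrite /adj trmx0 map_mx0. Qed.

Lemma mxtrace_adj n (A : 'M[C]_n) : \tr (adj A) = ((\tr A)^*)%C.
Proof. by rewrite conjc_sum; apply: eq_bigr => i _; rewrite adjE. Qed.

(** Positivity holds because the trace is the sum of the squared moduli of the entries. *)
Lemma hs_inner_product m n :
  is_inner_product (fun A B : 'M[C]_(m, n) => \tr (adj A *m B)).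
Proof.
split=> [A c X Y|A B|A nA].
- by rewrite mulmxDr -scalemxAr mxtraceD mxtraceZ.
- by rewrite -mxtrace_adj adjM adjK.
have E : \tr (adj A *m A) = \sum_j \sum_i `|A i j| ^+ 2.
  apply: eq_bigr => j _; rewrite mxE; apply: eq_bigr => i _.
  by rewrite adjE sqr_normc mulrC.
rewrite E lt0r sumr_ge0 => [|j _]; last by apply: sumr_ge0 => i _; rewrite exprn_ge0.
rewrite andbT; apply: contraNN nA.
rewrite psumr_eq0 => [/allP h|j _]; last by apply: sumr_ge0 => i _; rewrite exprn_ge0.
apply/eqP/matrixP => i j; rewrite mxE.
have := h j (mem_index_enum _); rewrite psumr_eq0 => [/allP h'|k _]; last by rewrite exprn_ge0.
by have := h' i (mem_index_enum _); rewrite expf_eq0 /= normr_eq0 => /eqP.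
Qed.

Lemma adjmx_eq0 m n (A : 'M[C]_(m, n)) : adj A *m A = 0 -> A = 0.
Proof. by move=> h; apply: (ip_eq0 (hs_inner_product m n)); rewrite h mxtrace0. Qed.

Record star_subalgebra n (A : 'M[C]_n -> Prop) : Prop := StarSubalgebra {
  ssub_submodule : submodule_pred A;
  ssub1 : A 1%:M;
  ssubM : forall a b, A a -> A b -> A (a *m b);
  ssub_adj : forall a, A a -> A (adj a)
}.

(* The orthogonal projection for the Hilbert-Schmidt inner product. *)
Lemma star_subalgebra_expectation n (A : 'M[C]_n -> Prop) :
  star_subalgebra A ->
  exists p : 'M[C]_n -> 'M[C]_n,
    [/\ lin p, forall x, A (p x), forall a, A a -> p a = a,
        forall a x, A a -> p (a *m x) = a *m p x &
        forall a x, A a -> p (x *m a) = p x *m a].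
Proof.
move=> sA; have hsp := hs_inner_product n n.
set ip := (fun A B : 'M[C]_n => \tr (adj A *m B)) in hsp.
have [U hU] := vspace_of_submodule (ssub_submodule sA).
have [s hs sU] := gram_schmidt hsp (vbasis U).
rewrite (span_basis (vbasisP U)) in sU.
pose p x := \sum_(j < size s) ip s`_j x *: s`_j.
have lp : lin p.
  move=> c x y; rewrite /p scaler_sumr -big_split; apply: eq_bigr => j _ /=.
  by rewrite (ip_linear hsp) scalerDl scalerA.
have Ap x : A (p x).
  apply/hU; rewrite -sU; apply: memv_suml => j _.
  by apply/memvZ/memv_span/mem_nth.
have orth x a : A a -> ip a (x - p x) = 0.
  move=> /hU; rewrite -sU => /(@coord_span _ _ _ (in_tuple s)) ->.
  rewrite (ip_suml hsp) big1 // => i _; rewrite (ipZl hsp).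
  by rewrite (orthonormal_proj hsp x hs) ?mulr0.
have orthU x a : A a -> (forall b, A b -> ip b (x - a) = 0) -> p x = a.
  move=> Aa h; apply/eqP; rewrite -subr_eq0; apply/eqP/(ip_eq0 hsp).
  have Ad : A (p x - a) by apply: submoduleB => //; exact: ssub_submodule.
  set d := p x - a in Ad *.
  have E : d = (x - a) - (x - p x) by rewrite /d opprB [RHS]addrC addrA subrK.
  rewrite {2}E (ipBr hsp).
  by rewrite orth // h // subr0.
exists p; split=> // [a Aa|a x Aa|a x Aa].
- by apply: orthU => // b _; rewrite subrr (ip0r hsp).
(* The Hilbert-Schmidt adjoint of multiplication by [a] is multiplication by [adj a], which
   preserves [A]; hence multiplication by [a] preserves the orthogonal complement of [A]. *)
- apply: orthU => [|b Ab]; first exact: ssubM.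
  rewrite -mulmxBr /ip mulmxA.
  have -> : adj b *m a = adj (adj a *m b) by rewrite adjM adjK.
  by apply: orth; apply: ssubM => //; exact: ssub_adj.
- apply: orthU => [|b Ab]; first exact: ssubM.
  rewrite -mulmxBl /ip mulmxA mxtrace_mulC mulmxA.
  have -> : a *m adj b = adj (b *m adj a) by rewrite adjM adjK.
  by apply: orth; apply: ssubM => //; exact: ssub_adj.
Qed.

(** The expectation [p] onto [A] is assembled from matrices [S a b], which commute with [A] because
    [p] is left [A]-linear. If [T] commutes with each of them, then [p T = T *m p 1%:M = T], and
    [p T] lies in [A]. *)
Lemma bicommutant n (A : 'M[C]_n -> Prop) (T : 'M[C]_n) :
  star_subalgebra A ->
  (forall S, (forall a, A a -> a *m S = S *m a) -> T *m S = S *m T) -> A T.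
Proof.
move=> sA hT.
have [p [lp Ap pid pl _]] := star_subalgebra_expectation sA.
suff <- : p T = T by exact: Ap.
pose S (a b : 'I_n) : 'M[C]_n := \matrix_(i, k) p (delta_mx k a) i b.
have psum (I : Type) (r : seq I) (g : I -> 'M[C]_n) :
    p (\sum_(i <- r) g i) = \sum_(i <- r) p (g i).
  by apply: (big_morph p) => [x y|]; [exact: linD | exact: lin0].
have pE x i b : p x i b = \sum_a (S a b *m x) i a.
  rewrite [x in LHS]matrix_sum_delta psum summxE.
  transitivity (\sum_k \sum_a x k a * p (delta_mx k a) i b).
    apply: eq_bigr => k _; rewrite psum summxE; apply: eq_bigr => a _.
    by rewrite (linZ _ _ lp) mxE.
  rewrite exchange_big; apply: eq_bigr => a _; rewrite mxE.
  by apply: eq_bigr => k _; rewrite mxE mulrC.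
have Scomm a b c : A c -> c *m S a b = S a b *m c.
  move=> Ac; apply/matrixP => i k.
  have -> : (c *m S a b) i k = (c *m p (delta_mx k a)) i b.
    by rewrite !mxE; apply: eq_bigr => m _; rewrite mxE.
  rewrite -pl // mxE.
  have -> : c *m delta_mx k a = \sum_m c m k *: delta_mx m a.
    apply/matrixP => i' j'; rewrite summxE mxE (bigD1 k) //= big1 ?addr0; last first.
      by move=> m ne; rewrite mxE (negPf ne) mulr0.
    rewrite (bigD1 i') //= big1 ?addr0; last first.
      by move=> m ne; rewrite !mxE eq_sym (negPf ne) mulr0.
    by rewrite !mxE !eqxx.
  rewrite psum summxE; apply: eq_bigr => m _.
  by rewrite (linZ _ _ lp) !mxE mulrC.
apply/matrixP => i b; rewrite pE.
transitivity (\sum_a (T *m S a b) i a).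
  by apply: eq_bigr => a _; rewrite (hT (S a b)) // => c Ac; exact: Scomm.
transitivity (\sum_m T i m * p 1%:M m b); last first.
  by rewrite pid; [have <- := mulmx1 T; rewrite mxE mulmx1 | exact: ssub1].
under [LHS]eq_bigr do rewrite mxE.
rewrite exchange_big; apply: eq_bigr => m _; rewrite -mulr_sumr pE.
by congr (_ * _); apply: eq_bigr => a _; rewrite mulmx1.
Qed.

End AdjointMatrix.

(** * Tensors and corepresentation matrices *)

Section TensorSums.
Variables (F : comNzRingType) (V W : lmodType F).

Lemma tens0l (w : W) : (0 : V) ⊗ w = 0. Proof. exact: (lin0 (lin_tensl w)). Qed.
Lemma tens0r (v : V) : v ⊗ (0 : W) = 0. Proof. exact: (lin0 (lin_tensr v)). Qed.

Lemma tens_suml (I : Type) (r : seq I) (P : pred I) (f : I -> V) (w : W) :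
  (\sum_(i <- r | P i) f i) ⊗ w = \sum_(i <- r | P i) (f i ⊗ w).
Proof.
apply: (big_morph (fun v : V => v ⊗ w)) => [x y|]; first exact: tensDl.
exact: tens0l.
Qed.

Lemma tens_sumr (I : Type) (r : seq I) (P : pred I) (v : V) (f : I -> W) :
  v ⊗ (\sum_(i <- r | P i) f i) = \sum_(i <- r | P i) (v ⊗ f i).
Proof.
apply: (big_morph (fun w : W => v ⊗ w)) => [x y|]; first exact: tensDr.
exact: tens0r.
Qed.

Lemma tlift_sum_tens (U : zmodType) (f : V -> W -> U) (I : Type) (r : seq I) a b :
  balanced f -> tlift f (\sum_(i <- r) (a i ⊗ b i)) = \sum_(i <- r) f (a i) (b i).
Proof.
by move=> hf; rewrite tlift_sum //; apply: eq_bigr => i _; rewrite tlift_tens.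
Qed.

Lemma lin_sum (f : V -> W) (I : Type) (r : seq I) (P : pred I) (g : I -> V) :
  lin f -> f (\sum_(i <- r | P i) g i) = \sum_(i <- r | P i) f (g i).
Proof.
by move=> hf; apply: (big_morph f) => [x y|]; [exact: linD | exact: lin0].
Qed.

Lemma bilin_scalel (f : V -> F^o) : lin f -> bilin (fun v (w : W) => f v *: w).
Proof.
move=> hf; split=> [w c x y|v c x y]; first by rewrite hf scalerDl -scalerA.
by rewrite scalerDr !scalerA mulrC.
Qed.

Lemma bilin_scaler (g : W -> F^o) : lin g -> bilin (fun (v : V) w => g w *: v).
Proof.
move=> hg; split=> [w c x y|v c x y]; last by rewrite hg scalerDl -scalerA.
by rewrite scalerDr !scalerA mulrC.
Qed.

End TensorSums.

(* The tensor rank of t: in a shortest decomposition both families of factors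
   are linearly independent. *)
Lemma minimal_decomposition (F : fieldType) (V W : lmodType F) (t : V ⊗ W) :
  exists n (a : 'I_n -> V) (b : 'I_n -> W) (f : 'I_n -> V -> F^o) (g : 'I_n -> W -> F^o),
    [/\ t = \sum_i (a i ⊗ b i), forall i, lin (f i), forall i, lin (g i),
        forall i j, f i (a j) = (i == j)%:R & forall i j, g i (b j) = (i == j)%:R].
Proof.
pose Q n := `[< exists (a : 'I_n -> V) (b : 'I_n -> W), t = \sum_i (a i ⊗ b i) >].
have exQ : exists n, Q n.
  exists (size (repr t)); apply/asboolP.
  exists (fun i => (tnth (in_tuple (repr t)) i).1),
    (fun i => (tnth (in_tuple (repr t)) i).2).
  rewrite [LHS]tensor_repr (big_nth (0, 0)) big_mkord.
  by apply: eq_bigr => i _; rewrite (tnth_nth (0, 0)).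
have [n /asboolP[a [b tE]] nmin] := ex_minnP exQ.
have shorter (k : 'I_n) (a' : 'I_n -> V) (b' : 'I_n -> W) :
    t = \sum_(i | i != k) (a' i ⊗ b' i) -> False.
  case: n k a b tE nmin a' b' => [[] //|n] k _ _ _ nmin a' b' E.
  suff /nmin : Q n by rewrite ltnn.
  apply/asboolP; exists (a' \o lift k), (b' \o lift k).
  rewrite E (reindex_omap (lift k) (unlift k)) => [|i ik]; last first.
    by case: unliftP ik => [j ->|->]; rewrite ?eqxx.
  by apply: eq_bigl => i; rewrite liftK eqxx eq_sym neq_lift.
have span_sub (X : lmodType F) (x : 'I_n -> X) (k : 'I_n) :
    submodule_pred (fun v => exists c : 'I_n -> F, v = \sum_(i | i != k) c i *: x i).
  split; first by exists (fun=> 0); rewrite big1 // => i _; rewrite scale0r.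
  move=> c _ _ [d ->] [e ->]; exists (fun i => c * d i + e i).
  rewrite scaler_sumr -big_split; apply: eq_bigr => i _ /=.
  by rewrite scalerDl scalerA.
have span_mem (X : lmodType F) (x : 'I_n -> X) (k j : 'I_n) : j != k ->
    exists c : 'I_n -> F, x j = \sum_(i | i != k) c i *: x i.
  move=> jk; exists (fun i => (i == j)%:R); rewrite (bigD1 j) //= eqxx scale1r.
  by rewrite big1 ?addr0 // => i /andP[_ /negPf ->]; rewrite scale0r.
(* Either some vector is a combination of the others, and its term can be distributed over them to
   shorten the decomposition, or separating functionals provide a dual family. *)
have dual (X : lmodType F) (x : 'I_n -> X) :
    (forall k, ~ exists c : 'I_n -> F, x k = \sum_(i | i != k) c i *: x i) ->
    exists f : 'I_n -> X -> F^o, (forall i, lin (f i)) /\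
      forall i j, f i (x j) = (i == j)%:R.
  move=> h.
  have /choice[f fP] k := separating_functional (span_sub _ x k) (h k).
  exists f; split=> [i|i j]; first by case: (fP i).
  case: (fP i) => _ f0 f1; have [<-|ij] := eqVneq i j; first by rewrite f1.
  by rewrite f0 //; apply: span_mem; rewrite eq_sym.
have [k [c aE]|f [lf fE]] := dual _ a.
  apply: (shorter k a (fun i => b i + c i *: b k)).
  rewrite tE (bigD1 k) //= aE tens_suml -big_split; apply: eq_bigr => i _ /=.
  by rewrite tensDr addrC tensZl tensZr.
have [k [c bE]|g [lg gE]] := dual _ b.
  apply: (shorter k (fun i => a i + c i *: a k) b).
  rewrite tE (bigD1 k) //= bE tens_sumr -big_split; apply: eq_bigr => i _ /=.
  by rewrite tensDl addrC tensZl tensZr.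
by exists n, a, b, f, g.
Qed.

Section AlgebraMultiplication.
Variables (F : comNzRingType) (A : algType F).

Lemma bilin_mul : bilin (fun a b : A => a * b).
Proof.
split=> [w c x y|v c x y]; first by rewrite mulrDl scalerAl.
by rewrite mulrDr scalerAr.
Qed.

Lemma lin_mulr (a : A) : lin (fun b => a * b).
Proof. by case: bilin_mul. Qed.

Lemma lin_mull (a : A) : lin (fun b => b * a).
Proof. by case: bilin_mul => h _; exact: h. Qed.

Lemma bilin_mulmul (t : A ⊗ A) : bilin (fun x y : A =>
  \sw_(x', y' <- t) ((x * x') ⊗ (y * y'))).
Proof.
split=> [w|v] c a b; rewrite -tlift_combine; apply: tlift_ext => x y.
- by rewrite mulrDl tensDl -scalerAl tensZl.
- by rewrite mulrDl tensDr -scalerAl tensZr.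
Qed.

Lemma bilin_mulmulr (x y : A) : bilin (fun x' y' : A => (x * x') ⊗ (y * y')).
Proof. by apply: bilin_tens; exact: lin_mulr. Qed.

End AlgebraMultiplication.

Section ScalarMatrices.
Variables (R : realType) (A : algType R[i]).
Local Notation C := R[i].

Definition cmx m n (T : 'M[C]_(m, n)) : 'M[A]_(m, n) := map_mx (in_alg A) T.

Lemma cmxE m n (T : 'M[C]_(m, n)) i j : cmx T i j = (T i j)%:A.
Proof. by rewrite mxE. Qed.

Lemma cmxM m n p (S : 'M[C]_(m, n)) (T : 'M[C]_(n, p)) :
  cmx (S *m T) = cmx S *m cmx T.
Proof. exact: map_mxM. Qed.

Lemma cmx1 n : cmx (1%:M : 'M[C]_n) = 1%:M.
Proof. exact: map_mx1. Qed.

Lemma cmx0 m n : cmx (0 : 'M[C]_(m, n)) = 0.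
Proof. exact: map_mx0. Qed.

Lemma cmxD m n (S T : 'M[C]_(m, n)) : cmx (S + T) = cmx S + cmx T.
Proof. exact: map_mxD. Qed.

Lemma mul_cmxE m n p (T : 'M[C]_(m, n)) (U : 'M[A]_(n, p)) i j :
  (cmx T *m U) i j = \sum_k T i k *: U k j.
Proof. by rewrite mxE; apply: eq_bigr => k _; rewrite mxE -scalerAl mul1r. Qed.

Lemma mulr_cmxE m n p (U : 'M[A]_(m, n)) (T : 'M[C]_(n, p)) i j :
  (U *m cmx T) i j = \sum_k T k j *: U i k.
Proof. by rewrite mxE; apply: eq_bigr => k _; rewrite mxE -scalerAr mulr1. Qed.

Lemma map_cmx_mul m n p (f : A -> C^o) (T : 'M[C]_(m, n)) (U : 'M[A]_(n, p)) :
  lin f -> map_mx f (cmx T *m U) = T *m map_mx f U.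
Proof.
move=> lf; apply/matrixP => i j; rewrite [LHS]mxE mul_cmxE (lin_sum _ _ _ lf) mxE.
by apply: eq_bigr => k _; rewrite (linZ _ _ lf) mxE.
Qed.

Lemma map_mul_cmx m n p (f : A -> C^o) (U : 'M[A]_(m, n)) (T : 'M[C]_(n, p)) :
  lin f -> map_mx f (U *m cmx T) = map_mx f U *m T.
Proof.
move=> lf; apply/matrixP => i j; rewrite [LHS]mxE mulr_cmxE (lin_sum _ _ _ lf) mxE.
by apply: eq_bigr => k _; rewrite (linZ _ _ lf) mxE mulrC.
Qed.

End ScalarMatrices.

Arguments cmx {R} A {m n} T.

Lemma sum_mxtens (V : nmodType) m n (F : 'I_(m * n) -> V) :
  \sum_k F k = \sum_i \sum_j F (mxtens_index (i, j)).
Proof.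
rewrite pair_big (reindex (@mxtens_index m n)) /=; last first.
  by exists (@mxtens_unindex m n) => i _; rewrite (mxtens_indexK, mxtens_unindexK).
by apply: eq_bigr => -[i j] _.
Qed.

(** * Corepresentation matrices, their direct sums and tensor products *)

Section Corepresentations.
Variables (R : realType) (H : hopf_star_algebra R).
Local Notation C := R[i].

Record is_corep n (U : 'M[H]_n) : Prop := IsCorep {
  corep_comul : forall i j, comul (U i j) = \sum_k (U i k ⊗ U k j);
  corep_counit : forall i j, counit (U i j) = (i == j)%:R
}.

Definition starmx m n (U : 'M[H]_(m, n)) : 'M[H]_(n, m) :=
  \matrix_(i, j) star (U j i).

Record is_ucorep n (U : 'M[H]_n) : Prop := IsUcorep {
  ucorep_corep :> is_corep U;
  ucorep_starl : starmx U *m U = 1%:M;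
  ucorep_starr : U *m starmx U = 1%:M
}.

Lemma star0 : star (0 : H) = 0.
Proof. by apply: (addrI (star (0 : H))); rewrite -starD !addr0. Qed.

Lemma star1 : star (1 : H) = 1.
Proof. by rewrite -[LHS]mulr1 -[X in _ * X]starK -starM mulr1 starK. Qed.

Lemma star_sum (I : Type) (r : seq I) (P : pred I) (f : I -> H) :
  star (\sum_(i <- r | P i) f i) = \sum_(i <- r | P i) star (f i).
Proof. by apply: (big_morph star) => [x y|]; [exact: starD | exact: star0]. Qed.

Definition antimx m n (U : 'M[H]_(m, n)) := map_mx (antipode : H -> H) U.

Lemma corep_antipodel n (U : 'M[H]_n) : is_corep U -> antimx U *m U = 1%:M.
Proof.
move=> hU; apply/matrixP => i j; have := antipode_left (U i j).
rewrite corep_comul // tlift_sum_tens; last first.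
  by apply/bilin_balanced/(bilin_compl (bilin_mul H)); [exact: lin_linear|].
rewrite corep_counit // mxE => E.
under eq_bigr do rewrite mxE.
by rewrite E mxE scaler_nat.
Qed.

Lemma corep_antipoder n (U : 'M[H]_n) : is_corep U -> U *m antimx U = 1%:M.
Proof.
move=> hU; apply/matrixP => i j; have := antipode_right (U i j).
rewrite corep_comul // tlift_sum_tens; last first.
  by apply/bilin_balanced/(bilin_compl (bilin_mul H)); [|exact: lin_linear].
rewrite corep_counit // mxE => E.
under eq_bigr do rewrite mxE.
by rewrite E mxE scaler_nat.
Qed.

Lemma ucorep_antipode n (U : 'M[H]_n) : is_ucorep U -> antimx U = starmx U.
Proof.
move=> hU; rewrite -[LHS]mul1mx -(ucorep_starl hU) -mulmxA (corep_antipoder hU).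
by rewrite mulmx1.
Qed.

Lemma ucorep_of_antipode n (U : 'M[H]_n) :
  is_corep U -> antimx U = starmx U -> is_ucorep U.
Proof.
by move=> hU E; split=> //; rewrite -E; [exact: corep_antipodel | exact: corep_antipoder].
Qed.

Lemma ucorep_block m n (U : 'M[H]_m) (V : 'M[H]_n) :
  is_ucorep U -> is_ucorep V -> is_ucorep (block_mx U 0 0 V).
Proof.
move=> hU hV.
have bE := (@block_mxEul, @block_mxEur, @block_mxEdl, @block_mxEdr).
have sE : starmx (block_mx U 0 0 V) = block_mx (starmx U) 0 0 (starmx V).
  apply/matrixP => i j; rewrite mxE.
  case: (split_ordP i) => {}i ->; case: (split_ordP j) => {}j ->.
  - by rewrite !block_mxEul mxE.
  - by rewrite block_mxEdl block_mxEur !mxE star0.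
  - by rewrite block_mxEdl block_mxEur !mxE star0.
  - by rewrite !block_mxEdr mxE.
split.
- split=> i j.
  + rewrite big_split_ord /=.
    case: (split_ordP i) => {}i ->; case: (split_ordP j) => {}j ->.
    * rewrite block_mxEul (corep_comul hU) [X in _ = _ + X]big1 ?addr0 => [|k _].
        by apply: eq_bigr => k _; rewrite !block_mxEul.
      by rewrite bE mxE tens0l.
    * by rewrite block_mxEur mxE linear0 !big1 ?addr0 // => k _; rewrite !bE mxE ?tens0l ?tens0r.
    * by rewrite block_mxEdl mxE linear0 !big1 ?addr0 // => k _; rewrite !bE mxE ?tens0l ?tens0r.
    * rewrite block_mxEdr (corep_comul hV) [X in _ = X + _]big1 ?add0r => [|k _].
        by apply: eq_bigr => k _; rewrite !block_mxEdr.
      by rewrite bE mxE tens0l.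
  + case: (split_ordP i) => {}i ->; case: (split_ordP j) => {}j ->.
    * by rewrite block_mxEul (corep_counit hU) eq_lshift.
    * by rewrite block_mxEur mxE linear0 eq_lrshift.
    * by rewrite block_mxEdl mxE linear0 eq_rlshift.
    * by rewrite block_mxEdr (corep_counit hV) eq_rshift.
- rewrite sE mulmx_block !mulmx0 !mul0mx !addr0 !add0r !ucorep_starl //.
  by rewrite -scalar_mx_block.
- rewrite sE mulmx_block !mulmx0 !mul0mx !addr0 !add0r !ucorep_starr //.
  by rewrite -scalar_mx_block.
Qed.

Lemma ucorep_tens m n (U : 'M[H]_m) (V : 'M[H]_n) :
  is_ucorep U -> is_ucorep V -> is_ucorep (U *t V).
Proof.
move=> hU hV; split.
- split=> k l; case: (mxtens_indexP k) => i a; case: (mxtens_indexP l) => j b.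
  + rewrite tensmxE comulM (corep_comul hU) tlift_sum_tens; last first.
      exact/bilin_balanced/bilin_mulmul.
    rewrite sum_mxtens; apply: eq_bigr => k' _.
    rewrite (corep_comul hV) tlift_sum_tens; last first.
      exact/bilin_balanced/bilin_mulmulr.
    by apply: eq_bigr => c _; rewrite !tensmxE.
  + rewrite tensmxE counitM (corep_counit hU) (corep_counit hV) -natrM mulnb.
    by rewrite (can_eq (@mxtens_indexK m n)) xpair_eqE.
- apply/matrixP => k l; case: (mxtens_indexP k) => i a; case: (mxtens_indexP l) => j b.
  rewrite mxE sum_mxtens exchange_big /=.
  (* As [star] reverses products, the entries of [U] are adjacent here and are summed first; in the
     opposite identity below it is the entries of [V]. *)
  transitivity (\sum_c star (V c a) * (starmx U *m U) i j * V c b).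
    apply: eq_bigr => c _; rewrite mxE mulr_sumr mulr_suml; apply: eq_bigr => k' _.
    by rewrite [starmx (_ *t _) _ _]mxE !tensmxE [starmx U _ _]mxE starM !mulrA.
  rewrite (ucorep_starl hU) mxE [RHS]mxE (can_eq (@mxtens_indexK m n)) xpair_eqE.
  case: (i == j); last by rewrite big1 // => c _; rewrite mulr0 mul0r.
  have := congr1 (fun M : 'M_n => M a b) (ucorep_starl hV); rewrite !mxE /= => <-.
  by apply: eq_bigr => c _; rewrite mulr1 mxE.
- apply/matrixP => k l; case: (mxtens_indexP k) => i a; case: (mxtens_indexP l) => j b.
  rewrite mxE sum_mxtens /=.
  transitivity (\sum_k' U i k' * (V *m starmx V) a b * star (U j k')).
    apply: eq_bigr => k' _; rewrite mxE mulr_sumr mulr_suml; apply: eq_bigr => c _.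
    by rewrite [starmx (_ *t _) _ _]mxE !tensmxE [starmx V _ _]mxE starM !mulrA.
  rewrite (ucorep_starr hV) mxE [RHS]mxE (can_eq (@mxtens_indexK m n)) xpair_eqE.
  case: (a == b); rewrite ?andbF; last by rewrite big1 // => c _; rewrite mulr0 mul0r.
  have := congr1 (fun M : 'M_m => M i j) (ucorep_starr hU); rewrite !mxE /= andbT => <-.
  by apply: eq_bigr => c _; rewrite mulr1 mxE.
Qed.

End Corepresentations.

Section TensorMaps.
Variables (F : comNzRingType) (V W : lmodType F).

Lemma tensor_lin_ext (U : lmodType F) (f g : V ⊗ W -> U) t :
  lin f -> lin g -> (forall v w, f (v ⊗ w) = g (v ⊗ w)) -> f t = g t.
Proof.
move=> hf hg h; rewrite [t]tensor_repr (lin_sum _ _ _ hf) (lin_sum _ _ _ hg).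
by apply: eq_bigr.
Qed.

Lemma sw_tens (t : V ⊗ W) : \sw_(v, w <- t) (v ⊗ w) = t.
Proof. by rewrite [RHS]tensor_repr. Qed.

End TensorMaps.

Section Slices.
Variables (F : fieldType) (V : vectType F) (W : lmodType F) (n : nat) (b : n.-tuple V).

Definition slice (i : 'I_n) (t : V ⊗ W) : W := \sw_(x, h <- t) (coord b i x *: h).

Lemma lin_coord i : lin (coord b i : V -> F^o).
Proof. by move=> c x y; rewrite linearP. Qed.

Lemma lin_slice i : lin (slice i).
Proof. exact/tlift_lin/bilin_scalel/lin_coord. Qed.

Lemma slice_tens i x h : slice i (x ⊗ h) = coord b i x *: h.
Proof. by rewrite /slice tlift_tens //; apply/bilin_balanced/bilin_scalel/lin_coord. Qed.

Lemma coord_basis_elt (hb : basis_of fullv b) (i j : 'I_n) :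
  coord b i b`_j = (j == i)%:R.
Proof. by rewrite (coord_free j i (basis_free hb)). Qed.

Lemma slice_basis (hb : basis_of fullv b) (c : 'I_n -> W) i :
  slice i (\sum_(j < n) (b`_j ⊗ c j)) = c i.
Proof.
rewrite (lin_sum _ _ _ (lin_slice i)) (bigD1 i) //= slice_tens (coord_basis_elt hb).
rewrite eqxx scale1r big1 ?addr0 // => j ji.
by rewrite slice_tens (coord_basis_elt hb) (negPf ji) scale0r.
Qed.

Lemma tens_slices (hb : basis_of fullv b) t : t = \sum_(i < n) (b`_i ⊗ slice i t).
Proof.
apply: (tensor_lin_ext (g := fun t => \sum_(i < n) (b`_i ⊗ slice i t))) => // [c x y|v w].
  rewrite scaler_sumr -big_split; apply: eq_bigr => i _ /=.
  by rewrite lin_slice tensDr tensZr.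
rewrite [in LHS](coord_basis hb (memvf v)) tens_suml; apply: eq_bigr => i _.
by rewrite slice_tens tensZr tensZl.
Qed.

End Slices.

Section ComoduleMatrices.
Variables (R : realType) (H : hopf_star_algebra R) (V : vectType R[i]).
Local Notation C := R[i].
Variables (n : nat) (b : n.-tuple V).
Hypothesis hb : basis_of fullv b.
Variable rho : V -> V ⊗ H.

Definition coact_mx : 'M[H]_n := \matrix_(i, j) slice b i (rho b`_j).

Lemma coact_mxE (j : 'I_n) : rho b`_j = \sum_(i < n) (b`_i ⊗ coact_mx i j).
Proof. by rewrite {1}(tens_slices hb (rho b`_j)); apply: eq_bigr => i _; rewrite mxE. Qed.

Lemma coact_mx_uniq (c : 'M[H]_n) :
  (forall j : 'I_n, rho b`_j = \sum_(i < n) (b`_i ⊗ c i j)) -> c = coact_mx.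
Proof. by move=> h; apply/matrixP => i j; rewrite mxE h slice_basis. Qed.

Lemma coact_mx_corep : is_comodule rho -> is_corep coact_mx.
Proof.
move=> [hlin hco heps].
have bL1 (h : H) : bilin (fun (y : V) (k : H) => y ⊗ (k ⊗ h)).
  by split=> [k|z]; [exact: lin_tensl | apply: lin_comp (lin_tensr _) (lin_tensl _)].
have bL : bilin (fun (x : V) (h : H) => \sw_(y, k <- rho x) (y ⊗ (k ⊗ h))).
  apply: (bilin_nestl hlin) => // v k.
  by apply: lin_comp (lin_tensr _) (lin_tensr _).
have lD : lin (comul : H -> H ⊗ H) by exact: lin_linear.
split=> i j.
- have := hco b`_j.
  have -> : \sw_(x, h <- rho b`_j) \sw_(h1, h2 <- comul h) (x ⊗ (h1 ⊗ h2)) =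
            \sw_(x, h <- rho b`_j) (x ⊗ comul h).
    apply: tlift_ext => x h; rewrite -[X in _ = _ ⊗ X]sw_tens.
    by rewrite (lin_fuse _ _ (lin_tensr _)).
  rewrite coact_mxE !tlift_sum_tens; first last.
  + exact: bilin_balanced bL.
  + exact: bilin_balanced (bilin_tens (@lin_id _ V) lD).
  move=> /(congr1 (slice b i)); rewrite slice_basis // => <-.
  rewrite (lin_sum _ _ _ (lin_slice _ _)); apply: eq_bigr => k _.
  rewrite coact_mxE tlift_sum_tens; last exact: (bilin_balanced (bL1 _)).
  by rewrite slice_basis.
- have := heps b`_j; rewrite coact_mxE tlift_sum_tens; last first.
    exact/bilin_balanced/bilin_scaler/lin_linear.
  move=> /(congr1 (coord b i)); rewrite (coord_basis_elt hb) eq_sym => <-.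
  rewrite linear_sum (bigD1 i) //= linearZ /= (coord_basis_elt hb) eqxx mulr1.
  rewrite big1 ?addr0 // => k ki.
  by rewrite linearZ /= (coord_basis_elt hb) (negPf ki) mulr0.
Qed.

Definition mx_coact (c : 'M[H]_n) : V -> V ⊗ H :=
  fun v => \sum_j coord b j v *: \sum_(i < n) (b`_i ⊗ c i j).

Lemma lin_mx_coact c : lin (mx_coact c).
Proof.
move=> d x y; rewrite /mx_coact scaler_sumr -big_split; apply: eq_bigr => j _ /=.
by rewrite linearP scalerDl scalerA.
Qed.

Lemma mx_coactE c (j : 'I_n) : mx_coact c b`_j = \sum_(i < n) (b`_i ⊗ c i j).
Proof.
rewrite /mx_coact (bigD1 j) //= (coord_basis_elt hb) eqxx scale1r.
rewrite [X in _ + X]big1 ?addr0 // => k kj.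
by rewrite (coord_basis_elt hb) eq_sym (negPf kj) scale0r.
Qed.

Lemma lin_ext_basis (U : lmodType C) (f g : V -> U) v : lin f -> lin g ->
  (forall j : 'I_n, f b`_j = g b`_j) -> f v = g v.
Proof.
move=> lf lg h; rewrite (coord_basis hb (memvf v)) (lin_sum _ _ _ lf) (lin_sum _ _ _ lg).
by apply: eq_bigr => j _; rewrite (linZ _ _ lf) (linZ _ _ lg) h.
Qed.

Lemma mx_coact_comodule c : is_corep c -> is_comodule (mx_coact c).
Proof.
move=> hc; have lr := lin_mx_coact c.
have bL1 (h : H) : bilin (fun (y : V) (k : H) => y ⊗ (k ⊗ h)).
  by split=> [k|z]; [exact: lin_tensl | apply: lin_comp (lin_tensr _) (lin_tensl _)].
have bL : bilin (fun (x : V) (h : H) => \sw_(y, k <- mx_coact c x) (y ⊗ (k ⊗ h))).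
  apply: (bilin_nestl lr) => // v k.
  by apply: lin_comp (lin_tensr _) (lin_tensr _).
have lD : lin (comul : H -> H ⊗ H) by exact: lin_linear.
have bc : bilin (fun (x : V) (h : H) => (counit h : C) *: x).
  exact/bilin_scaler/lin_linear.
have bD : bilin (fun (x : V) (h : H) => x ⊗ comul h) by exact: bilin_tens.
have l1 := tlift_lin bL; have l2 := tlift_lin bD; have l3 := tlift_lin bc.
split=> [//|v|v].
- have DE x h : \sw_(h1, h2 <- comul h) (x ⊗ (h1 ⊗ h2)) =
      x ⊗ comul h :> (V ⊗ (H ⊗ H))%type.
    by rewrite -[X in _ = _ ⊗ X]sw_tens (lin_fuse _ _ (lin_tensr _)).
  rewrite [RHS](tlift_ext _ DE).
  apply: (lin_ext_basis _ (lin_comp l1 lr) (lin_comp l2 lr)) => j.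
  rewrite mx_coactE !tlift_sum_tens; [|exact: bilin_balanced|exact: bilin_balanced].
  under eq_bigr => i _.
    rewrite mx_coactE tlift_sum_tens; last exact: (bilin_balanced (bL1 _)).
  over.
  rewrite exchange_big; apply: eq_bigr => i _.
  by rewrite (corep_comul hc) tens_sumr.
- apply: (lin_ext_basis _ (lin_comp l3 lr) (@lin_id _ V)) => j.
  rewrite mx_coactE tlift_sum_tens; last exact: bilin_balanced.
  rewrite (bigD1 j) //= (corep_counit hc) eqxx scale1r big1 ?addr0 // => i ij.
  by rewrite (corep_counit hc) (negPf ij) scale0r.
Qed.

End ComoduleMatrices.

(** * Unitary corepresentations and the spans of their entries *)

Section UnitaryBases.
Variables (R : realType) (H : hopf_star_algebra R).
Local Notation C := R[i].

Lemma antipode_lin : lin (antipode : H -> H).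
Proof. exact: lin_linear. Qed.

Lemma counit_lin : lin (counit : H -> C^o).
Proof. exact: lin_linear. Qed.

(** In a basis orthonormal for the inner product provided by [unitarizable], the identity defining
    it says that the antipode of the coefficient matrix is its adjoint. *)
Lemma comodule_unitary_basis (V : vectType C) (rho : V -> V ⊗ H) :
  is_comodule rho -> unitarizable rho ->
  exists b : (\dim {:V}).-tuple V, basis_of fullv b /\ is_ucorep (coact_mx b rho).
Proof.
move=> hrho [ip [hip hU]].
have [s hs sV] := gram_schmidt hip (vbasis {:V}).
rewrite (span_basis (vbasisP _)) in sV.
have hb : basis_of fullv s by rewrite /basis_of sV eqxx; exact: orthonormal_free hip _ hs.
have sz : size s == \dim {:V} by have /andP[_] := hb; rewrite /free sV eq_sym.
pose b := Tuple sz; have hb' : basis_of fullv b by []; exists b; split=> //.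
apply: ucorep_of_antipode; first exact: coact_mx_corep.
have ipb (i j : 'I_(\dim {:V})) : ip b`_i b`_j = (i == j)%:R.
  by rewrite hs // (eqP sz).
apply/matrixP => i j; rewrite [LHS]mxE [RHS]mxE.
have := hU b`_i b`_j; rewrite !(coact_mxE hb' rho).
rewrite !tlift_sum_tens; first last.
- split=> [x y w|x h k|c x h].
  + by rewrite (ipDl hip) scalerDl.
  + by rewrite starD scalerDr.
  + by rewrite (ipZl hip) starZ scalerA mulrC.
- split=> [x y w|x h k|c x h].
  + by rewrite (ipDr hip) scalerDl.
  + by rewrite linearD scalerDr.
  + by rewrite (ipZr hip) linearZ scalerA mulrC.
rewrite (bigD1 j) //= ipb eqxx scale1r big1 ?addr0 => [|k kj]; last first.
  by rewrite ipb (negPf kj) scale0r.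
rewrite (bigD1 i) //= ipb eqxx scale1r big1 ?addr0 => [|k ki]; last first.
  by rewrite ipb eq_sym (negPf ki) scale0r.
by move=> E; exact/esym.
Qed.

(** Linear combinations of entries are indexed by a matrix [L] so that block sums and Kronecker
    products of corepresentations act on the coefficients in the same way. *)
Definition pairing m n (L : 'M[C]_(m, n)) (U : 'M[H]_(m, n)) : H :=
  \sum_i \sum_j L i j *: U i j.

Lemma pairing_block m n (L : 'M[C]_m) (L' : 'M[C]_n) U V :
  pairing (block_mx L 0 0 L') (block_mx U 0 0 V) = pairing L U + pairing L' V.
Proof.
rewrite /pairing big_split_ord /=; congr (_ + _); apply: eq_bigr => i _;
  rewrite big_split_ord /=.
- rewrite [X in _ + X]big1 ?addr0 => [|j _]; last by rewrite !block_mxEur !mxE scale0r.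
  by apply: eq_bigr => j _; rewrite !block_mxEul.
- rewrite big1 ?add0r => [|j _]; last by rewrite !block_mxEdl !mxE scale0r.
  by apply: eq_bigr => j _; rewrite !block_mxEdr.
Qed.

Lemma pairing_tens m n (L : 'M[C]_m) (L' : 'M[C]_n) U V :
  pairing (L *t L') (U *t V) = pairing L U * pairing L' V.
Proof.
rewrite /pairing sum_mxtens mulr_suml; apply: eq_bigr => i _.
rewrite mulr_suml.
under eq_bigr do rewrite sum_mxtens.
rewrite exchange_big /=; apply: eq_bigr => j _.
rewrite mulr_sumr; apply: eq_bigr => a _; rewrite mulr_sumr; apply: eq_bigr => c _.
by rewrite !tensmxE -scalerAl -scalerAr scalerA.
Qed.

Lemma pairing_scale m n c (L : 'M[C]_(m, n)) U :
  pairing (c *: L) U = c *: pairing L U.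
Proof.
rewrite scaler_sumr; apply: eq_bigr => i _; rewrite scaler_sumr.
by apply: eq_bigr => j _; rewrite mxE scalerA.
Qed.

Lemma pairing0 m n (U : 'M[H]_(m, n)) : pairing 0 U = 0.
Proof. by rewrite /pairing big1 // => i _; rewrite big1 // => j _; rewrite mxE scale0r. Qed.

Lemma pairing_delta m n i j (U : 'M[H]_(m, n)) : pairing (delta_mx i j) U = U i j.
Proof.
rewrite /pairing (bigD1 i) //= (bigD1 j) //= mxE !eqxx scale1r.
rewrite !big1 ?addr0 // => k ki; last by rewrite mxE (negPf ki) andbF scale0r.
by rewrite big1 // => l _; rewrite mxE (negPf ki) scale0r.
Qed.

Lemma lin_pairing (U' : lmodType C) m n (f : H -> U') (L : 'M[C]_(m, n)) U : lin f ->
  f (pairing L U) = \sum_i \sum_j L i j *: f (U i j).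
Proof.
move=> lf; rewrite (lin_sum _ _ _ lf); apply: eq_bigr => i _.
by rewrite (lin_sum _ _ _ lf); apply: eq_bigr => j _; rewrite (linZ _ _ lf).
Qed.

Definition in_span m n (U : 'M[H]_(m, n)) (h : H) := exists L, h = pairing L U.

(* If comul h = \sum_i a_i ⊗ b_i is a shortest decomposition, the a_i span a
   subcomodule, and its matrix has h in the span of its entries. *)
Lemma corep_spanning (h : H) : exists n (c : 'M[H]_n), is_corep c /\ in_span c h.
Proof.
have [n [a [b [f [g [hE lf lg fE gE]]]]]] := minimal_decomposition (comul h).
have bS (k : H -> C^o) : lin k -> bilin (fun x y : H => k y *: x).
  exact: bilin_scaler.
pose c : 'M[H]_n := \matrix_(i, j) \sw_(x, y <- comul (b i)) (g j y *: x).
have lD : lin (comul : H -> H ⊗ H) by exact: lin_linear.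
have bL1 (y : H) : bilin (fun x1 x2 : H => x1 ⊗ (x2 ⊗ y)).
  by split=> [k|z]; [exact: lin_tensl | apply: lin_comp (lin_tensr _) (lin_tensl _)].
have bL : bilin (fun x y : H => \sw_(x1, x2 <- comul x) (x1 ⊗ (x2 ⊗ y))).
  apply: (bilin_nestl lD) => // v k.
  by apply: lin_comp (lin_tensr _) (lin_tensr _).
have bR : bilin (fun x y : H => x ⊗ comul y) by exact: (bilin_tens (@lin_id _ H) lD).
have coass (z : H) : \sw_(x, y <- comul z) \sw_(x1, x2 <- comul x) (x1 ⊗ (x2 ⊗ y)) =
               \sw_(x, y <- comul z) (x ⊗ comul y).
  rewrite comul_coassoc; apply: tlift_ext => x y.
  by rewrite -[X in _ = _ ⊗ X]sw_tens (lin_fuse _ _ (lin_tensr _)).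
(* Coassociativity at [h], with the last leg evaluated by [g j], shows that the [a j] span a
   subcomodule with matrix [c]. *)
have aE j : comul (a j) = \sum_i (a i ⊗ c i j).
  pose T (t : (H ⊗ (H ⊗ H))%type) : (H ⊗ H)%type :=
    \sw_(x, u <- t) (x ⊗ \sw_(y, z <- u) (g j z *: y)).
  have bT : bilin (fun (x : H) (u : (H ⊗ H)%type) => x ⊗ \sw_(y, z <- u) (g j z *: y)).
    by apply: bilin_tens => //; exact/tlift_lin/bS.
  have lT : lin T by exact: tlift_lin.
  have TE x u : T (x ⊗ u) = x ⊗ \sw_(y, z <- u) (g j z *: y).
    by rewrite /T tlift_tens //; exact: bilin_balanced.
  have := congr1 T (coass h); rewrite hE !tlift_sum_tens; first last.
  - exact: bilin_balanced.
  - exact: bilin_balanced.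
  rewrite !(lin_sum _ _ _ lT).
  move=> E; transitivity (\sum_i T (a i ⊗ comul (b i))).
    rewrite -E (bigD1 j) //= big1 ?addr0 => [|i ij]; rewrite (lin_fuse _ _ lT).
      rewrite -[LHS]sw_tens; apply: tlift_ext => x y.
      rewrite TE tlift_tens ?gE ?eqxx ?scale1r //; exact/bilin_balanced/bS.
    transitivity (\sw_(x1, x2 <- comul (a i)) (0 : (H ⊗ H)%type)).
      apply: tlift_ext => x y; rewrite TE tlift_tens ?gE; last exact/bilin_balanced/bS.
      by rewrite eq_sym (negPf ij) scale0r tens0r.
    by rewrite /tlift /formal_lift big1.
  by apply: eq_bigr => i _; rewrite TE mxE.
exists n, c; split.
- split=> [k j|k j].
  (* Coassociativity at [a j], with the first leg evaluated by [f k], computes [comul (c k j)]. *)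
  + have := coass (a j); rewrite aE !tlift_sum_tens; first last.
    * exact: bilin_balanced.
    * exact: bilin_balanced.
    pose T (t : (H ⊗ (H ⊗ H))%type) : (H ⊗ H)%type := \sw_(x, u <- t) (f k x *: u).
    have bT : bilin (fun (x : H) (u : (H ⊗ H)%type) => f k x *: u) by exact: bilin_scalel.
    have lT : lin T by exact: tlift_lin.
    have TE x u : T (x ⊗ u) = f k x *: u.
      by rewrite /T tlift_tens //; exact: bilin_balanced.
    move=> /(congr1 T); rewrite !(lin_sum _ _ _ lT).
    rewrite [RHS](bigD1 k) //= [X in _ = _ + X]big1 ?addr0 => [|i ik]; last first.
      by rewrite TE fE eq_sym (negPf ik) scale0r.
    rewrite TE fE eqxx scale1r => <-; apply: eq_bigr => i _.
    rewrite aE tlift_sum_tens; last exact: (bilin_balanced (bL1 _)).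
    rewrite (lin_sum _ _ _ lT) (bigD1 k) //= TE fE eqxx scale1r.
    by rewrite big1 ?addr0 // => l lk; rewrite TE fE eq_sym (negPf lk) scale0r.
  + have := counit_right (a j); rewrite aE tlift_sum_tens; last first.
      exact/bilin_balanced/bS/counit_lin.
    move=> /(congr1 (f k)); rewrite (lin_sum _ _ _ (lf k)) fE => <-.
    rewrite (bigD1 k) //= (linZ _ _ (lf k)) fE eqxx [_ *: _]mulr1 big1 ?addr0 //.
    by move=> i ik; rewrite (linZ _ _ (lf k)) fE eq_sym (negPf ik) [_ *: _]mulr0.
(* The two counit axioms give h as the sum of [counit (b j) *: a j], and [a j] as the sum of
   [counit (a i) *: c i j]. *)
exists (\matrix_(i, j) (counit (b j) * counit (a i))).
rewrite -[LHS]counit_right hE tlift_sum_tens; last exact/bilin_balanced/bS/counit_lin.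
rewrite /pairing exchange_big; apply: eq_bigr => j _ /=.
rewrite -[a j in LHS]counit_left aE tlift_sum_tens; last first.
  exact/bilin_balanced/bilin_scalel/counit_lin.
by rewrite scaler_sumr; apply: eq_bigr => i _; rewrite !mxE scalerA.
Qed.

End UnitaryBases.

Section Spans.
Variables (R : realType) (H : hopf_star_algebra R).
Local Notation C := R[i].

Lemma in_span_submodule m n (U : 'M[H]_(m, n)) : submodule_pred (in_span U).
Proof.
split; first by exists 0; rewrite pairing0.
move=> c _ _ [L ->] [M ->]; exists (c *: L + M).
rewrite -pairing_scale /pairing -big_split; apply: eq_bigr => i _.
rewrite -big_split; apply: eq_bigr => j _; rewrite /= -scalerDl.
by congr (_ *: _); rewrite [RHS]mxE.
Qed.

Lemma in_span_entry m n (U : 'M[H]_(m, n)) i j : in_span U (U i j).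
Proof. by exists (delta_mx i j); rewrite pairing_delta. Qed.

Lemma in_span_trans m n p q (U : 'M[H]_(m, n)) (c : 'M[H]_(p, q)) h :
  (forall i j, in_span U (c i j)) -> in_span c h -> in_span U h.
Proof.
move=> hc [L ->]; have sU := in_span_submodule U.
by apply: submodule_sum => // i _; apply: submodule_sum => // j _; exact: submoduleZ.
Qed.

Lemma in_span_blockl m n (U : 'M[H]_m) (V : 'M[H]_n) h :
  in_span U h -> in_span (block_mx U 0 0 V) h.
Proof.
move=> [L ->]; exists (block_mx L 0 0 0); by rewrite pairing_block pairing0 addr0.
Qed.

Lemma in_span_blockr m n (U : 'M[H]_m) (V : 'M[H]_n) h :
  in_span V h -> in_span (block_mx U 0 0 V) h.
Proof.
move=> [L ->]; exists (block_mx 0 0 0 L); by rewrite pairing_block pairing0 add0r.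
Qed.

Lemma coact_mx_in_span (V : vectType C) m n (b : m.-tuple V) (b' : n.-tuple V)
    (rho : V -> V ⊗ H) i j :
  basis_of fullv b' -> lin rho ->
  in_span (coact_mx b' rho) (coact_mx b rho i j).
Proof.
move=> hb' lr.
have lf : lin (fun v => slice b i (rho v)).
  by apply: lin_comp => //; exact: lin_slice.
rewrite mxE (coord_basis hb' (memvf b`_j)) (lin_sum _ _ _ lf).
have sU := in_span_submodule (coact_mx b' rho).
apply: submodule_sum => // k _; rewrite (linZ _ _ lf); apply: submoduleZ => //.
rewrite (coact_mxE hb' rho) (lin_sum _ _ _ (lin_slice _ _)).
apply: submodule_sum => // l _; rewrite slice_tens; apply: submoduleZ => //.
exact: in_span_entry.
Qed.

Lemma ucorep0 : is_ucorep (0 : 'M[H]_0).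
Proof. by split; [split; case|apply/matrixP; case|apply/matrixP; case]. Qed.

(** A form of the CQG condition that visibly passes to quotients. [cqg_spanned] and
    [spanned_unitarizable] translate between it and the unitarizability of all comodules. *)
Definition spanned_by_ucoreps : Prop :=
  forall h : H, exists n (U : 'M[H]_n), is_ucorep U /\ in_span U h.

Lemma ucorep_spanning_seq (hH : spanned_by_ucoreps) (s : seq H) :
  exists n (U : 'M[H]_n), is_ucorep U /\ forall h, h \in s -> in_span U h.
Proof.
elim: s => [|h s [n [U [hU sU]]]]; first by exists 0%N, 0; split=> //; exact: ucorep0.
have [m [V [hV sV]]] := hH h.
exists (m + n)%N, (block_mx V 0 0 U); split; first exact: ucorep_block.
move=> k; rewrite inE => /orP[/eqP ->|/sU]; first exact: in_span_blockl.
exact: in_span_blockr.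
Qed.

(** The image of the convolution algebra of all functionals on [H] under the representation attached
    to [U]. It is a finite-dimensional substitute for that algebra. *)
Definition slice_algebra n (U : 'M[H]_n) (T : 'M[C]_n) : Prop :=
  exists2 f : H -> C^o, lin f & T = map_mx f U.

Definition convolution (f g : H -> C^o) (h : H) : C^o :=
  \sw_(x, y <- comul h) ((f x : C) *: g y).

Lemma lin_convolution f g : lin f -> lin g -> lin (convolution f g).
Proof.
move=> lf lg; apply: lin_comp (lin_linear comul); apply: tlift_lin.
by apply: (bilin_compl (b := fun x y : C^o => (x : C) *: y) _ lf lg);
  split=> [w|v] c x y; rewrite ?scalerDl ?scalerDr -?scalerA // !scalerA mulrC.
Qed.

Lemma map_convolution n (U : 'M[H]_n) f g : lin f -> lin g -> is_corep U ->
  map_mx (convolution f g) U = map_mx f U *m map_mx g U.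
Proof.
move=> lf lg hU; apply/matrixP => i j; rewrite mxE [RHS]mxE.
rewrite /convolution (corep_comul hU) tlift_sum_tens; last first.
  by apply: bilin_balanced; apply: (bilin_compl (b := fun x y : C^o => (x : C) *: y) _ lf lg);
    split=> [w|v] c x y; rewrite ?scalerDl ?scalerDr -?scalerA // !scalerA mulrC.
by apply: eq_bigr => k _; rewrite !mxE.
Qed.

Lemma slice_algebra_star n (U : 'M[H]_n) :
  is_ucorep U -> star_subalgebra (slice_algebra U).
Proof.
move=> hU; split.
- split.
    exists (fun=> 0) => [c x y|]; first by rewrite scaler0 addr0.
    by apply/matrixP => i j; rewrite !mxE.
  move=> c _ _ [f lf ->] [g lg ->]; exists (fun h => c *: f h + g h).
    move=> d x y; rewrite lf lg !scalerDr !scalerA (mulrC c) addrACA.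
    by rewrite -!scalerA.
  by apply/matrixP => i j; rewrite !mxE.
- exists counit; first exact: counit_lin.
  by apply/matrixP => i j; rewrite !mxE (corep_counit hU).
- move=> _ _ [f lf ->] [g lg ->]; exists (convolution f g); first exact: lin_convolution.
  by rewrite map_convolution //; exact: hU.
(* This is the involution of the convolution algebra. On a unitary [U], [star (antipode (U i j))] is
   [U j i], so it becomes the adjoint of the slice. *)
- move=> _ [f lf ->]; exists (fun h => ((f (star (antipode h)))^*)%C : C^o).
    move=> c x y; rewrite linearP starD starZ lf.
    by rewrite conjc_add conjc_mul conjcK.
  apply/matrixP => i j; rewrite !mxE.
  have := congr1 (fun M : 'M_n => M i j) (ucorep_antipode hU); rewrite !mxE => ->.
  by rewrite starK.
Qed.

Lemma starmx_mul_cmx m n p (U : 'M[H]_(m, n)) (A : 'M[C]_(n, p)) :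
  starmx (U *m cmx H A) = cmx H (adj A) *m starmx U.
Proof.
apply/matrixP => i j; rewrite mxE mulr_cmxE mul_cmxE star_sum.
by apply: eq_bigr => k _; rewrite starZ !mxE.
Qed.

Lemma starmx_cmx_mul m n p (A : 'M[C]_(m, n)) (U : 'M[H]_(n, p)) :
  starmx (cmx H A *m U) = starmx U *m cmx H (adj A).
Proof.
apply/matrixP => i j; rewrite mxE mulr_cmxE mul_cmxE star_sum.
by apply: eq_bigr => k _; rewrite starZ !mxE.
Qed.

End Spans.

(** * Unitarizability from a spanning family of unitary corepresentations *)

Section SpannedUnitarizable.
Variables (R : realType) (H : hopf_star_algebra R).
Local Notation C := R[i].
Hypothesis hH : spanned_by_ucoreps H.

(* The averaged representation Phi \o p of the *-algebra of slices of U
   produces the intertwiners from c to U. *)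
Lemma corep_embedding n (c : 'M[H]_n) : is_corep c ->
  exists N (U : 'M[H]_N) (A : 'I_N -> 'I_n -> 'M[C]_(N, n)),
    [/\ is_ucorep U, forall a b, U *m cmx H (A a b) = cmx H (A a b) *m c &
        forall b j, \sum_a A a b a j = (b == j)%:R].
Proof.
move=> hc.
have [N [U [hU sU]]] := ucorep_spanning_seq hH [seq c i j | i <- enum 'I_n, j <- enum 'I_n].
have {}sU i j : exists L : 'M[C]_N, c i j = pairing L U.
  by apply: sU; apply/allpairsP; exists (i, j); rewrite !mem_enum.
pose L i j := projT1 (cid (sU i j)).
have LE i j : c i j = pairing (L i j) U by exact: projT2 (cid (sU i j)).
(* [Phi] carries a slice of [U] to the corresponding slice of [c]. On other matrices it depends on
   the choice of [L] and need not be multiplicative, so it is only used after the projection [p]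
   onto the slices. *)
pose Phi (x : 'M[C]_N) : 'M[C]_n := \matrix_(i, j) \sum_k \sum_l L i j k l * x k l.
have PhiE (f : H -> C^o) : lin f -> Phi (map_mx f U) = map_mx f c.
  move=> lf; apply/matrixP => i j; rewrite !mxE LE (lin_pairing _ _ lf).
  by apply: eq_bigr => k _; apply: eq_bigr => l _; rewrite mxE.
have lPhi : lin Phi.
  move=> d x y; apply/matrixP => i j; rewrite !mxE mulr_sumr -big_split.
  apply: eq_bigr => k _; rewrite mulr_sumr -big_split; apply: eq_bigr => l _ /=.
  by rewrite !mxE mulrDr mulrCA.
have PhiM x y : slice_algebra U x -> slice_algebra U y -> Phi (x *m y) = Phi x *m Phi y.
  move=> [f lf ->] [g lg ->].
  rewrite -(map_convolution lf lg hU) !PhiE //; last exact: lin_convolution.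
  exact: map_convolution.
have sB := slice_algebra_star hU.
have [p [lp Bp pid _ pr]] := star_subalgebra_expectation sB.
(* Right linearity of [p] and multiplicativity of [Phi] on slices make these matrices intertwiners.
   Summing over the diagonal matrix units recovers [Phi (p 1%:M)], which is the identity. *)
pose A a b : 'M[C]_(N, n) := \matrix_(k, j) Phi (p (delta_mx a k)) b j.
have lPp : lin (fun x => Phi (p x)) by exact: lin_comp.
exists N, U, A; split=> // [a b|b j].
- apply/matrixP => k j; apply/eqP; rewrite -subr_eq0; apply/eqP.
  apply: functionals_separate => f lf.
  have -> : (U *m cmx H (A a b)) k j - (cmx H (A a b) *m c) k j =
            (U *m cmx H (A a b) - cmx H (A a b) *m c) k j by rewrite !mxE.
  have -> (M : 'M[H]_(N, n)) : f (M k j) = map_mx f M k j by rewrite mxE.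
  have -> : map_mx f (U *m cmx H (A a b) - cmx H (A a b) *m c) =
     map_mx f (U *m cmx H (A a b)) - map_mx f (cmx H (A a b) *m c).
    by apply/matrixP => k' j'; rewrite !mxE -scaleN1r addrC lf addrC scaleN1r.
  rewrite map_mul_cmx // map_cmx_mul // -PhiE //.
  set d := map_mx f U; have Bd : slice_algebra U d by exists f.
  apply/eqP; rewrite mxE [X in _ + X]mxE subr_eq0; apply/eqP.
  transitivity (Phi (p (delta_mx a k *m d)) b j).
    have -> : delta_mx a k *m d = \sum_k' d k k' *: delta_mx a k'.
      apply/matrixP => i' j'; rewrite summxE mxE (bigD1 k) //= [X in _ + X]big1 ?addr0.
        rewrite (bigD1 j') //= [X in _ + X]big1 ?addr0 => [|m mj]; last first.
          by rewrite !mxE [j' == m]eq_sym (negPf mj) andbF mulr0.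
        by rewrite !mxE !eqxx !andbT mulrC.
      by move=> m mk; rewrite mxE (negPf mk) andbF mul0r.
    rewrite (lin_sum _ _ _ lPp) summxE mxE; apply: eq_bigr => k' _.
    by rewrite (linZ _ _ lPp) !mxE.
  rewrite pr // PhiM // !mxE; apply: eq_bigr => m _.
  by rewrite [A a b k m]mxE.
- have : Phi (p 1%:M) b j = (b == j)%:R.
    rewrite pid; last exact: ssub1 sB.
    have -> : 1%:M = map_mx (counit : H -> C^o) U.
      by apply/matrixP => i k; rewrite !mxE (corep_counit hU).
    by rewrite PhiE; [rewrite mxE (corep_counit hc)|exact: counit_lin].
  have -> : 1%:M = \sum_a delta_mx a a :> 'M[C]_N.
    apply/matrixP => i k; rewrite summxE (bigD1 i) //= big1 ?addr0 => [|m mi].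
      by rewrite !mxE eqxx eq_sym.
    by rewrite !mxE eq_sym (negPf mi).
  rewrite (lin_sum _ _ _ lPp) summxE => <-.
  by apply: eq_bigr => a _; rewrite mxE.
Qed.

(** The inner product is the sum of the pullbacks of the standard one along all intertwiners [A x y]
    into a unitary corepresentation. These are jointly injective by the last clause of
    [corep_embedding], whence positivity. *)
Lemma spanned_unitarizable (V : vectType C) (rho : V -> V ⊗ H) :
  is_comodule rho -> unitarizable rho.
Proof.
move=> hrho; pose b := vbasis {:V}.
have hb : basis_of fullv b := vbasisP _.
set c := coact_mx b rho; have hc : is_corep c by exact: coact_mx_corep.
have [N [U [A [hU AE A1]]]] := corep_embedding hc.
pose cc (v : V) : 'cV[C]_(\dim {:V}) := \col_i coord b i v.
have ccD d v w : cc (d *: v + w) = d *: cc v + cc w.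
  by apply/matrixP => i j; rewrite !mxE linearP.
pose G := \sum_x \sum_y adj (A x y) *m A x y.
pose ip v w : C := (adj (cc v) *m G *m cc w) 0 0.
have ipE v w : ip v w = \sum_x \sum_y \tr (adj (A x y *m cc v) *m (A x y *m cc w)).
  rewrite /ip /G mulmx_sumr mulmx_suml summxE; apply: eq_bigr => x _.
  rewrite mulmx_sumr mulmx_suml summxE; apply: eq_bigr => y _.
  by rewrite /mxtrace big_ord1 adjM !mulmxA.
have hip : is_inner_product ip.
  split=> [v d x y|v w|v vn0].
  - by rewrite /ip ccD mulmxDr -scalemxAr !mxE.
  - rewrite !ipE conjc_sum; apply: eq_bigr => x _; rewrite conjc_sum.
    by apply: eq_bigr => y _; rewrite -mxtrace_adj [adj (adj _ *m _)]adjM adjK.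
  - have pos x y : 0 <= \tr (adj (A x y *m cc v) *m (A x y *m cc v)).
      have [->|ne] := eqVneq (A x y *m cc v) 0; first by rewrite mulmx0 mxtrace0.
      exact/ltW/(ip_pos (hs_inner_product _ _ _)).
    rewrite ipE lt0r; apply/andP; split; last first.
      by apply: sumr_ge0 => x _; apply: sumr_ge0 => y _.
    apply: contraNN vn0; rewrite psumr_eq0 => [/allP h|x _]; last exact: sumr_ge0.
    have Av x y : A x y *m cc v = 0.
      have := h x (mem_index_enum _); rewrite psumr_eq0 // => /allP h'.
      have /eqP := h' y (mem_index_enum _).
      exact: (ip_eq0 (hs_inner_product _ _ _)).
    rewrite (coord_basis hb (memvf v)) big1 // => i _.
    have : \sum_a (A a i *m cc v) a 0 = 0 by rewrite big1 // => a _; rewrite Av mxE.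
    under eq_bigr do rewrite mxE.
    rewrite exchange_big /= (eq_bigr (fun j => (i == j)%:R * cc v j 0)).
      rewrite (bigD1 i) //= eqxx mul1r big1 ?addr0 ?mxE => [->|j ji]; first by rewrite scale0r.
      by rewrite eq_sym (negPf ji) mul0r.
    by move=> j _; rewrite -mulr_suml A1.
exists ip; split=> // v w.
(* Unitarizability in matrix form. It holds for each summand of [G], because [A x y] intertwines [c]
   with the unitary [U]. *)
have GE : starmx c *m cmx H G = cmx H G *m antimx c.
  rewrite /G /cmx !map_mx_sum mulmx_sumr mulmx_suml; apply: eq_bigr => x _.
  rewrite !map_mx_sum mulmx_sumr mulmx_suml; apply: eq_bigr => y _.
  rewrite -!/(cmx H _) !cmxM mulmxA -starmx_cmx_mul -AE starmx_mul_cmx.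
  rewrite -!mulmxA; congr (_ *m _).
  rewrite -[in RHS](mul1mx (cmx H _)) -(ucorep_starl hU) -(mulmxA _ U) AE -!mulmxA.
  by rewrite (corep_antipoder hc) mulmx1.
have rhoE u : rho u = \sum_(i < \dim {:V}) (b`_i ⊗ \sum_j cc u j 0 *: c i j).
  rewrite {1}(coord_basis hb (memvf u)).
  have lr : lin rho by case: hrho.
  rewrite (lin_sum _ _ _ lr).
  under eq_bigr do rewrite (linZ _ _ lr) (coact_mxE hb rho) scaler_sumr.
  rewrite exchange_big; apply: eq_bigr => i _; rewrite tens_sumr; apply: eq_bigr => j _.
  by rewrite tensZr [cc u j 0]mxE.
have ccb (i : 'I_(\dim {:V})) : cc b`_i = delta_mx i 0.
  by apply/matrixP => k l; rewrite !mxE (coord_basis_elt hb) ord1 eqxx andbT eq_sym.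
rewrite !rhoE !tlift_sum_tens; first last.
- split=> [x y z|x h k|d x h].
  + by rewrite (ipDl hip) scalerDl.
  + by rewrite starD scalerDr.
  + by rewrite (ipZl hip) starZ scalerA mulrC.
- split=> [x y z|x h k|d x h].
  + by rewrite (ipDr hip) scalerDl.
  + by rewrite linearD scalerDr.
  + by rewrite (ipZr hip) linearZ scalerA mulrC.
have ipl (i : 'I_(\dim {:V})) : ip b`_i w = \sum_k G i k * cc w k 0.
  rewrite /ip ccb.
  have -> : adj (delta_mx i 0 : 'cV[C]__) = delta_mx 0 i.
    by apply/matrixP => k l; rewrite !mxE andbC; case: (_ && _); rewrite ?conjc1 ?conjc0.
  by rewrite -rowE mxE; apply: eq_bigr => k _; rewrite mxE.
have ipr (i : 'I_(\dim {:V})) : ip v b`_i = \sum_j ((cc v j 0)^*)%C * G j i.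
  by rewrite /ip ccb -colE !mxE; apply: eq_bigr => k _; rewrite adjE.
transitivity (\sum_j \sum_k (((cc v j 0)^*)%C * cc w k 0) *: (starmx c *m cmx H G) j k).
  under [RHS]eq_bigr => j _ do under eq_bigr => k _ do rewrite mulr_cmxE scaler_sumr.
  under [RHS]eq_bigr => j _ do rewrite exchange_big.
  rewrite [RHS]exchange_big; apply: eq_bigr => i _ /=.
  rewrite ipl star_sum scaler_sumr; apply: eq_bigr => j _ /=.
  rewrite scaler_suml; apply: eq_bigr => k _.
  by rewrite starZ [starmx c j i]mxE !scalerA mulrC [G i k * _]mulrC mulrA.
rewrite GE.
under eq_bigr => j _ do under eq_bigr => k _ do rewrite mul_cmxE scaler_sumr.
under eq_bigr => j _ do rewrite exchange_big.
rewrite exchange_big; apply: eq_bigr => i _ /=.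
rewrite ipr scaler_suml; apply: eq_bigr => j _.
rewrite linear_sum scaler_sumr; apply: eq_bigr => k _ /=.
by rewrite (linZ _ _ (@antipode_lin _ H)) [antimx c i k]mxE !scalerA mulrAC.
Qed.

End SpannedUnitarizable.

(** * Hopf ideals and quotients *)

Section StandardBasis.
Variables (F : fieldType) (n : nat).

Definition row_basis : n.-tuple 'rV[F]_n := mktuple (fun i => delta_mx 0 i).

Lemma row_basis_nth (i : 'I_n) : row_basis`_i = delta_mx 0 i.
Proof. by rewrite -tnth_nth tnth_mktuple. Qed.

Lemma row_basisP : basis_of fullv row_basis.
Proof.
rewrite basisEfree size_tuple subvf dimvf /dim /= mul1n leqnn !andbT.
apply/(@freeP _ _ n row_basis) => k /rowP hk i; have := hk i.
rewrite mxE summxE (bigD1 i) // big1 => [|j ji].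
  by rewrite /= addr0 mxE row_basis_nth !mxE !eqxx mulr1.
by rewrite mxE row_basis_nth !mxE [i == j]eq_sym (negPf ji) andbF mulr0.
Qed.

End StandardBasis.

Section CQGSpanning.
Variables (R : realType) (H : cqg_algebra R).
Local Notation C := R[i].

(** The corepresentation matrix found by [corep_spanning] is realized as a coaction on row vectors;
    passing to an orthonormal basis makes it unitary and keeps the span of its entries. *)
Lemma cqg_spanned : spanned_by_ucoreps H.
Proof.
move=> h; have [n [c [hc ch]]] := corep_spanning h.
have hb := row_basisP C n; set b := row_basis C n in hb.
have hr := mx_coact_comodule hb hc.
have [b' [hb' hU]] := comodule_unitary_basis hr (cqg_unitarizable hr).
exists (\dim {:'rV[C]_n}), (coact_mx b' (mx_coact b c)); split=> //.
apply: in_span_trans ch => i j.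
have cE : c = coact_mx b (mx_coact b c).
  by apply: (coact_mx_uniq hb) => k; exact: mx_coactE.
by rewrite {2}cE; apply: coact_mx_in_span => //; exact: lin_mx_coact.
Qed.

(* On entries of unitary corepresentations this is the unitarity of their tensor
   product. *)
Lemma antipodeM (a b : H) : antipode (a * b) = antipode b * antipode a.
Proof.
have [m [U [hU [L ->]]]] := cqg_spanned a.
have [n [V [hV [M ->]]]] := cqg_spanned b.
have lS := @antipode_lin _ H.
have SU p (W : 'M[H]_p) i j : is_ucorep W -> antipode (W i j) = star (W j i).
  move=> hW; have := congr1 (fun X : 'M_p => X i j) (ucorep_antipode hW).
  by rewrite mxE [RHS]mxE.
have base i j k l : antipode (U i j * V k l) = antipode (V k l) * antipode (U i j).
  have := SU _ _ (mxtens_index (i, k)) (mxtens_index (j, l)) (ucorep_tens hU hV).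
  by rewrite !tensmxE starM (SU _ _ _ _ hU) (SU _ _ _ _ hV).
have l1 (x : H) : lin (fun y : H => antipode (y * x)).
  by apply: lin_comp lS _; exact: lin_mull.
have l2 (x : H) : lin (fun y : H => antipode (x * y)).
  by apply: lin_comp lS _; exact: lin_mulr.
have l3 (x : H) : lin (fun y : H => antipode x * antipode y).
  by apply: lin_comp lS; exact: lin_mulr.
have l4 (x : H) : lin (fun y : H => antipode y * antipode x).
  by apply: (lin_comp (f := fun z => z * antipode x)) lS; exact: lin_mull.
rewrite (lin_pairing _ _ (l1 _)) (lin_pairing _ _ (l3 _)).
apply: eq_bigr => i _; apply: eq_bigr => j _; congr (_ *: _).
rewrite (lin_pairing _ _ (l2 _)) (lin_pairing _ _ (l4 _)).
by apply: eq_bigr => k _; apply: eq_bigr => l _; rewrite base.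
Qed.

End CQGSpanning.

Section HopfIdeals.
Local Open Scope quotient_scope.
Variable R : realType.
Local Notation C := R[i].

Definition vanishes_on (H : hopf_star_algebra R) (I : H -> Prop) (U : lmodType C)
    (f : H -> H -> U) : Prop :=
  (forall x y, I x -> f x y = 0) /\ (forall x y, I y -> f x y = 0).

(* The last field says that comul maps the ideal to I ⊗ H + H ⊗ I. *)
Record hopf_star_ideal (H : hopf_star_algebra R) := HopfStarIdeal {
  ideal_pred :> H -> Prop;
  ideal_submodule : submodule_pred ideal_pred;
  ideal_mulr : forall a b, ideal_pred b -> ideal_pred (a * b);
  ideal_mull : forall a b, ideal_pred a -> ideal_pred (a * b);
  ideal_counit : forall a, ideal_pred a -> counit a = 0;
  ideal_antipode : forall a, ideal_pred a -> ideal_pred (antipode a);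
  ideal_star : forall a, ideal_pred a -> ideal_pred (star a);
  ideal_comul : forall a, ideal_pred a ->
    forall (U : lmodType C) (f : H -> H -> U), bilin f -> vanishes_on ideal_pred f ->
    tlift f (comul a) = 0
}.

Variables (H : hopf_star_algebra R) (I : hopf_star_ideal H).

Definition quot_eqv : rel H := fun a b => `[< I (a - b) >].

Lemma quot_eqvP : equiv_class_of quot_eqv.
Proof.
have sI := ideal_submodule I; split=> [a|a b|b a c].
- by apply/asboolP; rewrite subrr; case: sI.
- by apply/asboolP/asboolP => h; rewrite -opprB -scaleN1r; exact: submoduleZ.
- move=> /asboolP h1 /asboolP h2; apply/asboolP.
  by rewrite -(subrK b a) -addrA; exact: submoduleD.
Qed.

Canonical quot_equiv := EquivRelPack quot_eqvP.

Definition hquot := {eq_quot quot_eqv}.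

HB.instance Definition _ := Choice.on hquot.
HB.instance Definition _ := EqQuotient.on hquot.

Definition qpi (a : H) : hquot := \pi_hquot a.

Lemma qpiP a b : qpi a = qpi b <-> I (a - b).
Proof. by split=> [/eqquotP/asboolP //|h]; apply/eqquotP/asboolP. Qed.

Lemma qpi_repr (x : hquot) : qpi (repr x) = x.
Proof. exact: reprK. Qed.

Lemma qpi_ind (P : hquot -> Prop) : (forall a, P (qpi a)) -> forall x, P x.
Proof. by move=> h x; rewrite -(qpi_repr x). Qed.

Lemma repr_qpi a : I (repr (qpi a) - a).
Proof. by apply/qpiP; rewrite qpi_repr. Qed.

Definition q_zero : hquot := qpi 0.
Definition q_one : hquot := qpi 1.
Definition q_add (x y : hquot) : hquot := qpi (repr x + repr y).
Definition q_opp (x : hquot) : hquot := qpi (- repr x).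
Definition q_mul (x y : hquot) : hquot := qpi (repr x * repr y).
Definition q_scale (c : C) (x : hquot) : hquot := qpi (c *: repr x).

Lemma qpiD a b : q_add (qpi a) (qpi b) = qpi (a + b).
Proof.
apply/qpiP; rewrite opprD addrACA; apply: submoduleD (repr_qpi a) (repr_qpi b).
exact: ideal_submodule.
Qed.

Lemma qpiN a : q_opp (qpi a) = qpi (- a).
Proof.
by apply/qpiP; rewrite -opprD -scaleN1r; apply: submoduleZ (repr_qpi a); exact: ideal_submodule.
Qed.

Lemma qpiM a b : q_mul (qpi a) (qpi b) = qpi (a * b).
Proof.
apply/qpiP; rewrite -(subrK (a * repr (qpi b)) (repr (qpi a) * _)) -mulrBl -addrA -mulrBr.
apply: submoduleD; first exact: ideal_submodule.
  exact: ideal_mull (repr_qpi a).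
exact: ideal_mulr (repr_qpi b).
Qed.

Lemma qpiZ c a : q_scale c (qpi a) = qpi (c *: a).
Proof.
by apply/qpiP; rewrite -scalerBr; apply: submoduleZ (repr_qpi a); exact: ideal_submodule.
Qed.

Local Definition qE := (qpiD, qpiN, qpiM, qpiZ).

Lemma q_addA : associative q_add.
Proof. by elim/qpi_ind=> a; elim/qpi_ind=> b; elim/qpi_ind=> c; rewrite !qE addrA. Qed.
Lemma q_addC : commutative q_add.
Proof. by elim/qpi_ind=> a; elim/qpi_ind=> b; rewrite !qE addrC. Qed.
Lemma q_add0 : left_id q_zero q_add.
Proof. by elim/qpi_ind=> a; rewrite !qE add0r. Qed.
Lemma q_addN : left_inverse q_zero q_opp q_add.
Proof. by elim/qpi_ind=> a; rewrite !qE addNr. Qed.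

HB.instance Definition _ := GRing.isZmodule.Build hquot q_addA q_addC q_add0 q_addN.

Lemma qpi_add a b : qpi a + qpi b = qpi (a + b). Proof. exact: qpiD. Qed.

Lemma q_mulA : associative q_mul.
Proof. by elim/qpi_ind=> a; elim/qpi_ind=> b; elim/qpi_ind=> c; rewrite !qE mulrA. Qed.
Lemma q_mul1l : left_id q_one q_mul.
Proof. by elim/qpi_ind=> a; rewrite !qE mul1r. Qed.
Lemma q_mul1r : right_id q_one q_mul.
Proof. by elim/qpi_ind=> a; rewrite !qE mulr1. Qed.
Lemma q_mulDl : left_distributive q_mul q_add.
Proof. by elim/qpi_ind=> a; elim/qpi_ind=> b; elim/qpi_ind=> c; rewrite !qE mulrDl. Qed.
Lemma q_mulDr : right_distributive q_mul q_add.
Proof. by elim/qpi_ind=> a; elim/qpi_ind=> b; elim/qpi_ind=> c; rewrite !qE mulrDr. Qed.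
Lemma q_one_neq0 : q_one != 0.
Proof.
apply/eqP => /qpiP; rewrite subr0 => /ideal_counit; rewrite counit1.
by move=> /eqP; rewrite oner_eq0.
Qed.

HB.instance Definition _ := GRing.Zmodule_isNzRing.Build hquot
  q_mulA q_mul1l q_mul1r q_mulDl q_mulDr q_one_neq0.

Lemma q_scaleA c d x : q_scale c (q_scale d x) = q_scale (c * d) x.
Proof. by elim/qpi_ind: x => a; rewrite !qE scalerA. Qed.
Lemma q_scale1 : left_id 1 q_scale.
Proof. by elim/qpi_ind=> a; rewrite !qE scale1r. Qed.
Lemma q_scaleDr : right_distributive q_scale +%R.
Proof. by move=> c; elim/qpi_ind=> a; elim/qpi_ind=> b; rewrite qpi_add !qE qpi_add scalerDr. Qed.
Lemma q_scaleDl x : {morph (q_scale^~ x) : c d / c + d}.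
Proof. by elim/qpi_ind: x => a c d; rewrite !qE qpi_add scalerDl. Qed.

HB.instance Definition _ := GRing.Zmodule_isLmodule.Build C hquot
  q_scaleA q_scale1 q_scaleDr q_scaleDl.

Lemma qpi_mul a b : qpi a * qpi b = qpi (a * b). Proof. exact: qpiM. Qed.
Lemma qpi_scale c a : c *: qpi a = qpi (c *: a). Proof. exact: qpiZ. Qed.

Lemma q_scaleAl (c : C) (x y : hquot) : c *: (x * y) = c *: x * y.
Proof.
elim/qpi_ind: x => a; elim/qpi_ind: y => b.
by rewrite (qpi_scale c a) (qpi_mul a b) (qpi_mul (c *: a)) qpi_scale scalerAl.
Qed.
Lemma q_scaleAr (c : C) (x y : hquot) : c *: (x * y) = x * (c *: y).
Proof.
elim/qpi_ind: x => a; elim/qpi_ind: y => b.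
by rewrite (qpi_scale c b) (qpi_mul a b) (qpi_mul a) qpi_scale scalerAr.
Qed.

HB.instance Definition _ := GRing.Lmodule_isLalgebra.Build C hquot q_scaleAl.
HB.instance Definition _ := GRing.Lalgebra_isAlgebra.Build C hquot q_scaleAr.

Lemma qpi_is_linear : linear qpi.
Proof. by move=> c a b; rewrite -qpiD -qpiZ. Qed.
Lemma qpi_is_monoid_morphism : monoid_morphism qpi.
Proof. by split=> // a b; rewrite -qpiM. Qed.

HB.instance Definition _ := GRing.isLinear.Build C H hquot *:%R qpi qpi_is_linear.
HB.instance Definition _ := GRing.isMonoidMorphism.Build H hquot qpi qpi_is_monoid_morphism.

End HopfIdeals.

(** * The Hopf structure on the quotient by a Hopf ideal *)

Section QuotientHopf.
Variables (R : realType) (H : hopf_star_algebra R) (I : hopf_star_ideal H).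
Local Notation C := R[i].
Local Notation K := (hquot I).
Local Notation pi := (@qpi R H I).

Lemma lin_qpi : lin (pi : H -> K). Proof. exact: lin_linear. Qed.

Lemma qpi0 a : I a -> pi a = 0.
Proof. by move=> Ia; rewrite -[RHS](linear0 pi); apply/qpiP; rewrite subr0. Qed.

Lemma qpi_eq0 a : pi a = 0 -> I a.
Proof. by rewrite -(linear0 pi) => /qpiP; rewrite subr0. Qed.

Lemma qpi_factor (U : lmodType C) (f : H -> U) : lin f -> (forall a, I a -> f a = 0) ->
  forall a, f (repr (pi a)) = f a.
Proof.
move=> lf h a; apply/eqP; rewrite -subr_eq0; apply/eqP.
by have := h _ (repr_qpi I a); rewrite addrC -scaleN1r lf scaleN1r addrC.
Qed.

Lemma bilin_qpi2 : bilin (fun a b : H => pi a ⊗ pi b).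
Proof. exact: bilin_tens lin_qpi lin_qpi. Qed.

Lemma tens_qpi_vanish : vanishes_on I (fun a b : H => pi a ⊗ pi b).
Proof. by split=> a b /qpi0 ->; rewrite ?tens0l ?tens0r. Qed.

Definition q_comul (x : K) : (K ⊗ K)%type := \sw_(a, b <- comul (repr x)) (pi a ⊗ pi b).
Definition q_counit (x : K) : C^o := counit (repr x).
Definition q_antipode (x : K) : K := pi (antipode (repr x)).
Definition q_star (x : K) : K := pi (star (repr x)).

Lemma q_comulE a : q_comul (pi a) = \sw_(x, y <- comul a) (pi x ⊗ pi y).
Proof.
apply: (@qpi_factor _ (fun a => \sw_(x, y <- comul a) (pi x ⊗ pi y))).
  by apply: lin_comp (lin_linear _); exact: tlift_lin bilin_qpi2.
by move=> b Ib; apply: (ideal_comul Ib); [exact: bilin_qpi2 | exact: tens_qpi_vanish].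
Qed.

Lemma q_counitE a : q_counit (pi a) = counit a.
Proof. by apply: (@qpi_factor _ counit); [exact: lin_linear | exact: ideal_counit]. Qed.

Lemma q_antipodeE a : q_antipode (pi a) = pi (antipode a).
Proof.
apply: (@qpi_factor _ (fun a => pi (antipode a))) => [|b Ib].
  by apply: lin_comp lin_qpi _; exact: lin_linear.
by apply: qpi0; exact: ideal_antipode.
Qed.

Lemma q_starE a : q_star (pi a) = pi (star a).
Proof.
apply/qpiP; have := ideal_star (repr_qpi I a).
by rewrite -scaleN1r starD starZ rmorphN1 scaleN1r.
Qed.

Lemma q_comul_linear : linear q_comul.
Proof.
move=> c; elim/qpi_ind=> a; elim/qpi_ind=> b; rewrite -linearP !q_comulE.
by rewrite linearP (tlift_lin bilin_qpi2).
Qed.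
Lemma q_counit_linear : linear q_counit.
Proof. by move=> c; elim/qpi_ind=> a; elim/qpi_ind=> b; rewrite -linearP !q_counitE linearP. Qed.
Lemma q_antipode_linear : linear q_antipode.
Proof.
by move=> c; elim/qpi_ind=> a; elim/qpi_ind=> b; rewrite -linearP !q_antipodeE !linearP.
Qed.

HB.instance Definition _ := GRing.isLinear.Build C K (K ⊗ K)%type *:%R q_comul q_comul_linear.
HB.instance Definition _ := GRing.isLinear.Build C K C^o *:%R q_counit q_counit_linear.
HB.instance Definition _ := GRing.isLinear.Build C K K *:%R q_antipode q_antipode_linear.

Lemma sw_q_comul (U : zmodType) (f : K -> K -> U) a : balanced f ->
  tlift f (q_comul (pi a)) = \sw_(x, y <- comul a) f (pi x) (pi y).
Proof.
move=> hf; rewrite q_comulE tlift_fuse //; apply: tlift_ext => x y.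
by rewrite tlift_tens.
Qed.

Let lqc : lin q_comul. Proof. by move=> c x y; rewrite linearP. Qed.

Lemma q_comul_coassoc (a : K) :
    \sw_(x, y <- q_comul a) \sw_(x1, x2 <- q_comul x) (x1 ⊗ (x2 ⊗ y)) =
    \sw_(x, y <- q_comul a) \sw_(y1, y2 <- q_comul y) (x ⊗ (y1 ⊗ y2)).
Proof.
elim/qpi_ind: a => a.
have bL1 (y : K) : bilin (fun x1 x2 : K => x1 ⊗ (x2 ⊗ y)).
  by split=> [k|z]; [exact: lin_tensl | apply: lin_comp (lin_tensr _) (lin_tensl _)].
have bL : bilin (fun x y : K => \sw_(x1, x2 <- q_comul x) (x1 ⊗ (x2 ⊗ y))).
  apply: (bilin_nestl lqc) => // v k.
  by apply: lin_comp (lin_tensr _) (lin_tensr _).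
have bR1 (x : K) : bilin (fun y1 y2 : K => x ⊗ (y1 ⊗ y2)).
  by split=> k; apply: lin_comp (lin_tensr _) _; [exact: lin_tensl|exact: lin_tensr].
have bR : bilin (fun x y : K => \sw_(y1, y2 <- q_comul y) (x ⊗ (y1 ⊗ y2))).
  by apply: (bilin_nestr lqc) => // v k; exact: lin_tensl.
pose T (t : (H ⊗ (H ⊗ H))%type) : (K ⊗ (K ⊗ K))%type :=
  \sw_(x, u <- t) (pi x ⊗ \sw_(h, k <- u) (pi h ⊗ pi k)).
have bT : bilin (fun (x : H) (u : (H ⊗ H)%type) => pi x ⊗ \sw_(h, k <- u) (pi h ⊗ pi k)).
  by apply: bilin_tens lin_qpi _; exact: tlift_lin bilin_qpi2.
have lT : lin T by exact: tlift_lin.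
have TE x h k : T (x ⊗ (h ⊗ k)) = pi x ⊗ (pi h ⊗ pi k).
  by rewrite /T tlift_tens ?tlift_tens //; exact/bilin_balanced/bilin_qpi2 || exact: bilin_balanced.
have E := congr1 T (comul_coassoc a).
rewrite !(lin_fuse _ _ lT) in E.
rewrite (sw_q_comul _ (bilin_balanced bL)) (sw_q_comul _ (bilin_balanced bR)).
transitivity (\sw_(x, y <- comul a) T (\sw_(x1, x2 <- comul x) (x1 ⊗ (x2 ⊗ y)))).
  apply: tlift_ext => x y; rewrite (sw_q_comul _ (bilin_balanced (bL1 _))) (lin_fuse _ _ lT).
  by apply: tlift_ext => x1 x2; rewrite TE.
rewrite {}E; apply: tlift_ext => x y.
rewrite (sw_q_comul _ (bilin_balanced (bR1 _))) (lin_fuse _ _ lT).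
by apply: tlift_ext => x1 x2; rewrite TE.
Qed.

Lemma q_counit_left (a : K) : \sw_(x, y <- q_comul a) ((q_counit x : C) *: y) = a.
Proof.
elim/qpi_ind: a => a; rewrite sw_q_comul; last exact/bilin_balanced/bilin_scalel/lin_linear.
rewrite -[in RHS](counit_left a) (lin_fuse _ _ lin_qpi); apply: tlift_ext => x y.
by rewrite q_counitE (linZ _ _ lin_qpi).
Qed.

Lemma q_counit_right (a : K) : \sw_(x, y <- q_comul a) ((q_counit y : C) *: x) = a.
Proof.
elim/qpi_ind: a => a; rewrite sw_q_comul; last exact/bilin_balanced/bilin_scaler/lin_linear.
rewrite -[in RHS](counit_right a) (lin_fuse _ _ lin_qpi); apply: tlift_ext => x y.
by rewrite q_counitE (linZ _ _ lin_qpi).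
Qed.

Lemma q_comul1 : q_comul 1 = 1 ⊗ 1.
Proof.
rewrite -(rmorph1 pi) q_comulE comul1 tlift_tens ?rmorph1 //.
exact/bilin_balanced/bilin_qpi2.
Qed.

Lemma q_comulM (a b : K) : q_comul (a * b) =
  \sw_(x, y <- q_comul a) \sw_(x', y' <- q_comul b) ((x * x') ⊗ (y * y')).
Proof.
elim/qpi_ind: a => a; elim/qpi_ind: b => b.
rewrite -rmorphM /= q_comulE comulM.
have lT := tlift_lin bilin_qpi2.
rewrite (lin_fuse _ _ lT) sw_q_comul; last exact/bilin_balanced/bilin_mulmul.
apply: tlift_ext => x y; rewrite (lin_fuse _ _ lT) sw_q_comul; last first.
  exact/bilin_balanced/bilin_mulmulr.
apply: tlift_ext => x' y'; rewrite tlift_tens ?rmorphM //.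
exact/bilin_balanced/bilin_qpi2.
Qed.

Lemma q_counit1 : q_counit 1 = 1.
Proof. by rewrite -(rmorph1 pi) q_counitE counit1. Qed.

Lemma q_counitM (a b : K) : q_counit (a * b) = q_counit a * q_counit b.
Proof.
by elim/qpi_ind: a => a; elim/qpi_ind: b => b; rewrite -rmorphM /= !q_counitE counitM.
Qed.

Lemma q_antipode_left (a : K) :
  \sw_(x, y <- q_comul a) (q_antipode x * y) = (q_counit a : C)%:A.
Proof.
elim/qpi_ind: a => a; rewrite sw_q_comul; last first.
  apply: bilin_balanced; apply: (bilin_compl (bilin_mul K)) => //.
  exact: lin_linear.
rewrite q_counitE -(rmorph1 pi) -linearZ /= -antipode_left (lin_fuse _ _ lin_qpi).
by apply: tlift_ext => x y; rewrite q_antipodeE rmorphM.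
Qed.

Lemma q_antipode_right (a : K) :
  \sw_(x, y <- q_comul a) (x * q_antipode y) = (q_counit a : C)%:A.
Proof.
elim/qpi_ind: a => a; rewrite sw_q_comul; last first.
  apply: bilin_balanced; apply: (bilin_compl (bilin_mul K)) => //.
  exact: lin_linear.
rewrite q_counitE -(rmorph1 pi) -linearZ /= -antipode_right (lin_fuse _ _ lin_qpi).
by apply: tlift_ext => x y; rewrite q_antipodeE rmorphM.
Qed.

Lemma q_starD (a b : K) : q_star (a + b) = q_star a + q_star b.
Proof.
by elim/qpi_ind: a => a; elim/qpi_ind: b => b; rewrite -linearD !q_starE starD linearD.
Qed.

Lemma q_starZ (c : C) (a : K) : q_star (c *: a) = (c^*)%C *: q_star a.
Proof. by elim/qpi_ind: a => a; rewrite -linearZ !q_starE starZ linearZ. Qed.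

Lemma q_starM (a b : K) : q_star (a * b) = q_star b * q_star a.
Proof.
by elim/qpi_ind: a => a; elim/qpi_ind: b => b; rewrite -rmorphM /= !q_starE starM rmorphM.
Qed.

Lemma q_starK (a : K) : q_star (q_star a) = a.
Proof. by elim/qpi_ind: a => a; rewrite !q_starE starK. Qed.

Lemma q_comul_star (a : K) :
  q_comul (q_star a) = \sw_(x, y <- q_comul a) (q_star x ⊗ q_star y).
Proof.
elim/qpi_ind: a => a; rewrite q_starE q_comulE comul_star sw_q_comul; last first.
  split=> [x y w|v x y|c v w].
  - by rewrite q_starD tensDl.
  - by rewrite q_starD tensDr.
  - by rewrite !q_starZ tensZl tensZr.
rewrite tlift_fuse; last exact/bilin_balanced/bilin_qpi2.
apply: tlift_ext => x y; rewrite tlift_tens ?q_starE //.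
exact/bilin_balanced/bilin_qpi2.
Qed.

Definition quotient_hopf : hopf_star_algebra R :=
  @HopfStarAlgebra R K q_comul q_counit q_antipode q_star
    q_comul_coassoc q_counit_left q_counit_right q_comul1 q_comulM q_counit1 q_counitM
    q_antipode_left q_antipode_right q_starD q_starZ q_starM q_starK q_comul_star.

Definition quotient_morphism : hopf_star_morphism H quotient_hopf :=
  @HopfStarMorphism R H quotient_hopf pi q_comulE q_counitE q_antipodeE q_starE.

End QuotientHopf.

(** * Stabilizers of subspaces *)

Lemma linB (F : comNzRingType) (V U : lmodType F) (f : V -> U) x y :
  lin f -> f (x - y) = f x - f y.
Proof. by move=> hf; rewrite addrC -scaleN1r hf scaleN1r addrC. Qed.

Section MorphismImage.
Variables (R : realType) (H K : hopf_star_algebra R) (f : hopf_star_morphism H K).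
Local Notation C := R[i].

Lemma morph_lin : lin (f : H -> K). Proof. exact: lin_linear. Qed.

Lemma map_morph_cmx m n (A : 'M[C]_(m, n)) : map_mx f (cmx H A) = cmx K A.
Proof. by apply/matrixP => i j; rewrite !mxE linearZ /= rmorph1. Qed.

Lemma is_corep_morph n (U : 'M[H]_n) : is_corep U -> is_corep (map_mx f U).
Proof.
move=> hU; split=> i j; rewrite mxE.
- rewrite morph_comul (corep_comul hU) tlift_sum_tens; last first.
    exact/bilin_balanced/(bilin_tens morph_lin morph_lin).
  by apply: eq_bigr => k _; rewrite !mxE.
- by rewrite morph_counit (corep_counit hU).
Qed.

Lemma is_ucorep_morph n (U : 'M[H]_n) : is_ucorep U -> is_ucorep (map_mx f U).
Proof.
move=> hU; have sE : starmx (map_mx f U) = map_mx f (starmx U).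
  by apply/matrixP => i j; rewrite !mxE morph_star.
split; first exact/is_corep_morph/hU.
- by rewrite sE -map_mxM ucorep_starl // map_mx1.
- by rewrite sE -map_mxM ucorep_starr // map_mx1.
Qed.

Lemma pairing_morph m n (L : 'M[C]_(m, n)) (U : 'M[H]_(m, n)) :
  f (pairing L U) = pairing L (map_mx f U).
Proof.
rewrite (lin_pairing _ _ morph_lin); apply: eq_bigr => i _.
by apply: eq_bigr => j _; rewrite mxE.
Qed.

Lemma coact_mx_push (V : vectType C) n (b : n.-tuple V) (rho : V -> V ⊗ H) :
  coact_mx b (push_coact f rho) = map_mx f (coact_mx b rho).
Proof.
apply/matrixP => i j; rewrite !mxE /push_coact /slice.
rewrite tlift_fuse; last exact/bilin_balanced/bilin_scalel/lin_coord.
rewrite (lin_fuse _ _ morph_lin); apply: tlift_ext => x h.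
rewrite tlift_tens ?linearZ //; exact/bilin_balanced/bilin_scalel/lin_coord.
Qed.

End MorphismImage.

(** * Commutators with scalar matrices and the ideals they generate *)

Section Commutators.
Variables (R : realType) (H : hopf_star_algebra R).
Local Notation C := R[i].

Definition commutator n (T : 'M[C]_n) (U : 'M[H]_n) : 'M[H]_n :=
  cmx H T *m U - U *m cmx H T.

Lemma commutatorE n (T : 'M[C]_n) (U : 'M[H]_n) i j :
  commutator T U i j = \sum_k T i k *: U k j - \sum_k T k j *: U i k.
Proof. by rewrite mxE mul_cmxE [X in _ + X]mxE mulr_cmxE. Qed.

Lemma map_commutator n (f : H -> C^o) (T : 'M[C]_n) (U : 'M[H]_n) : lin f ->
  map_mx f (commutator T U) = T *m map_mx f U - map_mx f U *m T.
Proof.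
move=> lf; rewrite -map_cmx_mul // -map_mul_cmx //.
by apply/matrixP => i j; rewrite !mxE addrC -scaleN1r lf scaleN1r addrC.
Qed.

(** Unitarity rewrites the adjoint of a commutator as a commutator between two copies of [starmx U].
    With the analogue for the antipode, this keeps the ideal generated by the entries stable under
    both maps when [T] is self-adjoint. *)
Lemma starmx_commutator n (T : 'M[C]_n) (U : 'M[H]_n) : is_ucorep U ->
  starmx (commutator T U) = starmx U *m commutator (adj T) U *m starmx U.
Proof.
move=> hU; have sB (A B : 'M[H]_n) : starmx (A - B) = starmx A - starmx B.
  by apply/matrixP => i j; rewrite !mxE -scaleN1r starD starZ rmorphN1 scaleN1r.
rewrite sB starmx_cmx_mul starmx_mul_cmx mulmxBr mulmxBl !mulmxA.
rewrite -(mulmxA _ U) ucorep_starr // mulmx1; congr (_ - _).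
by rewrite ucorep_starl // mul1mx.
Qed.

Lemma antimx_commutator n (T : 'M[C]_n) (U : 'M[H]_n) : is_ucorep U ->
  antimx (commutator T U) = - (starmx U *m commutator T U *m starmx U).
Proof.
move=> hU; have aE : antimx (commutator T U) = cmx H T *m starmx U - starmx U *m cmx H T.
  rewrite -ucorep_antipode //; apply/matrixP => i j.
  have lS := @antipode_lin _ H.
  rewrite mxE commutatorE linearB /= !(lin_sum _ _ _ lS) mxE mul_cmxE [X in _ = _ + X]mxE.
  by rewrite mulr_cmxE; congr (_ - _); apply: eq_bigr => k _; rewrite (linZ _ _ lS) mxE.
rewrite aE mulmxBr mulmxBl !mulmxA -(mulmxA _ U) ucorep_starr // mulmx1.
by rewrite ucorep_starl // mul1mx opprB.
Qed.

(** Scalar multiples need no clause of their own, being products with scalars of the algebra.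
    Closure properties are proved by induction on membership. *)
Inductive gen_ideal n (T : 'M[C]_n) (U : 'M[H]_n) : H -> Prop :=
| gen_commutator i j : gen_ideal T U (commutator T U i j)
| gen_zero : gen_ideal T U 0
| gen_add a b : gen_ideal T U a -> gen_ideal T U b -> gen_ideal T U (a + b)
| gen_mull a b : gen_ideal T U a -> gen_ideal T U (a * b)
| gen_mulr a b : gen_ideal T U b -> gen_ideal T U (a * b).

Lemma gen_submodule n (T : 'M[C]_n) (U : 'M[H]_n) : submodule_pred (gen_ideal T U).
Proof.
split; first exact: gen_zero.
move=> c a b ha hb; apply: gen_add => //.
by rewrite -[a]mul1r scalerAl; exact: gen_mulr.
Qed.

Definition mx_in (I : H -> Prop) m n (M : 'M[H]_(m, n)) := forall i j, I (M i j).

End Commutators.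

Section MatrixIdeals.
Variables (R : realType) (H : hopf_star_algebra R) (I : H -> Prop).
Hypothesis sI : submodule_pred I.
Hypothesis Il : forall a b, I a -> I (a * b).
Hypothesis Ir : forall a b, I b -> I (a * b).

Lemma mx_inMl m n p (M : 'M[H]_(m, n)) (N : 'M[H]_(n, p)) : mx_in I M -> mx_in I (M *m N).
Proof. by move=> h i j; rewrite mxE; apply: submodule_sum => // k _; exact: Il. Qed.

Lemma mx_inMr m n p (M : 'M[H]_(m, n)) (N : 'M[H]_(n, p)) : mx_in I N -> mx_in I (M *m N).
Proof. by move=> h i j; rewrite mxE; apply: submodule_sum => // k _; exact: Ir. Qed.

Lemma mx_inD m n (M N : 'M[H]_(m, n)) : mx_in I M -> mx_in I N -> mx_in I (M + N).
Proof. by move=> h k i j; rewrite mxE; exact: submoduleD. Qed.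

Lemma mx_inN m n (M : 'M[H]_(m, n)) : mx_in I M -> mx_in I (- M).
Proof. by move=> h i j; rewrite mxE -scaleN1r; exact: submoduleZ. Qed.

End MatrixIdeals.

Section GeneratedHopfIdeal.
Variables (R : realType) (H : cqg_algebra R) (n : nat).
Local Notation C := R[i].
Variables (P : 'M[C]_n) (U : 'M[H]_n).
Hypothesis hU : is_ucorep U.
Hypothesis hP : adj P = P.
Local Notation I := (gen_ideal P U).

Let comm_in : mx_in I (starmx U *m commutator P U *m starmx U).
Proof.
have sI := gen_submodule P U.
apply: (mx_inMl sI (@gen_mull _ _ _ P U)); apply: (mx_inMr sI (@gen_mulr _ _ _ P U)).
by move=> i j; exact: gen_commutator.
Qed.

Lemma gen_counit a : I a -> counit a = 0.
Proof.
elim=> [i j||b c _ hb _ hc|b c _ hb|b c _ hb].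
- have := congr1 (fun M : 'M_n => M i j) (map_commutator P U (@counit_lin _ H)).
  have -> : map_mx (counit : H -> C^o) U = 1%:M.
    by apply/matrixP => k l; rewrite !mxE (corep_counit hU).
  by rewrite mulmx1 mul1mx subrr !mxE.
- by rewrite linear0.
- by rewrite linearD /= hb hc addr0.
- by rewrite counitM hb mul0r.
- by rewrite counitM hb mulr0.
Qed.

Lemma gen_antipode a : I a -> I (antipode a).
Proof.
have sI := gen_submodule P U.
elim=> [i j||b c _ hb _ hc|b c _ hb|b c _ hb].
- have := congr1 (fun M : 'M_n => M i j) (antimx_commutator P hU).
  by rewrite [LHS]mxE => ->; exact: (mx_inN sI comm_in).
- by rewrite linear0; exact: gen_zero.
- by rewrite linearD; exact: gen_add.
- by rewrite antipodeM; exact: gen_mulr.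
- by rewrite antipodeM; exact: gen_mull.
Qed.

Lemma gen_star a : I a -> I (star a).
Proof.
elim=> [i j||b c _ hb _ hc|b c _ hb|b c _ hb].
- have := congr1 (fun M : 'M_n => M j i) (starmx_commutator P hU).
  by rewrite [LHS]mxE hP => ->; exact: comm_in.
- by rewrite star0; exact: gen_zero.
- by rewrite starD; exact: gen_add.
- by rewrite starM; exact: gen_mulr.
- by rewrite starM; exact: gen_mull.
Qed.

Lemma gen_comul a : I a -> forall (L : lmodType C) (f : H -> H -> L),
  bilin f -> vanishes_on I f -> tlift f (comul a) = 0.
Proof.
move=> Ia L.
have tlift_zero (f : H -> H -> L) t : (forall x y, f x y = 0) -> tlift f t = 0.
  by move=> h; rewrite /tlift /formal_lift big1.
elim: Ia => [i j||b c _ hb _ hc|b c _ hb|b c _ hb] f bf [f1 f2].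
- have lf := tlift_lin bf.
  have fU k l : tlift f (comul (U k l)) = \sum_m f (U k m) (U m l).
    by rewrite (corep_comul hU) tlift_sum_tens //; exact: bilin_balanced.
  have lfr x : lin (f x) by case: bf.
  have lfl y : lin (f^~ y) by case: bf.
  have lfc : lin (fun a => tlift f (comul a)) by apply: lin_comp lf (lin_linear _).
  rewrite commutatorE -scaleN1r addrC lfc scaleN1r addrC !(lin_sum _ _ _ lfc).
  under eq_bigr do rewrite (linZ _ _ lfc) fU scaler_sumr.
  under [X in _ - X]eq_bigr do rewrite (linZ _ _ lfc) fU scaler_sumr.
  rewrite exchange_big [X in _ - X]exchange_big /= -sumrB.
  (* The commutator behaves as a coderivation: comul sends [P, U] to [P, U] ⊗ U + U ⊗ [P, U]. The
     mixed terms [D m] and [E m] cancel only after summation over m. *)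
  pose D m := \sum_k P k m *: f (U i k) (U m j).
  pose E m := \sum_k P m k *: f (U i m) (U k j).
  have DE : \sum_m D m = \sum_m E m by rewrite /D exchange_big.
  transitivity (\sum_m (f (commutator P U i m) (U m j) + f (U i m) (commutator P U m j))).
    apply/eqP; rewrite -subr_eq0 -sumrB; apply/eqP.
    transitivity (\sum_m (D m - E m)); last by rewrite sumrB DE subrr.
    apply: eq_bigr => m _.
    have fB x y z : f (x - y) z = f x z - f y z.
      exact: (linB _ _ (lfl z)).
    have fB' x y z : f x (y - z) = f x y - f x z.
      exact: linB.
    rewrite !commutatorE fB fB' (lin_sum _ _ _ (lfl _)) (lin_sum _ _ _ (lfl _)).
    rewrite !(lin_sum _ _ _ (lfr _)).
    under [\sum_k f (P i k *: _) _]eq_bigr do rewrite (linZ _ _ (lfl _)).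
    under [\sum_k f (P k m *: _) _]eq_bigr do rewrite (linZ _ _ (lfl _)).
    under [\sum_k f _ (P m k *: _)]eq_bigr do rewrite (linZ _ _ (lfr _)).
    under [\sum_k f _ (P k j *: _)]eq_bigr do rewrite (linZ _ _ (lfr _)).
    rewrite -/(D m) -/(E m).
    set A := \sum_k P i k *: _; set B := \sum_k P k j *: _.
    rewrite opprD !opprB addrA [A - B + _]addrC [D m - A + _]addrA subrK.
    by rewrite addrA subrK.
  by rewrite big1 // => m _; rewrite f1 ?f2 ?addr0 //; exact: gen_commutator.
- by rewrite linear0 (lin0 (tlift_lin bf)).
- by rewrite linearD (linD _ _ (tlift_lin bf)) hb // hc // addr0.
(* The other factor of the product is absorbed into the test map, which still vanishes on the ideal.
   This is why the induction keeps [f] general. *)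
- have lf := tlift_lin bf; have [bl br] := bilin_mulmul (comul c).
  rewrite comulM (lin_fuse _ _ lf); apply: hb.
    by split=> [w|v]; apply: lin_comp lf _; [exact: bl | exact: br].
  split=> x y Ixy; rewrite (lin_fuse _ _ lf); apply: tlift_zero => x' y';
    rewrite tlift_tens; try exact: bilin_balanced.
    by apply: f1; exact: gen_mull.
  by apply: f2; exact: gen_mull.
- have lf := tlift_lin bf; rewrite comulM (lin_fuse _ _ lf); apply: tlift_zero => x y.
  have [bl br] := bilin_mulmulr x y.
  rewrite (lin_fuse _ _ lf); apply: hb.
    by split=> [w|v]; apply: lin_comp lf _; [exact: bl | exact: br].
  split=> x' y' Ixy; rewrite tlift_tens; try exact: bilin_balanced.
    by apply: f1; exact: gen_mulr.
  by apply: f2; exact: gen_mulr.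
Qed.

End GeneratedHopfIdeal.

Section QuotientCQG.
Variables (R : realType) (H : cqg_algebra R) (I : hopf_star_ideal H).

Lemma quotient_spanned : spanned_by_ucoreps (quotient_hopf I).
Proof.
elim/qpi_ind=> a; have [n [U [hU [L ->]]]] := cqg_spanned a.
exists n, (map_mx (quotient_morphism I) U); split; first exact: is_ucorep_morph.
by exists L; exact: (pairing_morph (quotient_morphism I)).
Qed.

Definition quotient_cqg : cqg_algebra R :=
  CQGAlgebra (@spanned_unitarizable R (quotient_hopf I) quotient_spanned).

End QuotientCQG.

Section QuotientLift.
Variables (R : realType) (H K : hopf_star_algebra R) (I : hopf_star_ideal H).
Local Notation C := R[i].
Variable f : hopf_star_morphism H K.

Definition kills := forall a, I a -> f a = 0.
Hypothesis hf : kills.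

(* The unused proof argument is what lets the canonical morphism structures
   below be found from [q_lift hf]. *)
Definition q_lift (_ : kills) (x : hquot I) : K := f (repr x).

Lemma q_liftE a : q_lift hf (qpi I a) = f a.
Proof. by apply: (@qpi_factor _ _ _ _ f) => //; exact: lin_linear. Qed.

Lemma q_lift_linear : linear (q_lift hf).
Proof.
by move=> c; elim/qpi_ind=> a; elim/qpi_ind=> b; rewrite -linearP !q_liftE linearP.
Qed.

Lemma q_lift_monoid_morphism : monoid_morphism (q_lift hf).
Proof.
split; first by rewrite -(rmorph1 (qpi I)) q_liftE rmorph1.
by elim/qpi_ind=> a; elim/qpi_ind=> b; rewrite -rmorphM /= !q_liftE rmorphM.
Qed.

HB.instance Definition _ :=
  GRing.isLinear.Build C (hquot I) K *:%R (q_lift hf) q_lift_linear.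
HB.instance Definition _ :=
  GRing.isMonoidMorphism.Build (hquot I) K (q_lift hf) q_lift_monoid_morphism.

Lemma q_lift_comul (a : quotient_hopf I) :
  comul (q_lift hf a) = \sw_(x, y <- comul a) (q_lift hf x ⊗ q_lift hf y).
Proof.
elim/qpi_ind: a => a; rewrite q_liftE morph_comul.
rewrite [comul _ in RHS]/(q_comul _) /= sw_q_comul; last first.
  exact/bilin_balanced/(bilin_tens (lin_linear (q_lift hf)) (lin_linear (q_lift hf))).
by apply: tlift_ext => x y; rewrite !q_liftE.
Qed.

Lemma q_lift_counit (a : quotient_hopf I) : counit (q_lift hf a) = counit a.
Proof.
elim/qpi_ind: a => a; rewrite q_liftE morph_counit.
exact/esym/q_counitE.
Qed.

Lemma q_lift_antipode (a : quotient_hopf I) : antipode (q_lift hf a) = q_lift hf (antipode a).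
Proof.
elim/qpi_ind: a => a; rewrite q_liftE morph_antipode.
have -> : antipode (qpi I a : quotient_hopf I) = qpi I (antipode a) by exact: q_antipodeE.
by rewrite q_liftE.
Qed.

Lemma q_lift_star (a : quotient_hopf I) : star (q_lift hf a) = q_lift hf (star a).
Proof.
elim/qpi_ind: a => a; rewrite q_liftE morph_star.
have -> : star (qpi I a : quotient_hopf I) = qpi I (star a) by exact: q_starE.
by rewrite q_liftE.
Qed.

Definition lift_morphism : hopf_star_morphism (quotient_hopf I) K :=
  @HopfStarMorphism R (quotient_hopf I) K (q_lift hf)
    q_lift_comul q_lift_counit q_lift_antipode q_lift_star.

End QuotientLift.

(** * Orthogonal projections and subcomodules *)

Section Projections.
Variable R : realType.
Local Notation C := R[i].

Definition is_oproj n (P : 'M[C]_n) := adj P = P /\ P *m P = P.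

Lemma mx_ext_col m n (A B : 'M[C]_(m, n)) :
  (forall x : 'cV[C]_n, A *m x = B *m x) -> A = B.
Proof.
move=> h; apply/matrixP => i j; have := h (delta_mx j 0).
by rewrite -!colE => /matrixP/(_ i 0); rewrite !mxE.
Qed.

Lemma oproj_exists n (S : 'cV[C]_n -> Prop) : submodule_pred S ->
  exists2 P : 'M[C]_n, is_oproj P & forall x, S x <-> P *m x = x.
Proof.
move=> sS; have [U hU] := vspace_of_submodule sS.
have hsp := hs_inner_product R n 1.
set ip := (fun A B : 'M[C]_(n, 1) => \tr (adj A *m B)) in hsp.
have [s hs sU] := gram_schmidt hsp (vbasis U).
rewrite (span_basis (vbasisP U)) in sU.
pose P : 'M[C]_n := \sum_(j < size s) s`_j *m adj s`_j.
have PE x : P *m x = \sum_(j < size s) ip s`_j x *: s`_j.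
  rewrite mulmx_suml; apply: eq_bigr => j _; rewrite -mulmxA.
  by rewrite [adj _ *m x]mx11_scalar mul_mx_scalar /ip /mxtrace big_ord1.
have SP x : S (P *m x).
  apply/hU; rewrite PE -sU; apply: memv_suml => j _.
  by apply/memvZ/memv_span/mem_nth.
have PS x : S x -> P *m x = x.
  move=> Sx; apply/esym/eqP; rewrite -subr_eq0; apply/eqP/(ip_eq0 hsp).
  have : x - P *m x \in <<s>>%VS by rewrite sU; apply/hU; exact: submoduleB.
  move=> /(@coord_span _ _ _ (in_tuple s)) E; rewrite {1}E.
  rewrite (ip_suml hsp) big1 // => i _; rewrite (ipZl hsp) PE.
  by rewrite (orthonormal_proj hsp x hs) ?mulr0.
exists P; last by move=> x; split=> [|<-]; [exact: PS | exact: SP].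
split; last by apply: mx_ext_col => x; rewrite -mulmxA PS.
rewrite /P (big_morph (@adj R n n) (@adjD R n n) (adj0 R n n)).
by apply: eq_bigr => j _; rewrite adjM adjK.
Qed.

End Projections.

Section Subcomodules.
Variables (R : realType) (K : hopf_star_algebra R) (V : vectType R[i]).
Local Notation C := R[i].
Variables (n : nat) (b : n.-tuple V).
Hypothesis hb : basis_of fullv b.

Definition colv (v : V) : 'cV[C]_n := \col_i coord b i v.
Definition vecv (x : 'cV[C]_n) : V := \sum_(i < n) x i 0 *: b`_i.

Lemma lin_colv : lin colv.
Proof. by move=> c v w; apply/colP => i; rewrite !mxE linearP. Qed.

Lemma lin_vecv : lin vecv.
Proof.
move=> c x y; rewrite /vecv scaler_sumr -big_split; apply: eq_bigr => i _ /=.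
by rewrite !mxE scalerDl scalerA.
Qed.

Lemma colvK : cancel colv vecv.
Proof.
move=> v; rewrite [RHS](coord_basis hb (memvf v)).
by apply: eq_bigr => i _; rewrite mxE.
Qed.

Lemma vecvK : cancel vecv colv.
Proof.
move=> x; apply/colP => i; rewrite mxE linear_sum (bigD1 i) //= linearZ /=.
rewrite (coord_basis_elt hb) eqxx mulr1 big1 ?addr0 // => j ji.
by rewrite linearZ /= (coord_basis_elt hb) (negPf ji) mulr0.
Qed.

(** Orthogonality is that of coordinate vectors, as if [b] were declared orthonormal. *)
Definition proj_on (P : 'M[C]_n) (W : {vspace V}) : Prop :=
  is_oproj P /\ forall v, v \in W <-> P *m colv v = colv v.

Lemma proj_on_exists (W : {vspace V}) : exists P, proj_on P W.
Proof.
have [|P oP hP] := @oproj_exists R n (fun x => vecv x \in W).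
  split=> [|c x y hx hy]; first by rewrite (lin0 lin_vecv) mem0v.
  by rewrite lin_vecv; apply: memvD => //; exact: memvZ.
by exists P; split=> // v; rewrite -hP colvK.
Qed.

Lemma proj_on_vec (P : 'M[C]_n) W x : proj_on P W -> vecv (P *m x) \in W.
Proof. by move=> [[_ PP] h]; apply/h; rewrite vecvK mulmxA PP. Qed.

Variable rho : V -> V ⊗ K.
Hypothesis hrho : is_comodule rho.
Local Notation c := (coact_mx b rho).

Lemma slice_rho i v : slice b i (rho v) = (c *m cmx K (colv v)) i 0.
Proof.
have lr : lin rho by case: hrho.
rewrite -{1}(colvK v) (lin_sum _ _ _ lr) (lin_sum _ _ _ (lin_slice _ _)) mulr_cmxE.
apply: eq_bigr => j _; rewrite (linZ _ _ lr) (linZ _ _ (lin_slice _ _)).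
by rewrite [c i j]mxE.
Qed.

Lemma antimx_cmx_mul m p q (A : 'M[C]_(m, p)) (X : 'M[K]_(p, q)) :
  antimx (cmx K A *m X) = cmx K A *m antimx X.
Proof.
apply/matrixP => i j; have lS := @antipode_lin _ K.
rewrite mxE !mul_cmxE (lin_sum _ _ _ lS).
by apply: eq_bigr => k _; rewrite (linZ _ _ lS) mxE.
Qed.

Lemma antimx_mul_cmx m p q (X : 'M[K]_(m, p)) (A : 'M[C]_(p, q)) :
  antimx (X *m cmx K A) = antimx X *m cmx K A.
Proof.
apply/matrixP => i j; have lS := @antipode_lin _ K.
rewrite mxE !mulr_cmxE (lin_sum _ _ _ lS).
by apply: eq_bigr => k _; rewrite (linZ _ _ lS) mxE.
Qed.

Lemma starmxK m p (X : 'M[K]_(m, p)) : starmx (starmx X) = X.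
Proof. by apply/matrixP => i j; rewrite !mxE starK. Qed.

(** Invariance of [W] only says P c P = c P. Applying the antipode and then the star, with [c]
    unitary and [P] self-adjoint, gives P c P = P c as well: the orthogonal complement is also a
    subcomodule. *)
Lemma subcomodule_commutator (P : 'M[C]_n) W : is_ucorep c -> proj_on P W ->
  is_subcomodule rho W <-> commutator P c = 0.
Proof.
move=> hc hPW; have [[aP PP] hW] := hPW.
have mulcol j : c *m cmx K (col j P) = col j (c *m cmx K P).
  by apply/colP => i; rewrite mulr_cmxE [RHS]mxE mulr_cmxE; apply: eq_bigr => k _; rewrite mxE.
pose w j := vecv (col j P).
have wW j : w j \in W by rewrite /w colE; exact: proj_on_vec.
split=> [hsub|/eqP].
- have E : cmx K P *m (c *m cmx K P) = c *m cmx K P.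
    apply/matrixP => i j.
    have sE k : (c *m cmx K P) k j = slice b k (rho (w j)).
      by rewrite slice_rho /w vecvK mulcol [RHS]mxE.
    have [s [hs rE]] := hsub _ (wW j).
    have {}sE k : (c *m cmx K P) k j = \sum_(p <- s) coord b k p.1 *: p.2.
      rewrite sE rE (lin_sum _ _ _ (lin_slice _ _)).
      by apply: eq_bigr => p _; rewrite slice_tens.
    rewrite mul_cmxE sE; under eq_bigr do rewrite sE scaler_sumr.
    rewrite exchange_big; apply: eq_big_seq => p /hs/hW /colP/(_ i).
    rewrite !mxE => <-; rewrite scaler_suml; apply: eq_bigr => k _.
    by rewrite mxE scalerA.
  have := congr1 (@starmx _ _ _ _) (congr1 (@antimx _ _ _ _) E).
  rewrite antimx_cmx_mul antimx_mul_cmx ucorep_antipode //.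
  rewrite starmx_cmx_mul !starmx_mul_cmx starmxK aP => E'.
  by rewrite /commutator -E' -E mulmxA subrr.
- rewrite subr_eq0 => /eqP E v /hW vE.
  exists [seq (w k, slice b k (rho v)) | k <- enum 'I_n]; split.
    by move=> p /mapP[k _ ->]; exact: wW.
  rewrite big_map big_enum /= {1}(tens_slices hb (rho v)).
  have sE i : slice b i (rho v) = \sum_k P i k *: slice b k (rho v).
    rewrite slice_rho -vE cmxM mulmxA -E -mulmxA mul_cmxE.
    by apply: eq_bigr => k _; rewrite slice_rho.
  under [LHS]eq_bigr do rewrite sE tens_sumr.
  rewrite [LHS]exchange_big; apply: eq_bigr => k _ /=; rewrite /w /vecv tens_suml.
  by apply: eq_bigr => i _; rewrite mxE tensZl tensZr.
Qed.

End Subcomodules.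

Section Stabilizers.
Variables (R : realType) (H : cqg_algebra R) (V : vectType R[i]).
Local Notation C := R[i].
Variables (rho : V -> V ⊗ H) (n : nat) (b : n.-tuple V).
Hypothesis hrho : is_comodule rho.
Hypothesis hb : basis_of fullv b.
Local Notation U := (coact_mx b rho).
Hypothesis hU : is_ucorep U.
Variables (W : {vspace V}) (P : 'M[C]_n).
Hypothesis hPW : proj_on b P W.

Lemma map_morph_commutator (A B : hopf_star_algebra R) (f : hopf_star_morphism A B)
    m (T : 'M[C]_m) (X : 'M[A]_m) :
  map_mx f (commutator T X) = commutator T (map_mx f X).
Proof. by rewrite map_mxB !map_mxM !map_morph_cmx. Qed.

Lemma subcomodule_kills (K : hopf_star_algebra R) (f : hopf_star_morphism H K) :
  is_subcomodule (push_coact f rho) W <-> forall a, gen_ideal P U a -> f a = 0.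
Proof.
rewrite (subcomodule_commutator hb (is_comodule_push f hrho) _ hPW) coact_mx_push; last first.
  exact: is_ucorep_morph.
rewrite -map_morph_commutator; split=> [E a|h].
  elim=> [i j||x y _ hx _ hy|x y _ hx|x y _ hy].
  - by have /matrixP/(_ i j) := E; rewrite mxE [RHS]mxE.
  - by rewrite linear0.
  - by rewrite linearD /= hx hy addr0.
  - by rewrite rmorphM /= hx mul0r.
  - by rewrite rmorphM /= hy mulr0.
by apply/matrixP => i j; rewrite mxE [RHS]mxE; apply: h; exact: gen_commutator.
Qed.

Let hP : adj P = P. Proof. by case: hPW => [[]]. Qed.

Definition stab_ideal : hopf_star_ideal H :=
  HopfStarIdeal (gen_submodule P U) (@gen_mulr _ _ _ P U) (@gen_mull _ _ _ P U)
    (gen_counit hU) (gen_antipode hU) (gen_star hU hP) (gen_comul hU).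

Lemma stabilizer_exists :
  @is_stabilizer R H V rho W (quotient_cqg stab_ideal) (quotient_morphism stab_ideal).
Proof.
split; first by apply/subcomodule_kills => a Ia; exact: qpi0.
move=> K' f /subcomodule_kills hf.
pose g := lift_morphism (I := stab_ideal) hf.
exists g; split=> [a|g' hg']; first exact: (q_liftE (I := stab_ideal) hf).
elim/qpi_ind=> a; rewrite [LHS]hg'; exact/esym/(q_liftE (I := stab_ideal) hf).
Qed.

(** Whatever [K] realizes the universal property, it maps to the explicit quotient compatibly with
    the maps from [H], so its kernel is no larger than the ideal. *)
Lemma stabilizer_kernel (K : cqg_algebra R) (f : hopf_star_morphism H K) a :
  is_stabilizer rho W f -> f a = 0 <-> gen_ideal P U a.
Proof.
move=> [hsub huniv]; split; last by move: a; apply/subcomodule_kills.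
move=> fa0; have [g [hg _]] := huniv _ _ (proj1 stabilizer_exists).
apply: (@qpi_eq0 _ _ stab_ideal); rewrite -[LHS]hg fa0; exact: linear0.
Qed.

End Stabilizers.

(** * Extension of intertwiners *)

Section CommutatorAlgebra.
Variables (R : realType) (H : hopf_star_algebra R).
Local Notation C := R[i].

Lemma commutator_lin n c (S T : 'M[C]_n) (Z : 'M[H]_n) i j :
  commutator (c *: S + T) Z i j = c *: commutator S Z i j + commutator T Z i j.
Proof.
rewrite !commutatorE scalerBr addrACA -opprD !scaler_sumr -!big_split /=.
by congr (_ - _); apply: eq_bigr => k _; rewrite !mxE scalerDl scalerA.
Qed.

Lemma commutator1 n (Z : 'M[H]_n) : commutator 1%:M Z = 0.
Proof. by rewrite /commutator cmx1 mul1mx mulmx1 subrr. Qed.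

Lemma commutator0 n (Z : 'M[H]_n) : commutator 0 Z = 0.
Proof. by rewrite /commutator cmx0 mul0mx mulmx0 subrr. Qed.

Lemma commutatorM n (S T : 'M[C]_n) (Z : 'M[H]_n) :
  commutator (S *m T) Z = cmx H S *m commutator T Z + commutator S Z *m cmx H T.
Proof. by rewrite /commutator cmxM mulmxBr mulmxBl !mulmxA addrA subrK. Qed.

Lemma commutator_adj n (T : 'M[C]_n) (Z : 'M[H]_n) : is_ucorep Z ->
  commutator (adj T) Z = Z *m starmx (commutator T Z) *m Z.
Proof.
move=> hZ; rewrite starmx_commutator // !mulmxA ucorep_starr // mul1mx.
by rewrite -mulmxA ucorep_starl // mulmx1.
Qed.

Lemma cmx_block m1 m2 n1 n2 (A : 'M[C]_(m1, n1)) (B : 'M_(m1, n2))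
    (D : 'M_(m2, n1)) (E : 'M_(m2, n2)) :
  cmx H (block_mx A B D E) = block_mx (cmx H A) (cmx H B) (cmx H D) (cmx H E).
Proof. exact: map_block_mx. Qed.

Lemma commutator_block m n (A : 'M[C]_m) B D (E : 'M[C]_n) (Y : 'M[H]_m) (Z : 'M[H]_n) :
  commutator (block_mx A B D E) (block_mx Y 0 0 Z) =
  block_mx (commutator A Y) (cmx H B *m Z - Y *m cmx H B)
           (cmx H D *m Y - Z *m cmx H D) (commutator E Z).
Proof.
rewrite /commutator cmx_block !mulmx_block !mulmx0 !mul0mx !addr0 !add0r.
by rewrite opp_block_mx add_block_mx.
Qed.

Lemma commutator_block_diag m n (A : 'M[C]_m) (E : 'M[C]_n) (Y : 'M[H]_m) (Z : 'M[H]_n) :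
  commutator (block_mx A 0 0 E) (block_mx Y 0 0 Z) =
  block_mx (commutator A Y) 0 0 (commutator E Z).
Proof. by rewrite commutator_block !cmx0 !mulmx0 !mul0mx !subrr. Qed.

Lemma commutator_tensl m n (T : 'M[C]_m) (Z : 'M[H]_m) (Y : 'M[H]_n) :
  commutator (T *t 1%:M) (Z *t Y) = commutator T Z *t Y.
Proof.
apply/matrixP => k l; case: (mxtens_indexP k) => i a; case: (mxtens_indexP l) => j d.
rewrite tensmxE !commutatorE !sum_mxtens mulrBl !mulr_suml.
congr (_ - _); apply: eq_bigr => p _.
  rewrite (bigD1 a) //= big1 ?addr0 => [|q qa]; rewrite !tensmxE mxE.
    by rewrite eqxx mulr1 scalerAl.
  by rewrite eq_sym (negPf qa) mulr0 scale0r.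
rewrite (bigD1 d) //= big1 ?addr0 => [|q qa]; rewrite !tensmxE mxE.
  by rewrite eqxx mulr1 scalerAl.
by rewrite (negPf qa) mulr0 scale0r.
Qed.

Lemma commutator_tensr m n (T : 'M[C]_n) (Y : 'M[H]_m) (Z : 'M[H]_n) :
  commutator (1%:M *t T) (Y *t Z) = Y *t commutator T Z.
Proof.
apply/matrixP => k l; case: (mxtens_indexP k) => i a; case: (mxtens_indexP l) => j d.
rewrite tensmxE !commutatorE !sum_mxtens mulrBr !mulr_sumr.
congr (_ - _); rewrite exchange_big; apply: eq_bigr => p _ /=.
  rewrite (bigD1 i) //= big1 ?addr0 => [|q qa]; rewrite !tensmxE mxE.
    by rewrite eqxx mul1r scalerAr.
  by rewrite eq_sym (negPf qa) mul0r scale0r.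
rewrite (bigD1 j) //= big1 ?addr0 => [|q qa]; rewrite !tensmxE mxE.
  by rewrite eqxx mul1r scalerAr.
by rewrite (negPf qa) mul0r scale0r.
Qed.

Lemma commutator_of_slices n (T : 'M[C]_n) (Z : 'M[H]_n) :
  (forall a, slice_algebra Z a -> a *m T = T *m a) -> commutator T Z = 0.
Proof.
move=> h; apply/matrixP => i j; rewrite [RHS]mxE.
apply: functionals_separate => f lf.
have := congr1 (fun M : 'M_n => M i j) (map_commutator T Z lf).
rewrite [LHS]mxE => ->; rewrite -h; last by exists f.
by rewrite subrr mxE.
Qed.

Lemma is_ucorep1 n : is_ucorep (1%:M : 'M[H]_n).
Proof.
have s1 : starmx (1%:M : 'M[H]_n) = 1%:M.
  apply/matrixP => i j; rewrite !mxE eq_sym; case: (_ == _); first exact: star1.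
  exact: star0.
split; last 2 first; [by rewrite s1 mul1mx | by rewrite s1 mulmx1 | split=> i j].
- rewrite mxE (bigD1 i) //= !mxE eqxx big1 ?addr0 => [|k ki]; last first.
    by rewrite !mxE eq_sym (negPf ki) tens0l.
  by case: (i == j); rewrite ?comul1 // linear0 tens0r.
- by rewrite mxE; case: (i == j); rewrite ?counit1 // linear0.
Qed.

End CommutatorAlgebra.

Section Extension.
Variables (R : realType) (H : cqg_algebra R).
Local Notation C := R[i].
(** [X] is the parameter space, later an affine chart, and [reg] an algebra of functions on it that
    is closed under conjugation. *)
Variables (X : Type) (reg : (X -> C) -> Prop).
Hypothesis reg_const : forall c, reg (fun=> c).
Hypothesis reg_add : forall f g, reg f -> reg g -> reg (fun x => f x + g x).
Hypothesis reg_mul : forall f g, reg f -> reg g -> reg (fun x => f x * g x).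
(* Adjoints of intertwiners are needed: this is why the real Zariski topology
   of the Weil restriction appears, and not the complex one. *)
Hypothesis reg_conj : forall f, reg f -> reg (fun x => ((f x)^*)%C).

Definition regmx m n (F : X -> 'M[C]_(m, n)) := forall i j, reg (fun x => F x i j).

Lemma reg_ext f g : f =1 g -> reg f -> reg g.
Proof. by move=> /funext ->. Qed.

Lemma reg_sum (I : Type) (r : seq I) (F : I -> X -> C) :
  (forall i, reg (F i)) -> reg (fun x => \sum_(i <- r) F i x).
Proof.
move=> h; elim: r => [|i r IH].
  by apply: reg_ext (reg_const 0) => x; rewrite big_nil.
by apply: reg_ext (reg_add (h i) IH) => x; rewrite big_cons.
Qed.

Lemma regmx_const m n (A : 'M[C]_(m, n)) : regmx (fun=> A).
Proof. by move=> i j; exact: reg_const. Qed.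

Lemma regmx_lin m n c (F G : X -> 'M[C]_(m, n)) : regmx F -> regmx G ->
  regmx (fun x => c *: F x + G x).
Proof.
move=> hF hG i j.
by apply: reg_ext (reg_add (reg_mul (reg_const c) (hF i j)) (hG i j)) => x; rewrite !mxE.
Qed.

Lemma regmx_mul m n p (F : X -> 'M[C]_(m, n)) (G : X -> 'M[C]_(n, p)) :
  regmx F -> regmx G -> regmx (fun x => F x *m G x).
Proof.
move=> hF hG i j.
apply: (reg_ext (f := fun x => \sum_k F x i k * G x k j)) => [x|]; first by rewrite mxE.
by apply: reg_sum => k; exact: reg_mul.
Qed.

Lemma regmx_adj m n (F : X -> 'M[C]_(m, n)) : regmx F -> regmx (fun x => adj (F x)).
Proof. by move=> hF i j; apply: reg_ext (reg_conj (hF j i)) => x; rewrite adjE. Qed.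

Lemma regmx_block m1 m2 n1 n2 (A : X -> 'M[C]_(m1, n1)) (B : X -> 'M[C]_(m1, n2))
    (D : X -> 'M[C]_(m2, n1)) (E : X -> 'M[C]_(m2, n2)) :
  regmx A -> regmx B -> regmx D -> regmx E ->
  regmx (fun x => block_mx (A x) (B x) (D x) (E x)).
Proof.
move=> hA hB hD hE i j; case: (split_ordP i) => {}i ->; case: (split_ordP j) => {}j ->.
- by apply: reg_ext (hA i j) => x; rewrite block_mxEul.
- by apply: reg_ext (hB i j) => x; rewrite block_mxEur.
- by apply: reg_ext (hD i j) => x; rewrite block_mxEdl.
- by apply: reg_ext (hE i j) => x; rewrite block_mxEdr.
Qed.

Lemma regmx_tens m1 m2 n1 n2 (A : X -> 'M[C]_(m1, n1)) (B : X -> 'M[C]_(m2, n2)) :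
  regmx A -> regmx B -> regmx (fun x => A x *t B x).
Proof.
move=> hA hB k l; case: (mxtens_indexP k) => i a; case: (mxtens_indexP l) => j d.
by apply: reg_ext (reg_mul (hA i j) (hB a d)) => x; rewrite tensmxE.
Qed.

Variables (n : nat) (U : 'M[H]_n) (P : X -> 'M[C]_n).
Hypothesis hU : is_ucorep U.
Hypothesis regP : regmx P.
Hypothesis hP : forall x, adj (P x) = P x.
Local Notation I x := (gen_ideal (P x) U).
Variable x0 : X.

Let sI x : submodule_pred (I x) := gen_submodule (P x) U.
Let Il x a b : I x a -> I x (a * b) := @gen_mull _ _ _ (P x) U a b.
Let Ir x a b : I x b -> I x (a * b) := @gen_mulr _ _ _ (P x) U a b.

Let mx_in0 x p q : mx_in (I x) (0 : 'M[H]_(p, q)).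
Proof. by move=> i j; rewrite mxE; exact: gen_zero. Qed.

Definition extendable N (Z : 'M[H]_N) (T : 'M[C]_N) : Prop :=
  exists F : X -> 'M[C]_N, [/\ regmx F, F x0 = T & forall x, mx_in (I x) (commutator (F x) Z)].

Lemma extendable_commutant N (Z : 'M[H]_N) T : commutator T Z = 0 -> extendable Z T.
Proof. by move=> h; exists (fun=> T); split=> // x; rewrite h. Qed.

Lemma extendable_star N (Z : 'M[H]_N) : is_ucorep Z -> star_subalgebra (extendable Z).
Proof.
move=> hZ; split.
- split; first by apply: extendable_commutant; exact: commutator0.
  move=> c _ _ [F [rF <- hF]] [G [rG <- hG]]; exists (fun x => c *: F x + G x).
  split=> [||x i j]; [exact: regmx_lin | by [] | ].
  by rewrite commutator_lin; case: (sI x) => _; apply; [exact: hF | exact: hG].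
- by apply: extendable_commutant; exact: commutator1.
- move=> _ _ [F [rF <- hF]] [G [rG <- hG]]; exists (fun x => F x *m G x).
  split=> [||x]; [exact: regmx_mul | by [] | ].
  rewrite commutatorM; apply: (mx_inD (sI x)).
    by apply: (mx_inMr (sI x) (@Ir x)).
  by apply: (mx_inMl (sI x) (@Il x)).
- move=> _ [F [rF <- hF]]; exists (fun x => adj (F x)).
  split=> [||x]; [exact: regmx_adj | by [] | ].
  rewrite commutator_adj //; apply: (mx_inMl (sI x) (@Il x)); apply: (mx_inMr (sI x) (@Ir x)).
  by move=> i j; rewrite mxE; apply: gen_star => //; exact: hF.
Qed.

Lemma extendable_block M N (Y : 'M[H]_M) (Z : 'M[H]_N) S T :
  extendable Y S -> extendable Z T ->
  extendable (block_mx Y 0 0 Z) (block_mx S 0 0 T).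
Proof.
move=> [F [rF <- hF]] [G [rG <- hG]]; exists (fun x => block_mx (F x) 0 0 (G x)).
split=> // [|x]; first by apply: regmx_block => //; exact: regmx_const.
rewrite commutator_block_diag => i j.
case: (split_ordP i) => {}i ->; case: (split_ordP j) => {}j ->.
- by rewrite block_mxEul; exact: hF.
- by rewrite block_mxEur; exact: mx_in0.
- by rewrite block_mxEdl; exact: mx_in0.
- by rewrite block_mxEdr; exact: hG.
Qed.

Definition ext_ideal (a : H) : Prop :=
  exists N (Z : 'M[H]_N) T L,
    [/\ is_ucorep Z, extendable Z T & a = pairing L (commutator T Z)].

(** The generators come from the family [P] itself and sums from block sums. For products, tensoring
    with a unitary corepresentation having the other factor in the span of its entries multiplies
    the commutator by these entries. *)
Lemma gen_ext_ideal a : I x0 a -> ext_ideal a.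
Proof.
elim=> [i j||b c _ [M [Y [S [L [hY eS ->]]]]] _ [N [Z [T [L' [hZ eT ->]]]]]
    |b c _ [N [Z [T [L [hZ eT ->]]]]]|b c _ [N [Z [T [L [hZ eT ->]]]]]].
- exists n, U, (P x0), (delta_mx i j); split=> //; last by rewrite pairing_delta.
  by exists P; split=> // x k l; exact: gen_commutator.
- exists 0%N, 0, 0, 0; split; [exact: ucorep0 | | by rewrite pairing0].
  by apply: extendable_commutant; exact: commutator0.
- exists (M + N)%N, (block_mx Y 0 0 Z), (block_mx S 0 0 T), (block_mx L 0 0 L').
  by rewrite commutator_block_diag pairing_block; split=> //;
    [exact: ucorep_block | exact: extendable_block].
- have [M [Y [hY [L' ->]]]] := cqg_spanned c.
  exists (N * M)%N, (Z *t Y), (T *t 1%:M), (L *t L').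
  rewrite commutator_tensl pairing_tens; split=> //; first exact: ucorep_tens.
  have [F [rF <- hF]] := eT; exists (fun x => F x *t 1%:M); split=> // [|x k l].
    by apply: regmx_tens => //; exact: regmx_const.
  case: (mxtens_indexP k) => i a'; case: (mxtens_indexP l) => j d.
  by rewrite commutator_tensl tensmxE; apply: Il; exact: hF.
- have [M [Y [hY [L' ->]]]] := cqg_spanned b.
  exists (M * N)%N, (Y *t Z), (1%:M *t T), (L' *t L).
  rewrite commutator_tensr pairing_tens; split=> //; first exact: ucorep_tens.
  have [F [rF <- hF]] := eT; exists (fun x => 1%:M *t F x); split=> // [|x k l].
    by apply: regmx_tens => //; exact: regmx_const.
  case: (mxtens_indexP k) => i a'; case: (mxtens_indexP l) => j d.
  by rewrite commutator_tensr tensmxE; apply: Ir; exact: hF.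
Qed.

Lemma ext_ideal_seq (s : seq H) : (forall a, a \in s -> ext_ideal a) ->
  exists N (Z : 'M[H]_N) T, [/\ is_ucorep Z, extendable Z T &
    forall a, a \in s -> in_span (commutator T Z) a].
Proof.
elim: s => [|a s IH] h.
  exists 0%N, 0, 0; split=> //; first exact: ucorep0.
  by apply: extendable_commutant; exact: commutator0.
have [|N [Z [T [hZ eT sT]]]] := IH; first by move=> b bs; apply: h; rewrite inE bs orbT.
have [|M [Y [S [L [hY eS aE]]]]] := h a; first by rewrite inE eqxx.
exists (M + N)%N, (block_mx Y 0 0 Z), (block_mx S 0 0 T).
split; [exact: ucorep_block | exact: extendable_block | move=> b].
rewrite commutator_block_diag inE => /orP[/eqP ->|/sT]; last exact: in_span_blockr.
by apply: in_span_blockl; exists L.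
Qed.

(* The intertwiners at x0 that extend to regular families of intertwiners form
   a *-algebra; their commutators span an ideal containing I x0, so that the
   bicommutant theorem applies. *)
Theorem intertwiner_extends N (Z : 'M[H]_N) T :
  is_ucorep Z -> mx_in (I x0) (commutator T Z) -> extendable Z T.
Proof.
move=> hZ hT.
have [|N' [Z' [T' [hZ' eT' sT']]]] :=
    @ext_ideal_seq [seq commutator T Z i j | i <- enum 'I_N, j <- enum 'I_N].
  by move=> a /allpairsP[[i j] [_ _ ->]]; apply: gen_ext_ideal; exact: hT.
have {}sT' i j : in_span (commutator T' Z') (commutator T Z i j).
  by apply: sT'; apply/allpairsP; exists (i, j); rewrite !mem_enum.
(* [T] is placed next to an extendable [T'] whose commutator entries span those of the commutator of
   [T], so that one functional can test both. *)
pose Y := block_mx Z 0 0 Z'; have hY : is_ucorep Y by exact: ucorep_block.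
have sY := extendable_star hY.
suff [F [rF F0 hF]] : extendable Y (block_mx T 0 0 0).
  exists (fun x => ulsubmx (F x)); split=> [i j||x i j].
  - by apply: reg_ext (rF (lshift _ i) (lshift _ j)) => x; rewrite !mxE.
  - by rewrite F0 block_mxKul.
  - have := hF x (lshift _ i) (lshift _ j).
    by rewrite -[F x]submxK /Y commutator_block block_mxEul submxK.
apply: (bicommutant sY) => S hS.
(* Constant families are extendable, so [S] commutes with all intertwiners of [Y] over [H] itself,
   and a second use of the bicommutant theorem makes it a slice. *)
have [f lf SE] : slice_algebra Y S.
  apply: (bicommutant (slice_algebra_star hY)) => T1 hT1.
  by apply/esym/hS/extendable_commutant/commutator_of_slices.
(* Commuting with the slice of [Y] by [f] means that [f] kills the entries of the commutator. From
   [T'] this passes to [T], since the entries for [T] are combinations of those for [T']. *)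
have kill T1 : extendable Y T1 -> map_mx f (commutator T1 Y) = 0.
  by move=> e1; rewrite map_commutator // -SE hS // subrr.
have k' : map_mx f (commutator T' Z') = 0.
  have e1 : extendable Y (block_mx 0 0 0 T').
    by apply: extendable_block => //; apply: extendable_commutant; exact: commutator0.
  have := kill _ e1; rewrite commutator_block_diag map_block_mx => /(congr1 drsubmx).
  by rewrite block_mxKdr => ->; apply/matrixP => i j; rewrite !mxE.
have kT : map_mx f (commutator T Z) = 0.
  apply/matrixP => i j; rewrite mxE; have [L ->] := sT' i j.
  rewrite (lin_pairing _ _ lf) mxE big1 // => k _; rewrite big1 // => l _.
  by have /matrixP/(_ k l) := k'; rewrite !mxE => ->; rewrite scaler0.
apply/eqP; rewrite -subr_eq0 SE -map_commutator // commutator_block_diag commutator0.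
rewrite map_block_mx kT; apply/eqP/matrixP => i j; rewrite [RHS]mxE.
case: (split_ordP i) => {}i ->; case: (split_ordP j) => {}j ->;
  by rewrite ?block_mxEul ?block_mxEur ?block_mxEdl ?block_mxEdr !mxE ?(lin0 lf).
Qed.

(** A matrix with invariant columns intertwines the trivial corepresentation with [U], so it is the
    upper right corner of a self-intertwiner of the direct sum of the two. *)
Corollary invariants_extend (B : 'M[C]_n) :
  mx_in (I x0) (U *m cmx H B - cmx H B) ->
  exists F : X -> 'M[C]_n, [/\ regmx F, F x0 = B &
    forall x, mx_in (I x) (U *m cmx H (F x) - cmx H (F x))].
Proof.
move=> hB.
have hZ := ucorep_block hU (is_ucorep1 H n).
have [|F [rF F0 hF]] := @intertwiner_extends _ _ (block_mx 0 B 0 0) hZ.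
  rewrite commutator_block !commutator0 cmx0 !mul0mx !mulmx0 subrr mulmx1 => i j.
  case: (split_ordP i) => {}i ->; case: (split_ordP j) => {}j ->;
    rewrite ?block_mxEul ?block_mxEur ?block_mxEdl ?block_mxEdr; try exact: mx_in0.
  by rewrite -opprB; apply: (mx_inN (sI x0)).
exists (fun x => ursubmx (F x)); split=> [i j||x].
- by apply: reg_ext (rF (lshift _ i) (rshift _ j)) => x; rewrite !mxE.
- by rewrite F0 block_mxKur.
- rewrite -opprB; apply: (mx_inN (sI x)) => i j.
  have := hF x (lshift _ i) (rshift _ j).
  by rewrite -[F x]submxK commutator_block block_mxEur mulmx1 submxK.
Qed.

End Extension.

(** * Dimensions of irreducible comodules *)

Section Eigenvectors.
Variables (R : realType).
Local Notation C := R[i].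

(** Linear factors are stripped from a polynomial in [T] annihilating [F], at the start the
    characteristic one. The last nonzero product of [F] with a polynomial in [T] is the eigenvector,
    and it stays in [S]. *)
Lemma right_eigenvector m n (S : 'M[C]_(m, n) -> Prop) (T : 'M[C]_n) F :
  submodule_pred S -> (forall X, S X -> S (X *m T)) -> S F -> F != 0 ->
  exists (X : 'M[C]_(m, n)) l, [/\ S X, X != 0 & X *m T = l *: X].
Proof.
move=> sS ST SF F0.
case: n S T F sS ST SF F0 => [|n] S T F sS ST SF F0.
  by rewrite (thinmx0 F) eqxx in F0.
have Spoly p : S (F *m horner_mx T p).
  elim/poly_ind: p => [|p c IH]; first by rewrite rmorph0 mulmx0; case: sS.
  rewrite rmorphD rmorphM /= horner_mx_X horner_mx_C mulmxDr -mulmxE mulmxA.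
  apply: submoduleD => //; first exact: ST.
  by rewrite mul_mx_scalar; exact: submoduleZ.
have CH : F *m horner_mx T (char_poly T) = 0 by rewrite Cayley_Hamilton mulmx0.
have := monic_neq0 (char_poly_monic T); move: (char_poly T) CH => p.
have [k] := ubnP (size p); elim: k p => // k IH p; rewrite ltnS => szp pF p0.
have : size p != 1%N.
  apply: contraNN F0 => /size_poly1P[c c0 pE]; move: pF.
  rewrite pE horner_mx_C mul_mx_scalar => /eqP; rewrite scaler_eq0 (negPf c0).
  by [].
move=> /closed_rootP[l /factor_theorem[q qE]].
have q0 : q != 0 by apply: contraNneq p0 => q0; rewrite qE q0 mul0r.
have [Fq|Fq] := eqVneq (F *m horner_mx T q) 0.
  apply: (IH q) => //; apply: leq_trans szp.
  by rewrite qE size_Mmonic ?monicXsubC // size_XsubC addn2.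
exists (F *m horner_mx T q), l; split=> //; move: pF.
rewrite qE rmorphM rmorphB /= horner_mx_X horner_mx_C -mulmxE mulmxA mulmxBr.
by rewrite mul_mx_scalar => /eqP; rewrite subr_eq0 => /eqP.
Qed.

(* If the generator is invertible, then im Q is spanned by K-invariant vectors
   (the columns of Q B) and the orbit of l vectors (the columns of Q Vm) under
   the intertwiner Q T Q.  An eigenvector of the action of Q T Q on the intertwiners
   from im Q to a non-trivial irreducible Y kills B and is determined on that
   orbit by its values on l vectors, so that dim Y <= l. *)
Definition generator n l (Q T B : 'M[C]_n) (Vm : 'M[C]_(n, l))
    (s : seq (nat * 'M[C]_(l, n))) : 'M[C]_n :=
  (\sum_(p <- s) iter p.1 (mulmx (Q *m T *m Q)) (Q *m Vm) *m p.2 + Q *m B) *m Q + (1%:M - Q).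

(** An eigenvector [F] sees the whole orbit through the l columns of [F *m Vm], so [F] times the
    generator factors through dimension l. The summand [1%:M - Q], which makes the generator a
    square matrix on the whole space, is killed by [F]. *)
Lemma generator_rank m n l (Q T B : 'M[C]_n) (Vm : 'M[C]_(n, l)) s (F : 'M[C]_(m, n)) e :
  F *m Q = F -> F *m (Q *m T *m Q) = e *: F -> F *m B = 0 ->
  generator Q T B Vm s \in unitmx -> (\rank F <= l)%N.
Proof.
move=> FQ FT FB uG.
have it j (Y : 'M[C]_(n, l)) : F *m iter j (mulmx (Q *m T *m Q)) Y = e ^+ j *: (F *m Y).
  elim: j => [|j IH]; first by rewrite expr0 scale1r.
  by rewrite iterS mulmxA FT -scalemxAl IH scalerA exprS.
have E : F *m generator Q T B Vm s = (F *m Vm) *m (\sum_(p <- s) e ^+ p.1 *: p.2 *m Q).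
  rewrite /generator mulmxDr mulmxBr mulmx1 FQ subrr addr0 mulmxA mulmxDr.
  rewrite (mulmxA F Q B) FQ FB addr0 !mulmx_sumr mulmx_suml; apply: eq_bigr => p _.
  by rewrite mulmxA it mulmxA FQ -!scalemxAl -!scalemxAr !mulmxA.
have -> : \rank F = \rank (F *m generator Q T B Vm s) by rewrite mxrankMfree // row_free_unit.
by rewrite E (leq_trans (mxrankM_maxl _ _)) // rank_leq_col.
Qed.

End Eigenvectors.

Section IrreducibleQuotients.
Variables (R : realType) (K : hopf_star_algebra R).
Local Notation C := R[i].
Variables (Y : vectType C) (rhoY : Y -> Y ⊗ K) (m : nat) (bY : m.-tuple Y).
Hypothesis hY : is_comodule rhoY.
Hypothesis hbY : basis_of fullv bY.
Hypothesis irrY : is_irreducible rhoY.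
Local Notation cY := (coact_mx bY rhoY).

(** Half of Schur's lemma: the image is a nonzero subcomodule of the irreducible [Y]. *)
Lemma intertwiner_image n (F : 'M[C]_(m, n)) (Z : 'M[K]_n) :
  cmx K F *m Z = cY *m cmx K F -> F != 0 -> forall y, exists x : 'cV[C]_n, y = vecv bY (F *m x).
Proof.
move=> hF F0 y; have lv := @lin_vecv R Y m bY.
have [|W hW] := @vspace_of_submodule _ Y (fun y => exists x : 'cV[C]_n, y = vecv bY (F *m x)).
  split; first by exists 0; rewrite mulmx0 (lin0 lv).
  by move=> c _ _ [x ->] [x' ->]; exists (c *: x + x'); rewrite mulmxDr -scalemxAr lv.
have subW : is_subcomodule rhoY W.
  move=> w /hW[x ->].
  exists [seq (vecv bY (F *m delta_mx k 0), (Z *m cmx K x) k 0) | k <- enum 'I_n]; split.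
    by move=> p /mapP[k _ ->]; apply/hW; exists (delta_mx k 0).
  rewrite big_map big_enum /= {1}(tens_slices hbY (rhoY _)).
  have sE i : slice bY i (rhoY (vecv bY (F *m x))) = \sum_k F i k *: (Z *m cmx K x) k 0.
    by rewrite (slice_rho hbY hY) vecvK // cmxM mulmxA -hF -mulmxA mul_cmxE.
  under [LHS]eq_bigr do rewrite sE tens_sumr.
  rewrite [LHS]exchange_big; apply: eq_bigr => k _ /=; rewrite /vecv tens_suml.
  by apply: eq_bigr => i _; rewrite -colE [col k F i 0]mxE tensZl tensZr.
have [_ /(_ W subW)[W0|WT]] := irrY; last by apply/hW; rewrite WT memvf.
case/negP: F0; apply/eqP/matrixP => i j; rewrite mxE.
have : vecv bY (F *m delta_mx j 0) \in W by apply/hW; exists (delta_mx j 0).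
rewrite W0 memv0 => /eqP /(congr1 (colv bY)); rewrite vecvK // -colE => /colP/(_ i).
by rewrite !mxE linear0.
Qed.

Lemma intertwiner_rank n (F : 'M[C]_(m, n)) (Z : 'M[K]_n) :
  cmx K F *m Z = cY *m cmx K F -> F != 0 -> \rank F = m.
Proof.
move=> hF F0; have h := intertwiner_image hF F0.
have [G GE] : exists G : 'M[C]_(n, m), F *m G = 1%:M.
  have /choice[g hg] : forall j : 'I_m, exists x : 'cV[C]_n, delta_mx j 0 = F *m x.
    move=> j; have [x xE] := h (vecv bY (delta_mx j 0)); exists x.
    by rewrite -(vecvK hbY (delta_mx j 0)) xE vecvK.
  exists (\matrix_(i, j) g j i 0); apply/matrixP => i j.
  have := congr1 (fun M : 'cV_m => M i 0) (hg j); rewrite !mxE eqxx andbT => ->.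
  by apply: eq_bigr => k _; rewrite mxE.
apply/eqP; rewrite eqn_leq rank_leq_row -{1}(mxrank1 C m) -GE.
exact: mxrankM_maxl.
Qed.

Lemma irreducible_dim_le n l (c : 'M[K]_n) (Q T B : 'M[C]_n) (Vm : 'M[C]_(n, l)) s
    (F : 'M[C]_(m, n)) :
  ~ is_trivial rhoY -> commutator Q c = 0 -> commutator T c = 0 ->
  c *m cmx K B = cmx K B -> generator Q T B Vm s \in unitmx -> Q *m Q = Q ->
  cmx K F *m c = cY *m cmx K F -> F *m Q = F -> F != 0 -> (m <= l)%N.
Proof.
move=> ntriv cQ cT cB uG QQ cF FQ F0.
pose S (X : 'M[C]_(m, n)) := cmx K X *m c = cY *m cmx K X /\ X *m Q = X.
have sS : submodule_pred S.
  split; first by rewrite /S cmx0 mul0mx mulmx0 mul0mx.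
  move=> d X X' [h1 h2] [h1' h2']; split; last by rewrite mulmxDl -scalemxAl h2 h2'.
  apply/matrixP => i j; move/matrixP/(_ i j): h1; move/matrixP/(_ i j): h1'.
  rewrite !mul_cmxE !mulr_cmxE => h1' h1.
  have dE k k' : (d *: X + X') k k' = d * X k k' + X' k k' by rewrite !mxE.
  under eq_bigr do rewrite dE scalerDl -scalerA.
  rewrite big_split /= -scaler_sumr h1 h1'.
  under [RHS]eq_bigr do rewrite dE scalerDl -scalerA.
  by rewrite [RHS]big_split /= -scaler_sumr.
have cE A : commutator A c = 0 -> cmx K A *m c = c *m cmx K A.
  by move=> /eqP; rewrite subr_eq0 => /eqP.
have ST X : S X -> S (X *m (Q *m T *m Q)).
  move=> [h1 h2]; split; last by rewrite -!mulmxA QQ.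
  rewrite !cmxM !mulmxA -h1 -!mulmxA (cE _ cQ) (mulmxA _ c) (cE _ cT).
  by rewrite (mulmxA _ _ (cmx K Q)) (mulmxA _ _ (cmx K Q)) (mulmxA _ c) (cE _ cQ) !mulmxA.
have [X [e [[SX XQ] X0 XT]]] := right_eigenvector sS ST (conj cF FQ) F0.
rewrite -(intertwiner_rank SX X0).
(* If [X *m B] were nonzero, it would map a trivial comodule onto [Y], making [Y] trivial. *)
apply: (generator_rank XQ XT _ uG); apply: contrapT => /eqP XB0.
apply: ntriv => y.
have XBE : cmx K (X *m B) *m 1%:M = cY *m cmx K (X *m B).
  by rewrite mulmx1 cmxM mulmxA -SX -mulmxA cB.
have [x ->] := intertwiner_image XBE XB0 y.
rewrite (tens_slices hbY (rhoY _)) {2}/vecv tens_suml; apply: eq_bigr => i _.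
by rewrite (slice_rho hbY hY) vecvK // cmxM mulmxA -XBE mulmx1 -cmxM cmxE tensZr tensZl.
Qed.

End IrreducibleQuotients.

Section SubCoaction.
Variables (R : realType) (K : hopf_star_algebra R).
Local Notation C := R[i].

Lemma sw_sub_coact (V : vectType C) (rho : V -> V ⊗ K) (U : zmodType)
    (A : {vspace V}) (w : subvs_of A) (g : subvs_of A -> K -> U) :
  balanced g ->
  tlift g (@sub_coact R K V rho A w) = \sw_(x, h <- rho (vsval w)) g (vsproj A x) h.
Proof.
by move=> hg; rewrite /sub_coact tlift_fuse //; apply: tlift_ext => x h; rewrite tlift_tens.
Qed.

Lemma balanced_lin_tens (X Y : lmodType C) (f : X -> Y) : lin f ->
  balanced (fun x (h : K) => f x ⊗ h).
Proof. by move=> lf; apply/bilin_balanced/(bilin_tens lf (@lin_id _ K)). Qed.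

End SubCoaction.

Section GeneratedConstrained.
Variables (R : realType) (K : hopf_star_algebra R) (V : vectType R[i]).
Local Notation C := R[i].
Variables (rho : V -> V ⊗ K) (n : nat) (b : n.-tuple V).
Hypothesis hrho : is_comodule rho.
Hypothesis hb : basis_of fullv b.
Local Notation c := (coact_mx b rho).
Hypothesis hc : is_ucorep c.

Definition generated (l : nat) (Q : 'M[C]_n) : Prop :=
  exists (T B : 'M[C]_n) (Vm : 'M[C]_(n, l)) s,
    [/\ commutator T c = 0, c *m cmx K B = cmx K B & generator Q T B Vm s \in unitmx].

Lemma subcomodule_proj_mul (A : {vspace V}) (P Q : 'M[C]_n) :
  proj_on b P A -> adj Q = Q -> (forall a, a \in A -> Q *m colv b a = colv b a) ->
  Q *m P = P /\ P *m Q = P.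
Proof.
move=> hP aQ hQ; have [[aP PP] hA] := hP.
have QP : Q *m P = P.
  apply: mx_ext_col => x; rewrite -mulmxA -[P *m x](vecvK hb); apply: hQ.
  exact: proj_on_vec.
by split=> //; rewrite -[LHS]adjK adjM aP aQ QP.
Qed.

(** Colinearity of [f] is only known on [A]. Precomposing with the orthogonal projection onto [A],
    itself an intertwiner, gives an intertwiner on all of [V]. *)
Lemma subquotient_intertwiner (Y : vectType C) (rhoY : Y -> Y ⊗ K) m (bY : m.-tuple Y)
    (A : {vspace V}) (Q : 'M[C]_n) (f : V -> Y) a0 :
  is_comodule rhoY -> basis_of fullv bY -> is_subcomodule rho A -> adj Q = Q ->
  (forall a, a \in A -> Q *m colv b a = colv b a) -> lin f ->
  (forall a, a \in A -> rhoY (f a) = \sw_(x, h <- rho a) (f x ⊗ h)) ->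
  a0 \in A -> f a0 != 0 ->
  exists F : 'M[C]_(m, n),
    [/\ cmx K F *m c = coact_mx bY rhoY *m cmx K F, F *m Q = F & F != 0].
Proof.
move=> hY hbY hA aQ hQ lf hf a0A fa0.
have [P hP] := proj_on_exists hb A.
have [[aP PP] hPA] := hP.
have [QP PQ] := subcomodule_proj_mul hP aQ hQ.
pose Fm : 'M[C]_(m, n) := \matrix_(i, j) coord bY i (f b`_j).
have fE v : f v = vecv bY (Fm *m colv b v).
  rewrite -{1}(colvK hb v) /vecv (lin_sum _ _ _ lf).
  under [RHS]eq_bigr do rewrite mxE scaler_suml.
  rewrite exchange_big; apply: eq_bigr => j _.
  rewrite (linZ _ _ lf) (coord_basis hbY (memvf (f _))) scaler_sumr.
  by apply: eq_bigr => i _; rewrite !mxE scalerA mulrC.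
exists (Fm *m P); split; last first.
- apply: contra_neq fa0 => FP; rewrite fE.
  by have /hPA <- := a0A; rewrite mulmxA FP mul0mx (lin0 (@lin_vecv _ _ _ _)).
- by rewrite -mulmxA PQ.
have cP : cmx K P *m c = c *m cmx K P.
  have /(subcomodule_commutator hb hrho hc hP) := hA.
  by rewrite /commutator => /eqP; rewrite subr_eq0 => /eqP.
rewrite cmxM -mulmxA cP.
apply/matrixP => i j; pose w := vecv b (P *m delta_mx j 0).
have wA : w \in A by exact: proj_on_vec.
have := congr1 (slice bY i) (hf _ wA).
rewrite (slice_rho hbY hY) fE /w !vecvK // -!colE.
have colME p q r (M : 'M[K]_(p, q)) (N : 'M[C]_(q, r)) k : 
    (M *m cmx K (col k N)) =  col k (M *m cmx K N).
  by apply/colP => x; rewrite mulr_cmxE [RHS]mxE mulr_cmxE; apply: eq_bigr => y _; rewrite mxE.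
rewrite -[Fm *m col j P]/(Fm *m col j P) colE mulmxA -colE colME [LHS]mxE cmxM => ->.
rewrite (tens_slices hb (rho _)) tlift_sum_tens; last exact: balanced_lin_tens.
rewrite (lin_sum _ _ _ (lin_slice _ _)) mul_cmxE; apply: eq_bigr => k _.
rewrite slice_tens (slice_rho hb hrho) vecvK // -colE colME [col j (c *m _) _ _]mxE.
by rewrite [Fm i k]mxE.
Qed.

Lemma generated_ambient l : generated l 1%:M -> is_constrained l rho.
Proof.
move=> [T [B [Vm [s [cT cB uG]]]]] Y rhoY hY irrY [A hA [f hf fT]] ntriv.
have hbY := vbasisP {:Y}; have lvp : lin (vsproj A) by exact: lin_linear.
have lf : lin (fun v => f (vsproj A v)) by move=> d x y; rewrite !linearP.
have [y y0] : exists y : Y, y != 0.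
  exists (vpick {:Y}); rewrite vpick0 -dimv_eq0 -lt0n.
  by case: irrY.
have [w _ yE] : exists2 w, w \in fullv & y = f w by apply/memv_imgP; rewrite fT memvf.
have [||||F [F1 F2 F3]] :=
  @subquotient_intertwiner _ _ _ _ A 1%:M _ (vsval w) hY hbY hA (adj1 _ _) _ lf.
- by move=> a _; rewrite mul1mx.
- move=> a aA; rewrite -{1}(vsprojK aA) vsvalK hf sw_sub_coact ?vsprojK //.
  by apply: balanced_lin_tens; exact: lin_linear.
- exact: subvsP.
- by rewrite vsvalK -yE.
apply: (irreducible_dim_le hY hbY irrY ntriv (commutator1 _) cT cB uG _ F1 F2 F3).
by rewrite mul1mx.
Qed.

Lemma generated_sub l (W : {vspace V}) Q : proj_on b Q W -> is_subcomodule rho W ->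
  generated l Q -> is_constrained l (@sub_coact R K V rho W).
Proof.
move=> hQ hW [T [B [Vm [s [cT cB uG]]]]] Y rhoY hY irrY [A hA [f hf fT]] ntriv.
have [[aQ QQ] hQW] := hQ.
have hbY := vbasisP {:Y}.
have lf : lin (fun v => f (vsproj A (vsproj W v))) by move=> d x y; rewrite !linearP.
have [y y0] : exists y : Y, y != 0.
  exists (vpick {:Y}); rewrite vpick0 -dimv_eq0 -lt0n.
  by case: irrY.
have [w _ yE] : exists2 w, w \in fullv & y = f w by apply/memv_imgP; rewrite fT memvf.
(* The subcomodule [A] of [W] is viewed inside [V], so that this case too is about intertwiners out
   of [V]. *)
have [|A' hA'] := @vspace_of_submodule _ V (fun v => v \in W /\ vsproj W v \in A).
  split; first by rewrite linear0 !mem0v.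
  by move=> d x x' [h1 h2] [h1' h2']; rewrite linearP; split; apply: memvD => //; exact: memvZ.
have subA' : is_subcomodule rho A'.
  move=> v /hA'[vW vA]; have [t [ht tE]] := hA _ vA.
  exists [seq (vsval p.1, p.2) | p <- t]; split.
    by move=> p /mapP[q /ht qA ->] /=; apply/hA'; rewrite subvsP vsvalK.
  rewrite big_map -[v in LHS](vsprojK vW) -(sub_coactE hW) tE tlift_sum_tens //.
  by apply: balanced_lin_tens; exact: lin_linear.
have [||||F [F1 F2 F3]] :=
  @subquotient_intertwiner _ _ _ _ A' Q _ (vsval (vsval w)) hY hbY subA' aQ _ lf.
- by move=> a /hA'[/hQW].
- move=> a /hA'[aW aA]; rewrite -{1}(vsprojK aA) vsvalK hf sw_sub_coact; last first.
    by apply: balanced_lin_tens; exact: lin_linear.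
  rewrite vsprojK // sw_sub_coact ?vsprojK //.
  by apply: balanced_lin_tens => d x x'; rewrite !linearP.
- by apply/hA'; rewrite vsvalK !subvsP.
- by rewrite !vsvalK -yE.
apply: (irreducible_dim_le hY hbY irrY ntriv _ cT cB uG QQ F1 F2 F3).
exact/(subcomodule_commutator hb hrho hc hQ).
Qed.

End GeneratedConstrained.

(** * Generation by few vectors and decomposition into irreducibles *)

Section Generation.
Variables (R : realType) (n l : nat).
Local Notation C := R[i].

(** The columns of [M] lie in the smallest [T]-stable subspace containing those of [Vm]. The
    coefficients [s] are explicit because they are later held fixed while [T] varies. *)
Definition krylov (T : 'M[C]_n) (Vm : 'M[C]_(n, l)) q (M : 'M[C]_(n, q)) : Prop :=
  exists s : seq (nat * 'M[C]_(l, q)), M = \sum_(p <- s) iter p.1 (mulmx T) Vm *m p.2.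

Variables (T : 'M[C]_n) (Vm : 'M[C]_(n, l)).

Lemma krylov_gen q (D : 'M[C]_(l, q)) : krylov T Vm (Vm *m D).
Proof. by exists [:: (0%N, D)]; rewrite big_seq1. Qed.

Lemma krylov_add q (M N : 'M[C]_(n, q)) :
  krylov T Vm M -> krylov T Vm N -> krylov T Vm (M + N).
Proof. by move=> [s ->] [t ->]; exists (s ++ t); rewrite big_cat. Qed.

Lemma krylov_mulr q r (M : 'M[C]_(n, q)) (D : 'M[C]_(q, r)) :
  krylov T Vm M -> krylov T Vm (M *m D).
Proof.
move=> [s ->]; exists [seq (p.1, p.2 *m D) | p <- s].
by rewrite big_map mulmx_suml; apply: eq_bigr => p _; rewrite mulmxA.
Qed.

Lemma krylov_scale q a (M : 'M[C]_(n, q)) : krylov T Vm M -> krylov T Vm (a *: M).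
Proof. by move=> h; rewrite -mul_mx_scalar; exact: krylov_mulr. Qed.

Lemma krylov_mull q (M : 'M[C]_(n, q)) : krylov T Vm M -> krylov T Vm (T *m M).
Proof.
move=> [s ->]; exists [seq (p.1.+1, p.2) | p <- s].
by rewrite big_map mulmx_sumr; apply: eq_bigr => p _; rewrite mulmxA.
Qed.

Lemma krylov_sum q (I : Type) (r : seq I) (M : I -> 'M[C]_(n, q)) :
  (forall i, krylov T Vm (M i)) -> krylov T Vm (\sum_(i <- r) M i).
Proof.
move=> h; apply: (big_ind (@krylov T Vm q)) => //; last by move=> x y; exact: krylov_add.
by exists [::]; rewrite big_nil.
Qed.

(** This is (T - 1) ... (T - k) applied to [M], the polynomial that removes the eigenvalues 1, ...,
    k. *)
Fixpoint falling (k : nat) q (M : 'M[C]_(n, q)) : 'M[C]_(n, q) :=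
  if k is k'.+1 then T *m falling k' M - k%:R *: falling k' M else M.

Lemma krylov_falling k q (M : 'M[C]_(n, q)) : krylov T Vm M -> krylov T Vm (falling k M).
Proof.
move=> h; elim: k => //= k IH; rewrite -scaleNr; apply: krylov_add.
  exact: krylov_mull.
exact: krylov_scale.
Qed.

End Generation.

Section SubcomoduleDimensions.
Variables (R : realType) (K : hopf_star_algebra R) (V : vectType R[i]).
Local Notation C := R[i].
Variables (rho : V -> V ⊗ K).
Hypothesis hrho : is_comodule rho.

(** Only subcomodules of [V] inside [W] are tested, not all subquotients; orthogonal complements
    make this sufficient for the decomposition. *)
Definition irreducibles_le (l : nat) (W : {vspace V}) : Prop :=
  forall A : {vspace V}, is_subcomodule rho A -> (A <= W)%VS ->
    is_irreducible (@sub_coact R K V rho A) -> ~ is_trivial (@sub_coact R K V rho A) ->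
    (\dim A <= l)%N.

Lemma constrained_ambient_irreducibles l W :
  is_constrained l rho -> irreducibles_le l W.
Proof.
move=> hl A hA _ irrA ntriv.
have -> : \dim A = \dim {:subvs_of A} by rewrite dimvf.
apply: (hl _ _ (is_comodule_sub hrho hA) irrA _ ntriv).
exists A => //; exists \1%VF; last by rewrite lim1g.
move=> w; rewrite id_lfunE -[LHS]sw_tens; apply: tlift_ext => x h.
by rewrite id_lfunE.
Qed.

Lemma constrained_sub_irreducibles l W : is_subcomodule rho W ->
  is_constrained l (@sub_coact R K V rho W) -> irreducibles_le l W.
Proof.
move=> hW hl A hA AW irrA ntriv.
have -> : \dim A = \dim {:subvs_of A} by rewrite dimvf.
apply: (hl _ _ (is_comodule_sub hrho hA) irrA _ ntriv).
have [|A0 hA0] := @vspace_of_submodule _ (subvs_of W) (fun w => vsval w \in A).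
  split; first by rewrite linear0 mem0v.
  by move=> d x y hx hy; rewrite linearP; apply: memvD => //; exact: memvZ.
exists A0.
  move=> w /hA0 wA; have [s [hs sE]] := hA _ wA.
  exists [seq (vsproj W p.1, p.2) | p <- s]; split.
    move=> p /mapP[q /hs qA ->] /=; apply/hA0; rewrite vsprojK //.
    exact: (subvP AW).
  rewrite /sub_coact sE big_map tlift_sum_tens //.
  by apply: balanced_lin_tens; exact: lin_linear.
pose g (w : subvs_of A0) : subvs_of A := vsproj A (vsval (vsval w)).
have lg : linear g by move=> d x y; rewrite /g !linearP.
pose gL := GRing.isLinear.Build _ _ _ _ g lg.
pose gl : {linear subvs_of A0 -> subvs_of A} := HB.pack g gL.
exists (linfun gl); last first.
  apply/eqP; rewrite eqEsubv subvf /=; apply/subvP => x _.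
  have xW : vsval x \in W by apply: (subvP AW); exact: subvsP.
  have xA0 : vsproj W (vsval x) \in A0 by apply/hA0; rewrite vsprojK // subvsP.
  apply/memv_imgP; exists (vsproj A0 (vsproj W (vsval x))); first exact: memvf.
  by rewrite (lfunE gl) /= /g !vsprojK // vsvalK.
move=> w; rewrite (lfunE gl) /= /g.
have wA : vsval (vsval w) \in A by apply/hA0; exact: subvsP.
have [s [hs sE]] := hA _ wA.
rewrite sw_sub_coact; last by apply: balanced_lin_tens; exact: lin_linear.
rewrite sw_sub_coact; last by apply: balanced_lin_tens => d x y; rewrite !linearP.
rewrite /sub_coact vsprojK // sE !tlift_sum_tens; first last.
- by apply: balanced_lin_tens; exact: lin_linear.
- by apply: balanced_lin_tens => d x y; rewrite !linearP.
apply: eq_big_seq => p /hs pA; rewrite (lfunE gl) /= /g.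
have pW : p.1 \in W by exact: (subvP AW).
rewrite [vsval (vsproj A0 _)]vsprojK; last by apply/hA0; rewrite vsprojK.
by rewrite vsprojK.
Qed.

Lemma minimal_subcomodule (W : {vspace V}) : is_subcomodule rho W -> W != 0%VS ->
  exists A : {vspace V}, [/\ is_subcomodule rho A, (A <= W)%VS, A != 0%VS &
    is_irreducible (@sub_coact R K V rho A)].
Proof.
move=> hW W0.
pose Pd d := `[< exists A : {vspace V},
  [/\ is_subcomodule rho A, (A <= W)%VS, A != 0%VS & \dim A = d] >].
have exP : exists d, Pd d by exists (\dim W); apply/asboolP; exists W.
have [d /asboolP[A [hA AW A0 dA]] dmin] := ex_minnP exP.
exists A; split=> //; split; first by rewrite dimvf /dim /= lt0n dimv_eq0.
move=> B hB; have [->|B0] := eqVneq B 0%VS; [by left | right].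
pose g := linfun (vsval : subvs_of A -> V).
have gI : lker g == 0%VS.
  by apply/lker0P => x y; rewrite !lfunE; exact: subvs_inj.
pose B' := (g @: B)%VS.
have dB' : \dim B' = \dim B by apply: limg_dim_eq; rewrite (eqP gI) capv0.
have /dmin : Pd (\dim B').
  apply/asboolP; exists B'; split=> //.
  - move=> _ /memv_imgP[x xB ->]; rewrite lfunE /=.
    have [s [hs sE]] := hB _ xB.
    exists [seq (vsval p.1, p.2) | p <- s]; split.
      move=> p /mapP[q /hs qB ->] /=; have -> : vsval q.1 = g q.1 by rewrite lfunE.
      exact: memv_img.
    rewrite big_map -(sub_coactE hA) sE tlift_sum_tens //.
    by apply: balanced_lin_tens; exact: lin_linear.
  - apply: subv_trans AW; apply/subvP => _ /memv_imgP[x _ ->].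
    by rewrite lfunE /=; exact: subvsP.
  - by rewrite -dimv_eq0 dB' dimv_eq0.
rewrite -dA dB' => le; apply/eqP; rewrite eqEdim subvf /= dimvf.
exact: le.
Qed.

End SubcomoduleDimensions.

Section Decomposition.
Variables (R : realType) (K : hopf_star_algebra R) (V : vectType R[i]).
Local Notation C := R[i].
Variables (rho : V -> V ⊗ K) (n : nat) (b : n.-tuple V).
Hypothesis hrho : is_comodule rho.
Hypothesis hb : basis_of fullv b.
Local Notation c := (coact_mx b rho).
Hypothesis hc : is_ucorep c.

Lemma proj_factor l (A : {vspace V}) (P : 'M[C]_n) : proj_on b P A -> (\dim A <= l)%N ->
  exists (V1 : 'M[C]_(n, l)) (D1 : 'M[C]_(l, n)), P = V1 *m D1 /\ P *m V1 = V1.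
Proof.
move=> hP dA; have [[aP PP] hA] := hP.
pose a := vbasis A.
pose W1 : 'M[C]_(n, \dim A) := \matrix_(i, k) colv b a`_k i 0.
pose E1 : 'M[C]_(\dim A, n) := \matrix_(k, j) coord a k (vecv b (col j P)).
have PE : P = W1 *m E1.
  apply/matrixP => i j; rewrite [RHS]mxE.
  have wA : vecv b (col j P) \in A by rewrite colE; exact: proj_on_vec.
  have := congr1 (fun v => colv b v i 0) (coord_vbasis wA).
  rewrite vecvK // [LHS]mxE => ->; rewrite (lin_sum _ _ _ (@lin_colv _ _ _ _)) summxE.
  by apply: eq_bigr => k _; rewrite (linZ _ _ (@lin_colv _ _ _ _)) !mxE mulrC.
have PW : P *m W1 = W1.
  apply/matrixP => i k; have /hA/colP/(_ i) : a`_k \in A.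
    by apply: vbasis_mem; apply: mem_nth; rewrite size_tuple.
  move=> E; rewrite [RHS]mxE -E !mxE; apply: eq_bigr => j _.
  by rewrite !mxE.
(* A factorization through dimension [\dim A] is padded with zeros to dimension [l]. *)
exists (W1 *m pid_mx (\dim A)), (pid_mx (\dim A) *m E1); split; last by rewrite mulmxA PW.
rewrite -mulmxA (mulmxA (pid_mx _)) mul_pid_mx minnn (minn_idPr dA) pid_mx_1 mul1mx.
exact: PE.
Qed.

Lemma trivial_sub_coact (A : {vspace V}) (P : 'M[C]_n) : proj_on b P A ->
  is_subcomodule rho A -> is_trivial (@sub_coact R K V rho A) -> c *m cmx K P = cmx K P.
Proof.
move=> hP hA ht; apply/matrixP => i j.
have wA : vecv b (P *m delta_mx j 0) \in A by exact: proj_on_vec.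
have E : rho (vecv b (P *m delta_mx j 0)) = vecv b (P *m delta_mx j 0) ⊗ 1.
  rewrite -[X in rho X](vsprojK wA) -(sub_coactE hA) ht tlift_tens ?vsprojK //.
  by apply: balanced_lin_tens; exact: lin_linear.
have := congr1 (slice b i) E; rewrite (slice_rho hb hrho) slice_tens vecvK //.
rewrite cmxM mulmxA.
have -> : coord b i (vecv b (P *m delta_mx j 0)) = P i j.
  have := congr1 (fun x : 'cV_n => x i 0) (vecvK hb (P *m delta_mx j 0)).
  by rewrite mxE => ->; rewrite -colE mxE.
rewrite cmxE => <-; rewrite [RHS]mulr_cmxE (bigD1 j) //= [delta_mx j 0 j 0]mxE !eqxx scale1r.
by rewrite big1 ?addr0 // => k kj; rewrite [delta_mx j 0 k 0]mxE (negPf kj) scale0r.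
Qed.

(** The induction invariant behind [generated]: [M] is the part of [Q] generated by [Vm], [B] the
    part made of invariants, and the last equation records that only the eigenvalues 1, ..., r of
    [T] occur on the orbit of [Vm]. *)
Definition decomposed l (Q : 'M[C]_n) : Prop :=
  exists r (T B : 'M[C]_n) (Vm : 'M[C]_(n, l)) (M : 'M[C]_n),
    [/\ [/\ commutator T c = 0, c *m cmx K B = cmx K B & krylov T Vm M],
        Q = M + B, [/\ Q *m T = T, T *m Q = T, Q *m Vm = Vm & Q *m B = B]
      & falling T r Vm = 0].

(* The new intertwiner is T' + (r + 1) P; as T' has eigenvalues 1, ..., r on the
   summands found so far, (T - 1)...(T - r) isolates the new one. *)
Lemma decompose_step l (P Q' : 'M[C]_n) (V1 : 'M[C]_(n, l)) (D1 : 'M[C]_(l, n)) :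
  commutator P c = 0 -> is_oproj P -> is_oproj Q' -> P *m Q' = 0 -> Q' *m P = 0 ->
  P = V1 *m D1 -> P *m V1 = V1 -> decomposed l Q' -> decomposed l (Q' + P).
Proof.
move=> cP [aP PP] [aQ QQ] PQ QP PE PV.
move=> [r [T' [B [Vm' [M [[cT' cB kr] QE [QT TQ QV QB] fall]]]]]].
pose mu : C := r.+1%:R.
pose T := T' + mu *: P; pose Vm := Vm' + V1.
have PT' : P *m T' = 0 by rewrite -QT mulmxA PQ mul0mx.
have T'P : T' *m P = 0 by rewrite -TQ -mulmxA QP mulmx0.
have PV' : P *m Vm' = 0 by rewrite -QV mulmxA PQ mul0mx.
have PB : P *m B = 0 by rewrite -QB mulmxA PQ mul0mx.
have QV1 : Q' *m V1 = 0 by rewrite -PV mulmxA QP mul0mx.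
have TY q (Y : 'M[C]_(n, q)) : Q' *m Y = Y -> T *m Y = T' *m Y.
  by move=> h; rewrite mulmxDl -scalemxAl -{2}h mulmxA PQ mul0mx scaler0 addr0.
have TZ q (Z : 'M[C]_(n, q)) : P *m Z = Z -> T *m Z = mu *: Z.
  by move=> h; rewrite mulmxDl -scalemxAl h -{1}h mulmxA T'P mul0mx add0r.
have Qfall k : Q' *m falling T' k Vm' = falling T' k Vm'.
  by elim: k => //= k IH; rewrite mulmxBr -scalemxAr IH mulmxA QT.
(* [T] is the scalar r + 1 on [V1], so each factor T - j with j <= r multiplies [V1] by a nonzero
   number, while at k = r the contribution of [Vm'] vanishes. *)
have fallE k : (k <= r)%N -> exists2 a : C, a != 0 &
    falling T k Vm = falling T' k Vm' + a *: V1.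
  elim: k => [|k IH] hk; first by exists 1; rewrite ?oner_neq0 ?scale1r.
  have [a a0 E] := IH (ltnW hk); exists ((mu - k.+1%:R) * a).
    rewrite mulf_neq0 // /mu -natrB ?(leqW hk) // pnatr_eq0 subn_eq0 -ltnNge.
    by rewrite ltnS.
  rewrite /= E mulmxDr TY // -scalemxAr TZ // scalerDr opprD addrACA; congr (_ + _).
  by rewrite !scalerA -scalerBl mulrBl [a * _]mulrC.
have [a a0 E] := fallE r (leqnn r); rewrite fall add0r in E.
have krV1 : krylov T Vm V1.
  rewrite -[V1](scalerK a0) -E; apply/krylov_scale/krylov_falling.
  by rewrite -[X in krylov _ _ X]mulmx1; exact: krylov_gen.
have krV' : krylov T Vm Vm'.
  have -> : Vm' = Vm *m 1%:M + (-1) *: V1 by rewrite mulmx1 scaleN1r addrK.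
  by apply: krylov_add; [exact: krylov_gen | exact: krylov_scale].
(* [T] and [T'] agree on the image of [Q'], which contains the orbit of [Vm']; the combinations
   found for [T'] therefore remain valid for [T]. *)
have itE j : iter j (mulmx T') Vm' = iter j (mulmx T) Vm' /\
             Q' *m iter j (mulmx T') Vm' = iter j (mulmx T') Vm'.
  elim: j => [|j [IH1 IH2]] //=; split; last by rewrite mulmxA QT.
  by rewrite -IH1 TY.
exists r.+1, T, B, Vm, (M + P); split.
- split=> //.
  + apply/matrixP => i j; have -> : T = mu *: P + T' by rewrite addrC.
    by rewrite commutator_lin cP cT' !mxE scaler0 addr0.
  + apply: krylov_add; last by rewrite PE; exact: krylov_mulr.
    have [s ->] := kr; apply: krylov_sum => p; apply: krylov_mulr.
    have [-> _] := itE p.1.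
    by elim: p.1 => //= j IH; exact: krylov_mull.
- by rewrite QE addrAC.
- split.
  + by rewrite mulmxDl !mulmxDr -!scalemxAr QT QP PT' PP scaler0 addr0 add0r.
  + by rewrite mulmxDl !mulmxDr -!scalemxAl TQ PQ T'P PP scaler0 addr0 add0r.
  + by rewrite mulmxDl !mulmxDr QV QV1 PV' PV addr0 add0r.
  + by rewrite mulmxDl QB PB addr0.
- by rewrite /= E -scalemxAr TZ // scalerA mulrC -scalerA subrr.
Qed.

Lemma decompose_trivial l (P Q' : 'M[C]_n) :
  is_oproj P -> is_oproj Q' -> P *m Q' = 0 -> Q' *m P = 0 -> c *m cmx K P = cmx K P ->
  decomposed l Q' -> decomposed l (Q' + P).
Proof.
move=> [aP PP] [aQ QQ] PQ QP cP.
move=> [r [T [B [Vm [M [[cT cB kr] QE [QT TQ QV QB] fall]]]]]].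
have PT : P *m T = 0 by rewrite -QT mulmxA PQ mul0mx.
have TP : T *m P = 0 by rewrite -TQ -mulmxA QP mulmx0.
have PV : P *m Vm = 0 by rewrite -QV mulmxA PQ mul0mx.
have PB : P *m B = 0 by rewrite -QB mulmxA PQ mul0mx.
exists r, T, (B + P), Vm, M; split=> //.
- by split=> //; rewrite cmxD mulmxDr cB cP.
- by rewrite {1}QE addrA.
- split.
  + by rewrite mulmxDl QT PT addr0.
  + by rewrite mulmxDr TQ TP addr0.
  + by rewrite mulmxDl QV PV addr0.
  + by rewrite mulmxDl !mulmxDr QB QP PB PP addr0 add0r.
Qed.

(** Induction on the dimension: an irreducible subcomodule is split off, and its orthogonal
    complement in [W] has the projection [Q - P], again an intertwiner. *)
Lemma irreducibles_decomposed l (W : {vspace V}) (Q : 'M[C]_n) : proj_on b Q W ->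
  is_subcomodule rho W -> irreducibles_le rho l W -> decomposed l Q.
Proof.
have [k] := ubnP (\dim W); elim: k W Q => // k IH W Q; rewrite ltnS => dW hQ hW hl.
have [[aQ QQ] hQW] := hQ.
have [W0|W0] := eqVneq W 0%VS.
  have -> : Q = 0.
    apply: mx_ext_col => x; have := proj_on_vec hb x hQ.
    rewrite W0 memv0 => /eqP /(congr1 (colv b)).
    by rewrite vecvK // (lin0 (@lin_colv _ _ _ _)) mul0mx.
  exists 0%N, 0, 0, 0, 0; split; rewrite ?addr0 //; last by split; rewrite mul0mx.
  split; [exact: commutator0 | by rewrite cmx0 mulmx0 | exists [::]; by rewrite big_nil].
have [A [hA AW A0 irrA]] := minimal_subcomodule hW W0.
have [P hP] := proj_on_exists hb A; have [[aP PP] hPA] := hP.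
have [QP PQ] : Q *m P = P /\ P *m Q = P.
  by apply: (subcomodule_proj_mul hb hP aQ) => a aA; apply/hQW; exact: (subvP AW).
pose Q' := Q - P.
have oQ' : is_oproj Q'.
  split; first by rewrite adjB aQ aP.
  by rewrite mulmxBl !mulmxBr QQ QP PQ PP subrr subr0.
have PQ' : P *m Q' = 0 by rewrite mulmxBr PQ PP subrr.
have Q'P : Q' *m P = 0 by rewrite mulmxBl QP PP subrr.
have QQ' : Q *m Q' = Q' by rewrite mulmxBr QQ QP.
have cP : commutator P c = 0 by apply/(subcomodule_commutator hb hrho hc hP).
have cQ : commutator Q c = 0 by apply/(subcomodule_commutator hb hrho hc hQ).
have cQ' : commutator Q' c = 0.
  apply/matrixP => i j; have -> : Q' = (-1) *: P + Q by rewrite scaleN1r addrC.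
  by rewrite commutator_lin cP cQ !mxE scaler0 addr0.
have [|W' hW'] := @vspace_of_submodule _ V (fun v => Q' *m colv b v = colv b v).
  split=> [|d x y hx hy]; first by rewrite (lin0 (@lin_colv _ _ _ _)) mulmx0.
  by rewrite lin_colv mulmxDr -scalemxAr hx hy.
have hQ' : proj_on b Q' W' by split.
have W'W : (W' <= W)%VS.
  by apply/subvP => v /hW' vE; apply/hQW; rewrite -vE mulmxA QQ'.
have sW' : is_subcomodule rho W' by apply/(subcomodule_commutator hb hrho hc hQ').
have lt : (\dim W' < k)%N.
  apply: leq_trans dW; rewrite (ltn_leqif (dimv_leqif_sup W'W)).
  apply: contraNN A0 => WW'; rewrite -subv0; apply/subvP => v vA.
  have /hPA vP := vA; have /(subvP WW')/hW' vQ := subvP AW _ vA.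
  rewrite memv0 -(colvK hb v) -vP -vQ mulmxA PQ' mul0mx.
  by rewrite (lin0 (@lin_vecv _ _ _ _)).
have dec : decomposed l Q'.
  apply: (IH W') => // B hB BW'; apply: hl => //; exact: subv_trans W'W.
have -> : Q = Q' + P by rewrite subrK.
have [ht|nt] := pselect (is_trivial (@sub_coact R K V rho A)).
  by apply: decompose_trivial => //; exact: trivial_sub_coact.
have [V1 [D1 [PE PV]]] := proj_factor hP (hl A hA AW irrA nt).
exact: (decompose_step cP (conj aP PP) oQ' PQ' Q'P PE PV dec).
Qed.

Lemma irreducibles_generated l (W : {vspace V}) (Q : 'M[C]_n) : proj_on b Q W ->
  is_subcomodule rho W -> irreducibles_le rho l W -> generated rho b l Q.
Proof.
move=> hQ hW hl; have [[_ QQ] _] := hQ.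
have [r [T [B [Vm [M [[cT cB [s ME]] QE [QT TQ QV QB] _]]]]]] :=
  irreducibles_decomposed hQ hW hl.
exists T, B, Vm, s; split=> //.
rewrite /generator QT TQ QV QB -ME -QE QQ addrC subrK.
exact: unitmx1.
Qed.

End Decomposition.

(** * The two loci in terms of intertwiners modulo the ideal *)

Definition generated_mod (R : realType) (H : hopf_star_algebra R) n (U : 'M[H]_n)
    (I : H -> Prop) (l : nat) (Q : 'M[R[i]]_n) : Prop :=
  exists (T B : 'M[R[i]]_n) (Vm : 'M[R[i]]_(n, l)) s,
    [/\ mx_in I (commutator T U), mx_in I (U *m cmx H B - cmx H B)
      & generator Q T B Vm s \in unitmx].

Section LociModIdeal.
Variables (R : realType) (H : cqg_algebra R) (V : vectType R[i]).
Local Notation C := R[i].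
Variables (rho : V -> V ⊗ H) (n : nat) (b : n.-tuple V).
Hypothesis hrho : is_comodule rho.
Hypothesis hb : basis_of fullv b.
Local Notation U := (coact_mx b rho).
Hypothesis hU : is_ucorep U.

Lemma generated_push (K : hopf_star_algebra R) (f : hopf_star_morphism H K) l Q :
  generated (push_coact f rho) b l Q <-> generated_mod U (fun a => f a = 0) l Q.
Proof.
have mx0P m p (M : 'M[H]_(m, p)) : map_mx f M = 0 <-> mx_in (fun a => f a = 0) M.
  split=> [/matrixP h i j|h]; first by have := h i j; rewrite mxE [RHS]mxE.
  by apply/matrixP => i j; rewrite mxE [RHS]mxE; exact: h.
have E (B : 'M[C]_n) : map_mx f (U *m cmx H B - cmx H B) = map_mx f U *m cmx K B - cmx K B.
  by rewrite map_mxB map_mxM !map_morph_cmx.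
rewrite /generated coact_mx_push; split=> -[T [B [Vm [s [cT cB uG]]]]];
  exists T, B, Vm, s; split=> //.
- by apply/mx0P; rewrite map_morph_commutator.
- by apply/mx0P; rewrite E // cB subrr.
- by rewrite -map_morph_commutator; exact/mx0P.
- by apply/eqP; rewrite -subr_eq0 -E //; exact/eqP/mx0P.
Qed.

Lemma generated_mod_ext I J l Q : (forall a, I a <-> J a) ->
  generated_mod U I l Q -> generated_mod U J l Q.
Proof.
move=> IJ [T [B [Vm [s [cT cB uG]]]]]; exists T, B, Vm, s.
by split=> // i j; apply/IJ; [exact: cT | exact: cB].
Qed.

Variables (W : {vspace V}) (P : 'M[C]_n) (l : nat).
Hypothesis hPW : proj_on b P W.

(** The conditions on [T] and [B] depend only on the kernel of the map to [K], which is the same for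
    every realization. This leaves matrix conditions over the fixed algebra [H], in which only the
    ideal varies. *)
Lemma locus_subP :
  (exists (K : cqg_algebra R) (f : hopf_star_morphism H K),
     is_stabilizer rho W f /\ is_constrained l (@sub_coact R K V (push_coact f rho) W)) <->
  generated_mod U (gen_ideal P U) l P.
Proof.
split=> [[K [f [hf hl]]]|h].
  have hr := is_comodule_push f hrho; have [hW _] := hf.
  have hc : is_ucorep (coact_mx b (push_coact f rho)).
    by rewrite coact_mx_push; exact: is_ucorep_morph.
  have /generated_push := irreducibles_generated hr hb hc hPW hW
    (constrained_sub_irreducibles hr hW hl).
  by apply: generated_mod_ext => a; exact: (stabilizer_kernel hrho hb hU hPW).
have hf := stabilizer_exists hrho hb hU hPW.
exists (quotient_cqg (stab_ideal hU hPW)), (quotient_morphism (stab_ideal hU hPW)).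
split; first exact: hf.
set f := quotient_morphism _ in hf *; have [hW _] := hf.
have hc : is_ucorep (coact_mx b (push_coact f rho)).
  by rewrite coact_mx_push; exact: is_ucorep_morph.
apply: (generated_sub (is_comodule_push f hrho) hb hc hPW hW); apply/generated_push.
apply: generated_mod_ext h => a; apply: iff_sym.
exact: (stabilizer_kernel hrho hb hU hPW _ hf).
Qed.

Lemma locus_ambientP :
  (exists (K : cqg_algebra R) (f : hopf_star_morphism H K),
     is_stabilizer rho W f /\ is_constrained l (push_coact f rho)) <->
  generated_mod U (gen_ideal P U) l 1%:M.
Proof.
split=> [[K [f [hf hl]]]|h].
  have hr := is_comodule_push f hrho; have [hW _] := hf.
  have hc : is_ucorep (coact_mx b (push_coact f rho)).
    by rewrite coact_mx_push; exact: is_ucorep_morph.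
  have h1 : proj_on b 1%:M (fullv : {vspace V}).
    by split=> [|v]; [split; [exact: adj1 | exact: mul1mx] | rewrite memvf mul1mx].
  have hfull : is_subcomodule (push_coact f rho) fullv.
    exact/(subcomodule_commutator hb hr hc h1)/commutator1.
  have /generated_push := irreducibles_generated hr hb hc h1 hfull
    (constrained_ambient_irreducibles hr hl).
  by apply: generated_mod_ext => a; exact: (stabilizer_kernel hrho hb hU hPW).
have hf := stabilizer_exists hrho hb hU hPW.
exists (quotient_cqg (stab_ideal hU hPW)), (quotient_morphism (stab_ideal hU hPW)).
split; first exact: hf.
set f := quotient_morphism _ in hf *.
have hc : is_ucorep (coact_mx b (push_coact f rho)).
  by rewrite coact_mx_push; exact: is_ucorep_morph.
apply: (generated_ambient (is_comodule_push f hrho) hb hc); apply/generated_push.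
apply: generated_mod_ext h => a; apply: iff_sym.
exact: (stabilizer_kernel hrho hb hU hPW _ hf).
Qed.

End LociModIdeal.

(** * Nonvanishing of the generator determinant along regular families *)

Section Openness.
Variables (R : realType) (H : cqg_algebra R).
Local Notation C := R[i].
Variables (X : Type) (reg : (X -> C) -> Prop).
Hypothesis reg_const : forall c, reg (fun=> c).
Hypothesis reg_add : forall f g, reg f -> reg g -> reg (fun x => f x + g x).
Hypothesis reg_mul : forall f g, reg f -> reg g -> reg (fun x => f x * g x).
Hypothesis reg_conj : forall f, reg f -> reg (fun x => ((f x)^*)%C).

Lemma regmx_add m p (F G : X -> 'M[C]_(m, p)) : regmx reg F -> regmx reg G ->
  regmx reg (fun x => F x + G x).
Proof.
move=> hF hG i j.
by apply: (reg_ext (f := fun x => F x i j + G x i j)) => [x|]; [rewrite mxE | exact: reg_add].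
Qed.

Lemma regmx_opp m p (F : X -> 'M[C]_(m, p)) : regmx reg F -> regmx reg (fun x => - F x).
Proof.
move=> hF i j; apply: (reg_ext (f := fun x => -1 * F x i j)) => [x|].
  by rewrite mxE mulN1r.
by apply: reg_mul.
Qed.

Lemma reg_prod (I : Type) (r : seq I) (F : I -> X -> C) :
  (forall i, reg (F i)) -> reg (fun x => \prod_(i <- r) F i x).
Proof.
move=> h; elim: r => [|i r IH].
  by apply: (reg_ext (f := fun=> 1)) => // x; rewrite big_nil.
by apply: reg_ext (reg_mul (h i) IH) => x; rewrite big_cons.
Qed.

Lemma reg_det m (F : X -> 'M[C]_m) : regmx reg F -> reg (fun x => \det (F x)).
Proof.
move=> hF; apply: (reg_sum reg_const reg_add) => s; apply: reg_mul => //.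
by apply: reg_prod => i; exact: hF.
Qed.

Lemma regmx_iter m p k (F : X -> 'M[C]_m) (G : X -> 'M[C]_(m, p)) :
  regmx reg F -> regmx reg G -> regmx reg (fun x => iter k (mulmx (F x)) (G x)).
Proof.
by move=> hF hG; elim: k => //= k IH; apply: (regmx_mul reg_const reg_add reg_mul).
Qed.

Lemma regmx_sum m p (I : Type) (r : seq I) (F : I -> X -> 'M[C]_(m, p)) :
  (forall i, regmx reg (F i)) -> regmx reg (fun x => \sum_(i <- r) F i x).
Proof.
move=> h; elim: r => [|i r IH].
  move=> i j; apply: (reg_ext (f := fun=> 0)) => // x.
  by rewrite big_nil mxE.
move=> k j; apply: (reg_ext (f := fun x => (F i x + \sum_(i <- r) F i x) k j)) => [x|].
  by rewrite big_cons.
by apply: regmx_add.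
Qed.

Lemma regmx_generator n l (Q T B : X -> 'M[C]_n) (Vm : 'M[C]_(n, l)) s :
  regmx reg Q -> regmx reg T -> regmx reg B ->
  regmx reg (fun x => generator (Q x) (T x) (B x) Vm s).
Proof.
move=> hQ hT hB; have rM := @regmx_mul _ _ _ reg_const reg_add reg_mul.
have rc m p (A : 'M[C]_(m, p)) : regmx reg (fun=> A) by move=> i j.
apply: regmx_add; last by apply: regmx_add => //; exact: regmx_opp.
apply: (rM _ _ _) => //; apply: regmx_add; last exact: rM.
apply: regmx_sum => p; apply: (rM _ _ _) => //; apply: regmx_iter; last exact: rM.
by apply: (rM _ _ _) => //; exact: rM.
Qed.

Variables (n : nat) (U : 'M[H]_n) (P Q : X -> 'M[C]_n) (l : nat).
Hypothesis hU : is_ucorep U.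
Hypothesis regP : regmx reg P.
Hypothesis regQ : regmx reg Q.
Hypothesis hP : forall x, adj (P x) = P x.

(** [Vm] and [s] are frozen at their values for [x0], while [T0] and [B0] are replaced by regular
    families through them; [h] is the determinant of the resulting generator. *)
Lemma generated_mod_open x0 : generated_mod U (gen_ideal (P x0) U) l (Q x0) ->
  exists2 h : X -> C, reg h & h x0 != 0 /\
    forall x, h x != 0 -> generated_mod U (gen_ideal (P x) U) l (Q x).
Proof.
move=> [T0 [B0 [Vm [s [cT cB uG]]]]].
have [T [rT TE hT]] :=
  intertwiner_extends reg_const reg_add reg_mul reg_conj hU regP hP hU cT.
have [B [rB BE hB]] :=
  invariants_extend reg_const reg_add reg_mul reg_conj hU regP hP cB.
exists (fun x => \det (generator (Q x) (T x) (B x) Vm s)).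
  by apply: reg_det; exact: regmx_generator.
split=> [|x hx]; first by rewrite TE BE -unitfE -unitmxE.
by exists (T x), (B x), Vm, s; split=> //; rewrite unitmxE unitfE.
Qed.

End Openness.

(** * Charts of the Grassmannian *)

Section PolynomialFunctions.
Variables (R : realType) (N : nat).
Local Notation C := R[i].
Implicit Types f g : 'rV[R]_N -> C.

Definition polyfun f : Prop :=
  exists p q : mpoly N R, forall x, f x = meval (x 0) p +i* meval (x 0) q.

Lemma polyfun_const c : polyfun (fun=> c).
Proof.
by exists (mpolyC N (complex.Re c)), (mpolyC N (complex.Im c)) => x; rewrite !mevalC; case: c.
Qed.

Lemma polyfun_coord (i j : 'I_N) : polyfun (fun x => x 0 i +i* x 0 j).
Proof. by exists (mpolyX R (mnm1 i)), (mpolyX R (mnm1 j)) => x; rewrite !mevalXU. Qed.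

Lemma polyfun_add f g : polyfun f -> polyfun g -> polyfun (fun x => f x + g x).
Proof.
move=> [p [q fE]] [p' [q' gE]]; exists (p + p'), (q + q') => x.
by rewrite fE gE !mevalD.
Qed.

Lemma polyfun_mul f g : polyfun f -> polyfun g -> polyfun (fun x => f x * g x).
Proof.
move=> [p [q fE]] [p' [q' gE]]; exists (p * p' - q * q'), (p * q' + q * p') => x.
by rewrite fE gE mevalB mevalD !mevalM.
Qed.

Lemma polyfun_conj f : polyfun f -> polyfun (fun x => ((f x)^*)%C).
Proof. by move=> [p [q fE]]; exists p, (- q) => x; rewrite fE mevalN. Qed.

Lemma polyfun_nonzero f x0 : polyfun f -> f x0 != 0 ->
  exists p : mpoly N R, meval (x0 0) p != 0 /\
    forall x : 'rV[R]_N, meval (x 0) p != 0 -> f x != 0.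
Proof.
move=> [p [q fE]]; rewrite fE eq_complex negb_and /= => /orP[h|h];
  [exists p | exists q]; split=> // x hx; rewrite fE eq_complex negb_and /= hx ?orbT //.
Qed.

(** Quotients of polynomial functions of the real coordinates by nowhere vanishing ones. They are
    defined on the whole chart, and [f] has the same zeros as its numerator. *)
Definition regular f : Prop :=
  exists g, [/\ polyfun g, forall x, g x != 0 & polyfun (fun x => g x * f x)].

Lemma regular_poly f : polyfun f -> regular f.
Proof.
move=> hf; exists (fun=> 1); split=> [|x|]; [exact: polyfun_const | exact: oner_neq0 | ].
by apply: polyfun_mul => //; exact: polyfun_const.
Qed.

Lemma regular_const c : regular (fun=> c).
Proof. exact/regular_poly/polyfun_const. Qed.

Lemma polyfun_ext f g : f =1 g -> polyfun f -> polyfun g.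
Proof. by move=> /funext ->. Qed.

Lemma regular_add f g : regular f -> regular g -> regular (fun x => f x + g x).
Proof.
move=> [h [hp h0 hf]] [k [kp k0 kg]]; exists (fun x => h x * k x); split=> [|x|].
- exact: polyfun_mul.
- by rewrite mulf_neq0.
- apply: (@polyfun_ext (fun x => k x * (h x * f x) + h x * (k x * g x))) => [x|].
    by rewrite mulrDr mulrCA !mulrA.
  by apply: polyfun_add; apply: polyfun_mul.
Qed.

Lemma regular_mul f g : regular f -> regular g -> regular (fun x => f x * g x).
Proof.
move=> [h [hp h0 hf]] [k [kp k0 kg]]; exists (fun x => h x * k x); split=> [|x|].
- exact: polyfun_mul.
- by rewrite mulf_neq0.
- apply: (@polyfun_ext (fun x => (h x * f x) * (k x * g x))) => [x|].
    by rewrite mulrACA.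
  exact: polyfun_mul.
Qed.

Lemma regular_conj f : regular f -> regular (fun x => ((f x)^*)%C).
Proof.
move=> [h [hp h0 hf]]; exists (fun x => ((h x)^*)%C); split=> [|x|].
- exact: polyfun_conj.
- by rewrite conjc_eq0.
- by apply: (@polyfun_ext (fun x => ((h x * f x)^*)%C)) => [x|];
    [exact: conjc_mul | exact: polyfun_conj].
Qed.

Lemma regular_inv f : regular f -> (forall x, f x != 0) -> regular (fun x => (f x)^-1).
Proof.
move=> [h [hp h0 hf]] f0; exists (fun x => h x * f x); split=> [//|x|].
  by rewrite mulf_neq0.
by apply: (@polyfun_ext h) => // x; rewrite mulfK.
Qed.

Lemma regular_nonzero f x0 : regular f -> f x0 != 0 ->
  exists p : mpoly N R, meval (x0 0) p != 0 /\
    forall x : 'rV[R]_N, meval (x 0) p != 0 -> f x != 0.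
Proof.
move=> [h [hp h0 hf]] fx0.
have [|p [px0 hpx]] := @polyfun_nonzero _ x0 hf; first by rewrite mulf_neq0.
exists p; split=> // x /hpx.
by rewrite mulf_eq0 negb_or => /andP[].
Qed.

Lemma regular_invmx m (F : 'rV[R]_N -> 'M[C]_m) : regmx regular F ->
  (forall x, F x \in unitmx) -> regmx regular (fun x => invmx (F x)).
Proof.
move=> hF uF i j.
apply: (reg_ext (f := fun x => (\det (F x))^-1 * \adj (F x) i j)) => [x|].
  by rewrite /invmx uF !mxE.
apply: regular_mul; first apply: regular_inv => [|x].
- exact: (reg_det regular_const regular_add regular_mul).
- by have := uF x; rewrite unitmxE unitfE.
apply: (reg_ext (f := fun x => cofactor (F x) j i)) => [x|]; first by rewrite mxE.
apply: regular_mul; first exact: regular_const.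
apply: (reg_det regular_const regular_add regular_mul) => k l.
by apply: (reg_ext (f := fun x => F x (lift j k) (lift i l))) => [x|]; [rewrite !mxE | exact: hF].
Qed.

End PolynomialFunctions.

Section ChartProjections.
Variables (R : realType) (V : vectType R[i]) (d : nat).
Local Notation C := R[i].
Hypothesis hd : (d <= \dim {:V})%N.
Local Notation m := (\dim {:V} - d)%N.
Local Notation N := (d * m + d * m)%N.
Variables (n : nat) (b : n.-tuple V) (e : (\dim {:V}).-tuple V).
Hypothesis hb : basis_of fullv b.
Hypothesis he : basis_of fullv e.

Definition chart_vec (A : 'M[C]_(d, m)) (i : 'I_d) : V :=
  e`_i + \sum_(j < m) A i j *: e`_(d + j)%N.

Definition chart_cols (x : 'rV[R]_N) : 'M[C]_(n, d) :=
  \matrix_(k, i) coord b k (chart_vec (complex_mx x) i).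

(** The formula for the orthogonal projection onto a column space in terms of the Gram matrix, whose
    inverse is the source of the denominators in [regular]. *)
Definition chart_proj (x : 'rV[R]_N) : 'M[C]_n :=
  chart_cols x *m invmx (adj (chart_cols x) *m chart_cols x) *m adj (chart_cols x).

Lemma chart_cols_vec x (y : 'cV[C]_d) :
  vecv b (chart_cols x *m y) = \sum_i y i 0 *: chart_vec (complex_mx x) i.
Proof.
rewrite -[RHS](colvK hb); congr (vecv b _); apply/colP => k.
rewrite (lin_sum _ _ _ (@lin_colv _ _ _ _)) mxE summxE; apply: eq_bigr => i _.
by rewrite (linZ _ _ (@lin_colv _ _ _ _)) !mxE mulrC.
Qed.

Lemma chart_spaceP A v :
  v \in chart_space e A <-> exists y : 'cV[C]_d, v = \sum_i y i 0 *: chart_vec A i.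
Proof.
split=> [|[y ->]].
  have -> : chart_space e A = <<mktuple (chart_vec A)>>%VS.
    by rewrite /chart_space; congr (<<_>>)%VS; rewrite /= val_ord_tuple.
  move=> /coord_span ->; exists (\col_i coord (mktuple (chart_vec A)) i v).
  by apply: eq_bigr => i _; rewrite mxE -tnth_nth tnth_mktuple.
apply: memv_suml => i _; apply/memvZ/memv_span/mapP.
by exists i => //; rewrite mem_enum.
Qed.

(** A vector killed by the Gram matrix is killed by [chart_cols x], whose columns are the
    coordinates of a free family. *)
Lemma chart_gram_unit x : adj (chart_cols x) *m chart_cols x \in unitmx.
Proof.
rewrite -row_free_unit -kermx_eq0; apply/eqP.
have inj (y : 'cV[C]_d) : chart_cols x *m y = 0 -> y = 0.
  move=> h; have := chart_cols_vec x y; rewrite h (lin0 (@lin_vecv _ _ _ _)).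
  have := dim_chart_space (complex_mx x) hd he.
  have -> : chart_space e (complex_mx x) = <<mktuple (chart_vec (complex_mx x))>>%VS.
    by rewrite /chart_space; congr (<<_>>)%VS; rewrite /= val_ord_tuple.
  move=> dE /esym sE.
  have /freeP fr : free (mktuple (chart_vec (complex_mx x))) by rewrite /free dE size_tuple.
  apply/colP => i; rewrite mxE; apply: (fr (fun i => y i 0)).
  by rewrite -[RHS]sE; apply: eq_bigr => j _; rewrite -tnth_nth tnth_mktuple.
set G := adj _ *m _.
have aG : adj G = G by rewrite adjM adjK.
have injG (y : 'cV[C]_d) : G *m y = 0 -> y = 0.
  move=> Gy; apply/inj/adjmx_eq0; rewrite adjM mulmxA -(mulmxA (adj y)).
  by rewrite -mulmxA Gy mulmx0.
have kG : G *m adj (kermx G) = 0.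
  by rewrite -[LHS]adjK adjM adjK aG mulmx_ker adj0.
rewrite -[LHS]adjK (_ : adj (kermx G) = 0) ?adj0 //.
apply: mx_ext_col => y; rewrite mul0mx; apply: injG.
by rewrite mulmxA kG mul0mx.
Qed.

Lemma chart_proj_on x : proj_on b (chart_proj x) (chart_space e (complex_mx x)).
Proof.
have uG := chart_gram_unit x; set F := chart_cols x in uG *.
have aI : adj (invmx (adj F *m F)) = invmx (adj F *m F).
  by rewrite /adj trmx_inv map_invmx -/(adj (adj F *m F)) adjM adjK.
have PF : chart_proj x *m F = F.
  by rewrite /chart_proj -/F -!mulmxA mulVmx // mulmx1.
split.
- split; first by rewrite /chart_proj -/F !adjM adjK aI mulmxA.
  by rewrite {2}/chart_proj -/F !mulmxA PF.
- move=> v; split=> [/chart_spaceP[y ->]|vE].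
    by rewrite -chart_cols_vec vecvK // mulmxA PF.
  apply/chart_spaceP; exists (invmx (adj F *m F) *m adj F *m colv b v).
  transitivity (vecv b (chart_proj x *m colv b v)); first by rewrite vE colvK.
  by rewrite -chart_cols_vec /chart_proj -/F !mulmxA.
Qed.

Lemma regular_chart_cols : regmx (@regular R N) chart_cols.
Proof.
move=> k i; apply: (reg_ext (f := fun x => coord b k e`_i +
    \sum_(j < m) complex_mx x i j * coord b k e`_(d + j))) => [x|].
  by rewrite mxE linearD linear_sum; congr (_ + _); apply: eq_bigr => j _; rewrite linearZ.
apply: regular_add; first exact: regular_const.
apply: (reg_sum (@regular_const _ _) (@regular_add _ _)) => j.
apply: regular_mul; last exact: regular_const.
apply/regular_poly.
have h := @polyfun_coord R N (lshift (d * m) (mxvec_index i j))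
  (rshift (d * m) (mxvec_index i j)).
apply: (polyfun_ext _ h).
by move=> x; rewrite mxE.
Qed.

Lemma regular_chart_proj : regmx (@regular R N) chart_proj.
Proof.
have rc := @regular_const R N; have ra := @regular_add R N; have rm := @regular_mul R N.
have rj := @regular_conj R N.
have rF := regular_chart_cols.
have rA : regmx (@regular R N) (fun x => adj (chart_cols x)) by exact: regmx_adj.
apply: regmx_mul => //; apply: regmx_mul => //.
by apply: regular_invmx; [exact: regmx_mul | exact: chart_gram_unit].
Qed.

End ChartProjections.

Local Open Scope classical_set_scope.

(** * Common complements, common charts and density *)

Section CommonComplement.
Variables (F : fieldType) (V : vectType F).

Lemma vector_outside (A B : {vspace V}) : \dim A = \dim B -> A != fullv ->
  exists v, v \notin A /\ v \notin B.
Proof.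
move=> dAB Af.
have outside (E : {vspace V}) : E != fullv -> exists v, v \notin E.
  move=> Ef; apply: contrapT => h; case/negP: Ef.
  rewrite eqEsubv subvf /=; apply/subvP => v _.
  by apply: contrapT => /negP nv; apply: h; exists v.
have [AB|/subvPn[a aA aB]] := boolP (A <= B)%VS.
  have /eqP <- : A == B by rewrite eqEdim AB dAB leqnn.
  by have [v vA] := outside _ Af; exists v.
have [BA|/subvPn[c cB cA]] := boolP (B <= A)%VS.
  have /eqP -> : B == A by rewrite eqEdim BA dAB leqnn.
  by have [v vA] := outside _ Af; exists v.
exists (a + c); split.
  by apply: contraNN cA => /memvB/(_ aA); rewrite addrC addKr.
by apply: contraNN aB => /memvB/(_ cB); rewrite addrK.
Qed.

Lemma dim_add_line (A : {vspace V}) v : v \notin A -> \dim (A + <[v]>) = (\dim A).+1.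
Proof.
move=> vA; have v0 : v != 0 by apply: contraNneq vA => ->; exact: mem0v.
have := dimv_sum_cap A <[v]>; rewrite dim_vline v0 addn1 => <-.
suff -> : (A :&: <[v]>)%VS = 0%VS by rewrite dimv0 addn0.
apply/eqP; rewrite -subv0; apply/subvP => w; rewrite memv_cap => /andP[wA /vlineP[k wE]].
rewrite memv0; apply: contraNT vA => w0.
have k0 : k != 0 by apply: contraNneq w0 => k0; rewrite wE k0 scale0r.
by rewrite -(scalerK k0 v) -wE; exact: memvZ.
Qed.

Lemma dimv_leq_add (A B : {vspace V}) : (\dim (A + B) <= \dim A + \dim B)%N.
Proof. by case: (dimv_add_leqif A B). Qed.

(** Two proper subspaces never cover the space, so a vector outside both can be adjoined to both
    until they are full; the adjoined vectors span the complement. *)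
Lemma common_complement (A B : {vspace V}) : \dim A = \dim B ->
  exists D : {vspace V}, [/\ (A + D)%VS = fullv, (B + D)%VS = fullv
    & \dim D = (\dim {:V} - \dim A)%N].
Proof.
have [k] := ubnP (\dim {:V} - \dim A); elim: k A B => // k IH A B; rewrite ltnS => hk dAB.
have [Af|Af] := eqVneq A fullv.
  have Bf : B = fullv by apply/eqP; rewrite eqEdim subvf -dAB Af leqnn.
  by exists 0%VS; rewrite !addv0 Af Bf subnn dimv0.
have [v [vA vB]] := vector_outside dAB Af.
have dA := dim_add_line vA; have dB := dim_add_line vB.
have leA : (\dim A < \dim {:V})%N by rewrite -dA dimvS // subvf.
have [||D [hA hB dD]] := IH (A + <[v]>)%VS (B + <[v]>)%VS.
- by apply: leq_trans hk; rewrite dA subnS prednK // subn_gt0.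
- by rewrite dA dB dAB.
have hA' : (A + (<[v]> + D))%VS = fullv by rewrite addvA.
exists (<[v]> + D)%VS; split=> //; first by rewrite addvA.
apply/eqP; rewrite eqn_leq; apply/andP; split; last first.
  by rewrite leq_subLR -hA'; exact: dimv_leq_add.
apply: leq_trans (dimv_leq_add _ _) _; rewrite dD dA.
have v0 : v != 0 by apply: contraNneq vA => ->; exact: mem0v.
by rewrite dim_vline v0 add1n subnS prednK // subn_gt0.
Qed.

End CommonComplement.

Section Density.
Variable R : realType.

Lemma meval_line N (p : mpoly N R) (x y : 'rV[R]_N) :
  exists q : {poly R}, forall t, meval ((x + t *: y) 0) p = q.[t].
Proof.
exists (\sum_(u <- msupp p) (mcoeff u p)%:P * \prod_i ((x 0 i)%:P + (y 0 i)%:P * 'X) ^+ u i).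
move=> t; rewrite mevalE horner_sum; apply: eq_bigr => u _.
rewrite hornerM hornerC horner_prod; congr (_ * _); apply: eq_bigr => i _.
by rewrite horner_exp hornerD hornerM !hornerC hornerX !mxE mulrC.
Qed.

Lemma nonroot_near0 (q : {poly R}) (e : R) : q != 0 -> 0 < e ->
  exists t, [/\ 0 < t, t < e & q.[t] != 0].
Proof.
(* There are [size q] candidates, one more than the degree of [q], so not all are roots. The shift
   in [k.+2] keeps each of them strictly below e. *)
move=> q0 e0; pose s := [seq e / (k.+2)%:R | k <- iota 0 (size q)].
have [/allP h|/allPn[t ts qt]] := boolP (all (root q) s); last first.
  have /mapP[k _ tE] := ts; exists t; split; last exact: qt.
    by rewrite tE divr_gt0 // ltr0n.
  by rewrite tE ltr_pdivrMr ?ltr0n // ltr_pMr // ltr1n.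
have us : uniq s.
  rewrite map_inj_uniq ?iota_uniq // => j k /(mulfI (lt0r_neq0 e0)) /invr_inj /eqP.
  by rewrite eqr_nat => /eqP[].
have := max_poly_roots q0 (introT allP h) us.
by rewrite size_map size_iota ltnn.
Qed.

(** Restricted to the line from [x1] to [x0], [p] is a polynomial in one variable that is nonzero at
    1; it therefore has nonroots arbitrarily close to 0. *)
Lemma open_meets_nonzero N (p : mpoly N R) (A : set 'rV[R]_N) (x0 x1 : 'rV[R]_N) :
  open A -> A x1 -> meval (x0 0) p != 0 -> exists x, A x /\ meval ((x : 'rV[R]_N) 0) p != 0.
Proof.
move=> oA Ax1 px0.
have /nbhs_ballP[e e0 he] : nbhs x1 A by apply: open_nbhs_nbhs; split.
have [q qE] := meval_line p x1 (x0 - x1).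
have q0 : q != 0.
  apply: contraNneq px0 => q0; have := qE 1.
  by rewrite scale1r addrC subrK q0 horner0 => ->.
(* A bound for all coordinates of the direction; the 1 keeps it positive when [x0 = x1]. *)
pose M := 1 + \sum_i `|(x0 - x1) 0 i|.
have sum0 : 0 <= \sum_i `|(x0 - x1) 0 i| by apply: sumr_ge0.
have M0 : 0 < M by rewrite ltr_pwDl.
have [t [t0 te qt]] := nonroot_near0 q0 (divr_gt0 e0 M0).
exists (x1 + t *: (x0 - x1)); split; last by rewrite qE.
apply: he; split=> // i j; rewrite /ball /= ord1.
have -> : (x1 + t *: (x0 - x1)) 0 j = x1 0 j + t * (x0 - x1) 0 j by rewrite !mxE.
rewrite opprD addrA subrr add0r normrN normrM (gtr0_norm t0).
have le : `|(x0 - x1) 0 j| <= M.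
  rewrite /M (bigD1 j) //= addrCA ler_wpDr // addr_ge0 //.
  by apply: sumr_ge0.
by apply: le_lt_trans (ler_wpM2l (ltW t0) le) _; rewrite -ltr_pdivlMr.
Qed.

End Density.

Section Grass.
Variables (R : realType) (V : vectType R[i]) (d : nat).
Local Notation C := R[i].
Hypothesis hd : (d <= \dim {:V})%N.
Local Notation m := (\dim {:V} - d)%N.

Lemma complex_mx_surj (A : 'M[C]_(d, m)) : exists x, @complex_mx R V d x = A.
Proof.
exists (row_mx (mxvec (map_mx (@complex.Re R) A)) (mxvec (map_mx (@complex.Im R) A))).
apply/matrixP => i j; rewrite mxE row_mxEl row_mxEr !mxvecE !mxE.
by case: (A i j).
Qed.

(** For a basis of [W0] followed by one of a common complement [D], the chart contains every
    complement of [D], being the space of graphs of linear maps from [W0] to [D]. *)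
Lemma common_chart (W0 W1 : grassmannian V d) :
  exists2 phi, @is_chart R V d phi & exists x0 x1, phi x0 = W0 /\ phi x1 = W1.
Proof.
have /eqP d0 := valP W0; have /eqP d1 := valP W1.
have [|D [h0 h1 dD]] := @common_complement _ V (\val W0) (\val W1); first by rewrite d0 d1.
rewrite d0 in dD.
have cap (W : grassmannian V d) : (\val W + D)%VS = fullv -> (\val W :&: D)%VS = 0%VS.
  move=> hW; have /eqP dW := valP W; have := dimv_sum_cap (\val W) D.
  rewrite hW dW dD subnKC // => /eqP; rewrite -{2}[\dim {:V}]addn0 eqn_add2l dimv_eq0.
  by move=> /eqP.
have sz : size (vbasis (\val W0) ++ vbasis D) == \dim {:V}.
  by rewrite size_cat !size_tuple d0 dD subnKC.
pose e := Tuple sz.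
have he : basis_of fullv e.
  have := cat_basis (introT directv_addP (cap _ h0)) (vbasisP (\val W0)) (vbasisP D).
  by rewrite h0.
have [phi hphi phiE] := chart_exists hd he.
have eD (j : 'I_m) : e`_(d + j) = (vbasis D)`_j.
  have szW : size (vbasis (\val W0)) = d by rewrite size_tuple.
  by rewrite nth_cat szW ltnNge leq_addr /= addKn.
have surj (W : grassmannian V d) : (\val W + D)%VS = fullv -> exists x, phi x = W.
  move=> hW; have /eqP dW := valP W.
  have dec (i : 'I_d) : exists a : 'rV[C]_m, e`_i + \sum_(j < m) a 0 j *: e`_(d + j) \in \val W.
    have : e`_i \in (\val W + D)%VS by rewrite hW memvf.
    move=> /memv_addP[w wW [y yD eE]].
    have szD : size (vbasis D) = m by rewrite size_tuple dD.
    exists (\row_j - coord (vbasis D) (cast_ord (esym dD) j) y).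
    have -> : \sum_(j < m)
        (\row_j - coord (vbasis D) (cast_ord (esym dD) j) y) 0 j *: e`_(d + j) = - y.
      transitivity (\sum_(j < m) - coord (vbasis D) (cast_ord (esym dD) j) y *: (vbasis D)`_j).
        by apply: eq_bigr => j _; rewrite mxE -eD.
      rewrite [in RHS](coord_vbasis yD) -sumrN (reindex (cast_ord dD)) /=; last first.
        by exists (cast_ord (esym dD)) => k _; rewrite ?cast_ordK ?cast_ordKV.
      by apply: eq_bigr => j _; rewrite cast_ordK scaleNr.
    by rewrite eE addrK.
  have /choice[a ha] := dec.
  have [x xE] := complex_mx_surj (\matrix_(i, j) a i 0 j).
  exists x; apply: val_inj; apply/eqP; rewrite phiE eqEdim dim_chart_space // dW leqnn andbT.
  apply/span_subvP => v /mapP[i _ ->].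
  rewrite (eq_bigr (fun j : 'I_m => a i 0 j *: e`_(d + j))); first exact: ha.
  by move=> j _; rewrite xE mxE.
by exists phi => //; have [x0 E0] := surj _ h0; have [x1 E1] := surj _ h1; exists x0, x1.
Qed.

Lemma zariski_open_dense (S : set (grassmannian V d)) :
  @open (weil_grassmannian V d) S -> S !=set0 -> @dense (grassmannian V d) S.
Proof.
move=> oS [W0 SW0] O [W1 OW1] oO.
have [phi hphi [x0 [x1 [E0 E1]]]] := common_chart W0 W1.
have [P SE] := oS phi hphi.
have [p Pp px0] : [set x : 'rV[R]_(d * m + d * m) | exists2 p, P p & meval (x 0) p != 0] x0.
  by rewrite -SE /= E0.
have [|x [Ox px]] := open_meets_nonzero (oO phi hphi) _ px0 (x1 := x1); first by rewrite /= E1.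
exists (phi x); split; first exact: Ox.
have : (phi @^-1` S) x by rewrite SE; exists p.
by [].
Qed.

End Grass.


(** [Q] distinguishes the two loci: [Q P = P] tests [W], and [Q P = 1%:M] tests all of [V]. *)
Lemma constrained_locus_open (R : realType) (H : cqg_algebra R) (V : vectType R[i])
    (rho : V -> (V ⊗ H)%type) (hrho : is_comodule rho) (d : nat)
    (hd : (d <= \dim {:V})%N) (n : nat) (b : n.-tuple V) (hb : basis_of fullv b)
    (hU : is_ucorep (coact_mx b rho)) (l : nat) (S : set (weil_grassmannian V d))
    (Q : 'M[R[i]]_n -> 'M[R[i]]_n) :
  (forall N (P : 'rV[R]_N -> 'M[R[i]]_n), regmx (@regular R N) P ->
     regmx (@regular R N) (fun x => Q (P x))) ->
  (forall W P, proj_on b P (\val W) ->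
     S W <-> generated_mod (coact_mx b rho) (gen_ideal P (coact_mx b rho)) l (Q P)) ->
  open S.
Proof.
move=> regQ SE; rewrite weil_openE => phi [e he phiE].
(* All polynomials whose nonvanishing locus lies inside the preimage of [S] are taken, so it is
   enough to find one of them around each point of that preimage. *)
exists [set p | forall x : 'rV[R]_(d * (\dim {:V} - d) + d * (\dim {:V} - d)),
  meval (x 0) p != 0 -> S (phi x)].
apply/seteqP; split=> [x0 /= Sx0|x [p hp /hp //]].
have hproj x : proj_on b (chart_proj b e x) (\val (phi x)).
  by rewrite phiE; exact: chart_proj_on.
have rP := regular_chart_proj hd hb he.
have gen0 := (SE _ _ (hproj x0)).1 Sx0.
have [h rh [hx0 hh]] := generated_mod_open (@regular_const R _) (@regular_add R _)
  (@regular_mul R _) (@regular_conj R _) hU rP (regQ _ _ rP)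
  (fun x => (hproj x).1.1) gen0.
have [p [px0 hp]] := regular_nonzero rh hx0.
by exists p => // x /hp /hh /(SE _ _ (hproj x)).
Qed.

Theorem corollary1p12 (R : realType) (H : cqg_algebra R) (V : vectType R[i])
    (rho : V -> (V ⊗ H)%type) (hrho : is_comodule rho) (d : nat)
    (hd : (d <= \dim {:V})%N) (l : nat) :
  (@open (weil_grassmannian V d) (constrained_on_sub rho d l) /\
   (constrained_on_sub rho d l !=set0 ->
    @dense (grassmannian V d) (constrained_on_sub rho d l))) /\
  (@open (weil_grassmannian V d) (constrained_on_ambient rho d l) /\
   (constrained_on_ambient rho d l !=set0 ->
    @dense (grassmannian V d) (constrained_on_ambient rho d l))).
Proof.
have [b [hb hU]] := comodule_unitary_basis hrho (cqg_unitarizable hrho).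
have oS : @open (weil_grassmannian V d) (constrained_on_sub rho d l).
  apply: (constrained_locus_open hrho hd hb hU (l := l) (Q := id)) => // W P hP.
  exact: locus_subP.
have oA : @open (weil_grassmannian V d) (constrained_on_ambient rho d l).
  apply: (constrained_locus_open hrho hd hb hU (l := l) (Q := fun=> 1%:M)) => [N P _ i j|W P hP].
    exact: regular_const.
  exact: locus_ambientP.
by split; split=> // ne; exact: zariski_open_dense.
Qed.
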